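(* Let $\psi:(0,\infty)\to(0,\infty)$ be the unique positive solution of $\psi''=\psi^2+\psi$ with $\psi(x)\to\infty$ as $x\to0$ and $\psi(x)\to0$ as $x\to\infty$. For constants $\sigma^2,\eta^2>0$ and every $\alpha>0$ define $$\mathcal{R}(\alpha)=\frac{6\eta^2}{\sigma^2}\left(\frac{2\alpha}{\sigma^2}\,\psi\Big(\sqrt{\tfrac{12\alpha}{\sigma^2}}\Big)-1+\frac{\alpha}{\sigma^2}\right).$$ Then $\mathcal{R}$ extends to $0$ by continuity, with a series expansion as $\alpha\searrow0$ whose first terms are $$\frac{\sigma^2}{6\eta^2}\mathcal{R}(\alpha)=\frac35\Big(\frac{\alpha}{\sigma^2}\Big)^2-\frac27\Big(\frac{\alpha}{\sigma^2}\Big)^3+\frac{3}{25}\Big(\frac{\alpha}{\sigma^2}\Big)^4+O(\alpha^5).$$ Moreover, let $(T,(D_v)_{v\in T},(X_v)_{v\in T},(\Lambda_v)_{v\in T})$ be a decorated branching random walk whose reproduction scheme satisfies Assumptions 1--6 listed in the context (with these $\sigma^2$ and $\eta^2$), and put $$t(r,\alpha)=\frac{\alpha^2}{2\sigma^2}\left(\frac{6\eta^2}{\sigma^2r^2}\right)^2 .$$ Then for every $\alpha>0$, as $r\to\infty$, $$r^2\left(1-\mathbb{E}\Big[e^{-t(r,\alpha)\sum_{v\in T}D_v}\,\Big|\,\sup_{v\in T}\Lambda_v\le r\Big]\right)\longrightarrow\mathcal{R}(\alpha)$$ and $$\mathbb{E}\Big[e^{-t(r,\alpha)\sum_{v\in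 T}D_v}\,\Big|\,\sup_{v\in T}\Lambda_v>r\Big]\longrightarrow\frac{2\alpha}{\sigma^2}\,\psi\Big(\sqrt{\tfrac{12\alpha}{\sigma^2}}\Big).$$
   Context: Let $\mathcal{U}=\bigcup_{n\ge0}\{1,2,\dots\}^n$ be the set of finite words ($\emptyset$ is the empty word). A finite point process on $\mathbb{R}$ is a random finite counting measure; for a counting measure $\mu$, $\sup\mu$ is the supremum of its support, with $\sup\mu=-\infty$ if $\mu=0$. A reproduction scheme is $(\chi,\Lambda,D,(X_i)_{1\le i\le\chi(\mathbb{R})})$ where $\chi$ is a finite point process on $\mathbb{R}$, $(X_i)$ is a measurable enumeration of its atoms ($\chi=\sum_i\delta_{X_i}$), $\Lambda\ge0$ is a random variable with $\Lambda\ge\sup\chi$ a.s., and $D\ge0$ is a random variable; the joint law is otherwise arbitrary. The decorated branching random walk with this scheme is built from i.i.d. copies $(\chi_u,\Lambda^{(u)},D_u,(X^{(u)}_i)_{i})_{u\in\mathcal{U}}$ of the scheme: $T\subset\mathcal{U}$ is the random tree with $\emptyset\in T$ and $uj\in T$ iff $u\in T$ and $1\le j\le\chi_u(\mathbb{R})$; $X_\emptyset=0$, $X_{uj}=X_u+X^{(u)}_j$, and $\Lambda_u=X_u+\Lambda^{(u)}$. Assumptions: (1) $\mathbb{E}[\chi(\mathbb{R})]=1$; (2) $\mathbb{E}[\int x\,d\chi(x)]=0$; (3) $\mathbb{E}[\chi(\mathbb{R})^2]=\sigma^2+1\in(1,\infty)$; (4) $\mathbb{E}[\int x^2\,d\chi(x)]=\eta^2\in(0,\infty)$;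 (5) $\mathbb{P}(\Lambda>r)=o(r^{-4})$ as $r\to\infty$; (6) $\mathbb{E}[D]=1$. *)

(* Defs.v *)
From HB Require Import structures.
From mathcomp Require Import all_boot all_order all_algebra finmap.
From mathcomp Require Import all_classical all_reals all_analysis.

Set Implicit Arguments.
Unset Strict Implicit.
Unset Printing Implicit Defensive.

Import Order.TTheory GRing.Theory Num.Theory.
Import numFieldNormedType.Exports.

Local Open Scope classical_set_scope.
Local Open Scope ring_scope.

Section profile.
Context {R : realType}.

(* Only the restriction of psi to ]0, +oo[ is relevant: a function on the open
   half-line is represented by an arbitrary extension to R. *)
Definition is_profile (psi : R -> R) : Prop :=
  [/\ forall x : R, 0 < x -> 0 < psi x,
      forall x : R, 0 < x ->
        [/\ derivable psi x 1, derivable (derive1 psi) x 1 &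
            derive1 (derive1 psi) x = psi x ^+ 2 + psi x],
      psi x @[x --> 0^'+] --> +oo%R &
      psi x @[x --> +oo%R] --> (0 : R)].

Definition profile_at (psi : R -> R) (sigma2 alpha : R) : R :=
  2 * alpha / sigma2 * psi (Num.sqrt (12 * alpha / sigma2)).

Definition rate (psi : R -> R) (sigma2 eta2 alpha : R) : R :=
  6 * eta2 / sigma2 * (profile_at psi sigma2 alpha - 1 + alpha / sigma2).

Definition laplace_parameter (sigma2 eta2 r alpha : R) : R :=
  alpha ^+ 2 / (2 * sigma2) * (6 * eta2 / (sigma2 * r ^+ 2)) ^+ 2.

End profile.

Definition msupport {R : realType} (mu : {measure set R -> \bar R}) : set R :=
  [set x | forall U : set R, open U -> U x -> (0 < mu U)%E].

(* Equal to -oo when mu = 0. *)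
Definition sup_support {R : realType} (mu : {measure set R -> \bar R}) : \bar R :=
  ereal_sup [set x%:E | x in msupport mu].

Definition atomic {R : realType} (n : nat) (x : nat -> R) :
    {measure set R -> \bar R} :=
  msum (fun i => dirac (x i)) n.

(* The atoms X_1, ..., X_n of the point process are atom 0, ..., atom n.-1 with
   n = natoms. The entries of index >= natoms carry no information: they are
   set to 0, so that (natoms, atom) encodes exactly a random finite sequence. *)
Record scheme {R : realType} {d : measure_display} {T : measurableType d}
    (P : probability T R) := Scheme {
  natoms : {RV P >-> nat};
  atom : nat -> {RV P >-> R};
  lambda : {RV P >-> R};
  decor : {RV P >-> R};
  atom_out : forall w i, (natoms w <= i)%N -> atom i w = 0;
  lambda_ge0 : forall w, 0 <= lambda w;
  decor_ge0 : forall w, 0 <= decor w;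
  lambda_ge_sup : {ae P, forall w,
    (sup_support (atomic (natoms w) (fun i => atom i w)) <= (lambda w)%:E)%E}
}.

Definition chi {R : realType} {d : measure_display} {T : measurableType d}
    {P : probability T R} (s : scheme P) (w : T) : {measure set R -> \bar R} :=
  atomic (natoms s w) (fun i => atom s i w).

Definition mark (R : realType) : Type := nat * (nat -> R) * R * R.

(* The sigma-algebra on marks generated by the coordinates. *)
Definition mark_events (R : realType) : set (set (mark R)) :=
  <<s [set (fun m : mark R => m.1.1.1) @^-1` A | A in measurable] `|`
      \bigcup_i [set (fun m : mark R => m.1.1.2 i) @^-1` B | B in measurable] `|`
      [set (fun m : mark R => m.1.2) @^-1` B | B in measurable] `|`
      [set (fun m : mark R => m.2) @^-1` B | B in measurable] >>.

Definition mark_of {R : realType} {d : measure_display} {T : measurableType d}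
    {P : probability T R} (s : scheme P) (w : T) : mark R :=
  (natoms s w, fun i => atom s i w, lambda s w, decor s w).

Definition same_law {R : realType}
    {d0 : measure_display} {T0 : measurableType d0} {P0 : probability T0 R}
    {d : measure_display} {T : measurableType d} {P : probability T R}
    (s0 : scheme P0) (s : scheme P) : Prop :=
  forall A, mark_events A -> P (mark_of s @^-1` A) = P0 (mark_of s0 @^-1` A).

Definition independent_schemes {R : realType}
    {d : measure_display} {T : measurableType d} {P : probability T R}
    {I : choiceType} (S : I -> scheme P) : Prop :=
  forall (J : {fset I}) (A : I -> set (mark R)),
    (forall i, i \in J -> mark_events (A i)) ->
    P (\bigcap_(i in [set` J]) (mark_of (S i) @^-1` A i)) =
    (\prod_(i <- J) P (mark_of (S i) @^-1` A i))%E.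

Section moments.
Context {R : realType} {d : measure_display} {T : measurableType d}
  {P : probability T R}.
Local Open Scope ereal_scope.

Definition standing_assumptions (s : scheme P) (sigma2 eta2 : R) : Prop :=
  [/\ \int[P]_w chi s w setT = 1,
      \int[P]_w \int[chi s w]_x x%:E = 0,
      (0 < sigma2)%R /\ \int[P]_w (chi s w setT) ^+ 2 = (sigma2 + 1)%:E,
      (0 < eta2)%R /\ \int[P]_w \int[chi s w]_x (x ^+ 2)%:E = eta2%:E &
      (forall eps : R, (0 < eps)%R -> \forall r \near +oo%R,
         P [set w | (r < lambda s w)%R] <= (eps * r ^- 4)%:E) /\
      'E_P[decor s] = 1].

End moments.

(* Words over {1, 2, ...} are encoded as sequences of natural numbers, the
   letter j standing for j.+1. *)
Definition word := seq nat.

Section branching_random_walk.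
Context {R : realType} {d : measure_display} {T : measurableType d}
  {P : probability T R}.
Implicit Types (S : word -> scheme P) (u v : word) (w : T).

Definition tree S w : set word :=
  [set u | forall k, (k < size u)%N ->
             (nth 0%N u k < natoms (S (take k u)) w)%N].

Definition position S u w : R :=
  \sum_(k < size u) atom (S (take k u)) (nth 0%N u k) w.

Definition Lambda S u w : R := position S u w + lambda (S u) w.

Lemma tree_nil S w : tree S w [::].
Proof. by []. Qed.

Lemma tree_rcons S w u j :
  tree S w (rcons u j) <-> tree S w u /\ (j < natoms (S u) w)%N.
Proof.
rewrite /tree /= size_rcons; split=> [H|[H Hj] k].
  split=> [k ku|]; last first.
    by have := H (size u) (ltnSn _); rewrite nth_rcons ltnn eqxx -cats1 take_size_cat.
  have := H k (ltnW ku).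
  by rewrite nth_rcons ku -cats1 takel_cat // ltnW.
rewrite ltnS leq_eqVlt => /predU1P[->|ku].
  by rewrite nth_rcons ltnn eqxx -cats1 take_size_cat.
by rewrite nth_rcons ku -cats1 takel_cat ?(ltnW ku) //; exact: H.
Qed.

Lemma position_nil S w : position S [::] w = 0.
Proof. by rewrite /position big_ord0. Qed.

Lemma position_rcons S w u j :
  position S (rcons u j) w = position S u w + atom (S u) j w.
Proof.
rewrite /position size_rcons big_ord_recr /= nth_rcons ltnn eqxx -cats1.
rewrite take_size_cat //; congr (_ + _); apply: eq_bigr => k _.
by rewrite nth_cat ltn_ord takel_cat // ltnW.
Qed.

Definition sup_Lambda S w : \bar R :=
  ereal_sup [set (Lambda S v w)%:E | v in tree S w].

(* May be +oo where the tree is infinite. *)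
Definition total_decor S w : \bar R :=
  (\esum_(v in tree S w) (decor (S v) w)%:E)%E.

End branching_random_walk.

(* The elementary conditional expectation E[Y | A], meaningful when P A > 0. *)
Definition cond_expectation {R : realType} {d : measure_display}
    {T : measurableType d} (P : probability T R) (Y : T -> \bar R) (A : set T) : R :=
  fine (\int[P]_(w in A) Y w)%E / fine (P A).

(* Main.v *)
Require Import Defs.
From HB Require Import structures.
From mathcomp Require Import all_boot all_order all_algebra finmap.
From mathcomp Require Import all_classical all_reals all_analysis.
From mathcomp Require Import measurable_realfun ring lra zify.

Set Implicit Arguments.
Unset Strict Implicit.
Unset Printing Implicit Defensive.

Import Order.TTheory GRing.Theory Num.Theory.
Import numFieldNormedType.Exports.

Local Open Scope classical_set_scope.
Local Open Scope ring_scope.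

(** The profile equation has the explicit solution
    psi x = 3/2 (coth (x/2) ^ 2 - 1) = 6 e^x / (e^x - 1)^2.
A solution vanishing at infinity has zero energy psi'^2 - psi^2 - 2/3 psi^3, so
v = - psi' / psi satisfies v^2 = 1 + 2/3 psi and the Riccati equation
v' = (1 - v^2) / 2; hence v is a translate of coth (x/2), and the blow-up at 0
leaves only the trivial translation ([profile_unique]).  With
a = alpha / sigma2, the quantity 2 a psi (sqrt (12 a)) is z / sinh^2 (sqrt z) at
z = 3 a, the reciprocal of an entire series with first coefficient 1: inverting
that series gives the expansion ([rate_series], [rate_estimate]).

For the walk, let F_t y be the expectation of exp (- t sum_v D_v) on the event
sup Lambda <= y.  By independence of the subtrees of the children of the root
([integral_subtree]), F_t is the decreasing limit of the iterates, started
from 1, of the branching operator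
    Phi_t F y = E [e^(-t D) 1_(Lambda <= y) prod_(i <= N) F (y - X_i)].
For large y the defect w = 1 - F_t is small.  A second order expansion of
Phi_t F = F, in which the mean number of children is 1, their mean displacement
0, and the second moments are sigma2 for N (N - 1) and eta2 for the sum of the
X_i^2, gives
    eta2 / 2 w'' = sigma2 / 2 w^2 - t.
With k = sigma2 / eta2 and t = sigma2 / 2 w0^2, this is w'' = k (w^2 - w0^2),
and the solution which blows up at 0 and tends to w0 at infinity is
V y = 2 w0 psi (sqrt (2 k w0) y) + w0 ([stationary]).

The expansion is made rigorous by comparison.  Multiplying V by 1 + eps or by
1 - eps breaks the balance between its linear and its quadratic terms by an
amount of order eps V^2, which absorbs every error term: the tail
o (r^-4) of Lambda is exactly what makes the displacements comparable to y
negligible against V^2, which decays no faster than y^-4.  So 1 - (1 + eps) V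
and 1 - (1 - eps) V are a sub- and a supersolution of Phi_t far enough from the
barrier, uniformly in w0 ([branching_ge_stationary],
[branching_le_stationary]); criticality and sigma2 > 0 force extinction and an
a priori bound on w, which provide the boundary conditions.  As a
consequence w lies between translates of (1 - eps) V and (1 + eps) V by
constants which do not depend on t ([defect_ge_stationary],
[defect_le_stationary]).

For t = t(r, alpha) one finds w0 = a c / r^2 with c = 6 eta2 / sigma2, and
r^2 V r = c (2 a psi (sqrt (12 a)) + a) for every r, so that r^2 (1 - F_t r)
tends to this value.  Letting the barrier go to infinity at fixed t gives
r^2 (1 - E e^(-t sum D)) --> c a, and letting alpha tend to 0 gives
r^2 P (sup Lambda > r) --> c.  Both conditional expectations are quotients of
these three quantities ([conditional_limits]). *)

(** * An explicit solution of the profile equation *)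

Lemma MVT_pos (R : realType) (f df : R -> R) (a b : R) :
  (forall x : R, 0 < x -> is_derive x 1 f (df x)) -> 0 < a -> a < b ->
  exists2 c, a < c < b & f b - f a = df c * (b - a).
Proof.
move=> fdf a0 ab; have [||c] := @MVT R f df a b ab.
- by move=> x /[!in_itv]/= /andP[ax _]; apply: fdf; exact: lt_trans ax.
- apply: derivable_within_continuous => x /[!in_itv]/= /andP[ax _].
  by have [] := fdf x (lt_le_trans a0 ax).
by move=> /[!in_itv]/= cab e; exists c.
Qed.

Lemma nondecreasing_pos (R : realType) (f df : R -> R) (a b : R) :
  (forall x : R, 0 < x -> is_derive x 1 f (df x)) ->
  (forall x : R, 0 < x -> 0 <= df x) -> 0 < a -> a <= b -> f a <= f b.
Proof.
move=> fdf df0 a0; rewrite le_eqVlt => /predU1P[->//|ab].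
have [c /andP[ac _] e] := MVT_pos fdf a0 ab.
by rewrite -subr_ge0 e mulr_ge0 ?subr_ge0 ?(ltW ab)// df0// (lt_trans a0).
Qed.

Lemma constant_pos (R : realType) (f : R -> R) :
  (forall x : R, 0 < x -> is_derive x 1 f 0) ->
  forall a b, 0 < a -> 0 < b -> f a = f b.
Proof.
move=> fdf; suff h a b : 0 < a -> a <= b -> f a = f b.
  by move=> a b a0 b0; case/orP: (le_total a b) => ab; [|symmetry]; exact: h.
move=> a0; rewrite le_eqVlt => /predU1P[->//|ab].
have [c _ /eqP] := MVT_pos fdf a0 ab.
by rewrite mul0r subr_eq0 => /eqP.
Qed.

Section hyperbolic.
Context {R : realType}.
Implicit Types x y : R.

(** This is [coth (x / 2)]. *)
Definition hcoth x : R := (expR x + 1) / (expR x - 1).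

(** The solution of the profile equation, expressed through [hcoth] because the
    Riccati equation [hcoth' = (1 - hcoth ^+ 2) / 2] makes all its derivatives
    polynomials in [hcoth]. *)
Definition profile x : R := 3 / 2 * (hcoth x ^+ 2 - 1).

Lemma expRB1_gt0 x : 0 < x -> 0 < expR x - 1.
Proof. by move=> x0; rewrite subr_gt0 -expR0 ltr_expR. Qed.

Lemma hcoth_gt1 x : 0 < x -> 1 < hcoth x.
Proof.
move=> x0; have := expRB1_gt0 x0 => e0.
by rewrite /hcoth ltr_pdivlMr// mul1r ltrD2l; lra.
Qed.

Lemma profileE x : 0 < x -> profile x = 6 * expR x / (expR x - 1) ^+ 2.
Proof.
move=> /expRB1_gt0 e0; rewrite /profile /hcoth; field.
by rewrite gt_eqF.
Qed.

Lemma profile_gt0 x : 0 < x -> 0 < profile x.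
Proof.
move=> x0; rewrite profileE//; apply: divr_gt0.
  by rewrite mulr_gt0 ?expR_gt0.
by rewrite exprn_gt0// expRB1_gt0.
Qed.

Lemma is_derive_hcoth x : 0 < x -> is_derive x 1 hcoth ((1 - hcoth x ^+ 2) / 2).
Proof.
move=> x0; have e0 := expRB1_gt0 x0.
have d1 : is_derive x 1 (fun y => expR y + 1 : R) (expR x).
  by apply: is_derive_eq; rewrite addr0.
have d2 : is_derive x 1 (fun y => expR y - 1 : R) (expR x).
  by apply: is_derive_eq; rewrite oppr0 addr0.
have d3 := @is_deriveV R (fun y => expR y - 1 : R) x _ _ (lt0r_neq0 e0) d2.
apply: (@is_derive_eq _ _ _ _ _ _ _ _ (is_deriveM d1 d3)).
rewrite /hcoth /= !/GRing.scale/=; field; rewrite gt_eqF//.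
Qed.

Lemma is_derive_profile x :
  0 < x -> is_derive x 1 profile (- hcoth x * profile x).
Proof.
move=> x0; have d := is_derive_hcoth x0.
have -> : profile = (fun y : R => (3 / 2) *: ((hcoth y ^+ 2 : R) - 1)).
  by apply/funext => y; rewrite /GRing.scale.
have dd := is_deriveX 2 d.
apply: is_derive_eq; rewrite !/GRing.scale/= expr1; lra.
Qed.

Lemma is_derive_profile2 x : 0 < x ->
  is_derive x 1 (fun y => - hcoth y * profile y) (profile x ^+ 2 + profile x).
Proof.
move=> x0; have d := is_derive_hcoth x0; have d' := is_derive_profile x0.
have dd := is_deriveN d.
apply: (@is_derive_eq _ _ _ _ _ _ _ _ (is_deriveM dd d')).
rewrite /= !/GRing.scale/= ?fctE/= /profile; lra.
Qed.

End hyperbolic.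

(** The rules of differentiation for functions given by pointwise expressions. *)
Section derive_arith.
Context {R : realType}.
Implicit Types (f g : R -> R) (x a b c : R).

Lemma is_deriveMf f g x a b : is_derive x 1 f a -> is_derive x 1 g b ->
  is_derive x 1 (fun y => f y * g y) (f x * b + g x * a).
Proof. by move=> fa gb; exact: is_deriveM. Qed.

Lemma is_deriveDf f g x a b : is_derive x 1 f a -> is_derive x 1 g b ->
  is_derive x 1 (fun y => f y + g y) (a + b).
Proof. by move=> fa gb; exact: is_deriveD. Qed.

Lemma is_deriveBf f g x a b : is_derive x 1 f a -> is_derive x 1 g b ->
  is_derive x 1 (fun y => f y - g y) (a - b).
Proof. by move=> fa gb; exact: is_deriveB. Qed.

Lemma is_deriveNf f x a : is_derive x 1 f a -> is_derive x 1 (fun y => - f y) (- a).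
Proof. by move=> fa; exact: is_deriveN. Qed.

Lemma is_deriveZf f x a c : is_derive x 1 f a ->
  is_derive x 1 (fun y => c * f y) (c * a).
Proof. by move=> fa; exact: is_deriveZ. Qed.

Lemma is_deriveXf f n x a : is_derive x 1 f a ->
  is_derive x 1 (fun y => f y ^+ n) (n%:R * f x ^+ n.-1 * a).
Proof. by move=> fa; have := is_deriveX n fa; rewrite exprfctE. Qed.

Lemma is_derive_affine f x a b c : is_derive (c * x + b) 1 f a ->
  is_derive x 1 (fun y => f (c * y + b)) (c * a).
Proof.
move=> fa.
have h : is_derive x 1 (fun y : R => c * y + b) c.
  have := is_deriveDf (is_deriveZf c (is_derive_id x 1)) (is_derive_cst b x 1).
  by move=> hh; apply: is_derive_eq; rewrite addr0 mulr1.
have := @is_derive1_comp R f (fun y : R => c * y + b) x _ _ fa h.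
by move=> hh; apply: is_derive_eq; rewrite mulrC.
Qed.

End derive_arith.

Section profile_limits.
Context {R : realType}.
Implicit Types x y : R.

(** From [e^x - 1 <= x e^x]; the factor [e^(-x)] tends to 1 at 0, whence the blow-up. *)
Lemma profile_ge x : 0 < x -> 6 * expR (- x) / x ^+ 2 <= profile x.
Proof.
move=> x0; have e0 := expRB1_gt0 x0; rewrite profileE//.
rewrite ler_pdivrMr ?exprn_gt0// mulrAC ler_pdivlMr ?exprn_gt0// expRN.
have E0 := expR_gt0 x.
suff h : expR x - 1 <= x * expR x.
  have h2 : (expR x - 1) ^+ 2 <= (x * expR x) ^+ 2.
    by apply: lerXn2r h; rewrite nnegrE ?mulr_ge0// ltW.
  rewrite -subr_ge0.
  have -> : 6 * expR x * x ^+ 2 - 6 / expR x * (expR x - 1) ^+ 2 =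
     6 / expR x * ((x * expR x) ^+ 2 - (expR x - 1) ^+ 2).
    by field; rewrite gt_eqF.
  by rewrite mulr_ge0 ?subr_ge0// divr_ge0// ltW.
have := expR_ge1Dx (- x); rewrite expRN => h.
have : (1 - x) * expR x <= 1 by rewrite -ler_pdivlMr// mul1r.
lra.
Qed.

(** From [e^x = E ^+ 2] with [E >= 1 + x / 2], which gives [x E <= 2 (E ^+ 2 - 1)]. *)
Lemma profile_le x : 0 < x -> profile x <= 24 / x ^+ 2.
Proof.
move=> x0; have e0 := expRB1_gt0 x0; rewrite profileE//.
rewrite ler_pdivrMr ?exprn_gt0// mulrAC ler_pdivlMr ?exprn_gt0//.
have -> : expR x = expR (x / 2) ^+ 2 by rewrite -expRM_natl; congr expR; lra.
have := expR_ge1Dx (x / 2); set E := expR (x / 2) => h.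
have h1 : x * E <= 2 * (E ^+ 2 - 1) by nra.
have h2 : (x * E) ^+ 2 <= (2 * (E ^+ 2 - 1)) ^+ 2.
  by apply: lerXn2r h1; rewrite nnegrE; nra.
nra.
Qed.

Lemma is_profile_profile : is_profile (@profile R).
Proof.
have D x : 0 < x -> derive1 profile x = - hcoth x * profile x.
  by move=> x0; rewrite derive1E; have [_ <-] := is_derive_profile x0.
have nD x : 0 < x -> \near x, - hcoth x * profile x = derive1 profile x.
  by move=> x0; near=> y; rewrite D//; near: y; exact: lt_nbhsr.
split.
- by move=> x x0; exact: profile_gt0.
- move=> x x0; have [d e] := is_derive_profile x0.
  have [d2 e2] := near_eq_is_derive (nD _ x0) (is_derive_profile2 x0).
  by split; [exact: d|exact: d2|rewrite derive1E e2].
- apply/cvgryPge => A; near=> x.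
  have x0 : 0 < x by near: x; exact: nbhs_right_gt.
  apply: le_trans (profile_ge x0).
  have x1 : x <= 1 / 2 by near: x; exact: nbhs_right_le.
  have xA : x <= (`|A| + 1)^-1.
    by near: x; apply: nbhs_right_le; rewrite invr_gt0 ltr_wpDl.
  have h : 1 / 2 <= expR (- x) by apply: le_trans (expR_ge1Dx _); lra.
  apply: (@le_trans _ _ (x^-1)).
    have A1 : 0 < `|A| + 1 by rewrite ltr_wpDl.
    rewrite -[A]invrK; have [A0|A0] := ltP 0 A; last first.
      by rewrite invrK (le_trans A0)// invr_ge0 ltW.
    rewrite lef_pV2 ?posrE ?invr_gt0//; apply: le_trans xA _.
    by rewrite lef_pV2 ?posrE//; have := ler_norm A; lra.
  rewrite ler_pdivlMr ?exprn_gt0// expr2 mulrA mulVf ?gt_eqF// mul1r; lra.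
- apply/cvgrPdist_le => e e0; near=> x.
  have x0 : 0 < x by near: x; exact: nbhs_pinfty_gt.
  have x1 : 1 <= x by near: x; exact: nbhs_pinfty_ge.
  have xe : 24 / e <= x by near: x; apply: nbhs_pinfty_ge; exact: num_real.
  rewrite sub0r normrN gtr0_norm ?profile_gt0//; apply: le_trans (profile_le x0) _.
  rewrite ler_pdivrMr ?exprn_gt0//.
  move: xe; rewrite ler_pdivrMr// => xe; nra.
Unshelve. all: by end_near.
Qed.

End profile_limits.

(** * Uniqueness of the profile *)

Section uniqueness.
Context {R : realType}.
Implicit Types x y a b e : R.
Variable psi : R -> R.
Hypothesis psiP : is_profile psi.
Let p : R -> R := derive1 psi.

Let psi_gt0 x : 0 < x -> 0 < psi x. Proof. by have [h _ _ _] := psiP; exact: h. Qed.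

Let is_derive_psi x : 0 < x -> is_derive x 1 psi (p x).
Proof.
move=> x0; have [_ h _ _] := psiP; have [d _ _] := h x x0.
by rewrite /p derive1E; exact: derivableP.
Qed.

Let is_derive_p x : 0 < x -> is_derive x 1 p (psi x ^+ 2 + psi x).
Proof.
move=> x0; have [_ h _ _] := psiP; have [_ d <-] := h x x0.
by rewrite derive1E; exact: derivableP.
Qed.

Let psi_small e : 0 < e -> exists2 x0 : R, 0 < x0 & forall x, x0 <= x -> psi x <= e.
Proof.
move=> e0; have [_ _ _ /cvgrPdist_le/(_ e e0)[M [_ h]]] := psiP.
exists (`|M| + 1); first by rewrite ltr_wpDl.
move=> x Mx; have := h x; rewrite sub0r normrN => /(_ _)/(le_trans (ler_norm _)); apply.
by have := ler_norm M; lra.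
Qed.

Let p_mono a b : 0 < a -> a <= b -> p a <= p b.
Proof.
apply: nondecreasing_pos is_derive_p _ => x x0.
by rewrite addr_ge0 ?sqr_ge0// ltW// psi_gt0.
Qed.

(** [psi'' > 0] makes [p] increase, so a positive value would persist and keep [psi]
    away from 0 at infinity. *)
Let p_le0 x : 0 < x -> p x <= 0.
Proof.
move=> x0; rewrite leNgt; apply/negP => px.
have [y0 y00 hy] := psi_small (divr_gt0 (psi_gt0 x0) (ltr0n _ 2)).
pose y := x + y0 + 1.
have xy : x < y by rewrite /y; lra.
have [c /andP[xc _] e] := MVT_pos is_derive_psi x0 xy.
have pc : 0 <= p c by apply: le_trans (ltW px) (p_mono x0 (ltW xc)).
have h1 : 0 <= psi y - psi x by rewrite e mulr_ge0// subr_ge0 ltW.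
have h2 : psi y <= psi x / 2 by apply: hy; rewrite /y; lra.
have := psi_gt0 x0; lra.
Qed.

(** The energy [p ^+ 2 - 2 / 3 psi ^+ 3 - psi ^+ 2] is constant; it is arbitrarily
    small far out, where [psi] is small and the mean value theorem makes [p] small. *)
Let energy x : 0 < x -> p x ^+ 2 = psi x ^+ 2 * (1 + 2 / 3 * psi x).
Proof.
move=> x0.
pose E y : R := p y ^+ 2 - (2 / 3 * psi y ^+ 3 + psi y ^+ 2).
have dE y : 0 < y -> is_derive y 1 E 0.
  move=> y0; have d1 := is_derive_p y0; have d2 := is_derive_psi y0.
  have := is_deriveBf (is_deriveXf 2 d1)
    (is_deriveDf (is_deriveZf (2 / 3) (is_deriveXf 3 d2)) (is_deriveXf 2 d2)).
  by move=> d; apply: is_derive_eq; rewrite /=; lra.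
suff : E x = 0 by rewrite /E; lra.
apply/eqP; rewrite -normr_eq0 eq_le normr_ge0 andbT; apply/ler_addgt0Pl => e e0.
rewrite addr0.
pose d := Num.min 1 (e / 3).
have d0 : 0 < d by rewrite lt_min ltr01 divr_gt0.
have d1 : d <= 1 by rewrite ge_min lexx.
have de : d <= e / 3 by rewrite ge_min lexx orbT.
have [y0 y00 hy] := psi_small d0.
have y1 : 0 < y0 + 1 by lra.
have yy : y0 < y0 + 1 by lra.
rewrite (constant_pos dE x0 y1).
have [c /andP[cy cy1] ec] := MVT_pos is_derive_psi y00 yy.
have c0 : 0 < c by lra.
have k1 : p c <= p (y0 + 1) by apply: p_mono => //; exact: ltW.
have k2 : p (y0 + 1) <= 0 by exact: p_le0.
have k3 : psi y0 <= d by apply: hy.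
have k4 : psi (y0 + 1) <= d by apply: hy; lra.
have k5 := psi_gt0 y00; have k6 := psi_gt0 y1.
have k7 : - d <= p (y0 + 1) by apply: le_trans k1; move: ec; rewrite addrAC subrr add0r mulr1; lra.
rewrite /E; set a := p (y0 + 1) in k1 k2 k7 *; set b := psi (y0 + 1) in k4 k6 *.
have a2 : a ^+ 2 <= d by nra.
have b2 : b ^+ 2 <= d by nra.
have b3 : b ^+ 3 <= d by rewrite exprS; nra.
have b30 : 0 <= b ^+ 3 by rewrite exprn_ge0// ltW.
have := sqr_ge0 a; have := sqr_ge0 b.
move=> b20 a20; rewrite ler_norml; apply/andP; split; lra.
Qed.

(** With zero energy, [v = - psi' / psi] solves [v' = (1 - v ^+ 2) / 2], so
    [(v + 1) / (v - 1) = k e^x] for a constant [k].  As [v > 1] near 0, [k >= 1];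
    if [k > 1] then [psi] stays bounded near 0.  For [k = 1], [v] is [hcoth]. *)
Lemma profile_unique x : 0 < x -> psi x = profile x.
Proof.
pose v y : R := - p y / psi y.
have psi_neq0 y : 0 < y -> psi y != 0 by move=> y0; rewrite gt_eqF// psi_gt0.
have v2 y : 0 < y -> v y ^+ 2 = 1 + 2 / 3 * psi y.
  move=> y0; rewrite /v expr_div_n sqrrN energy//; field; exact: psi_neq0.
have v1 y : 0 < y -> 1 < v y.
  move=> y0; have vy0 : 0 <= v y.
    by rewrite /v divr_ge0// ?oppr_ge0 ?p_le0// ltW// psi_gt0.
  have := v2 y y0; have := psi_gt0 y0 => a b; nra.
have v1N y : 0 < y -> v y - 1 != 0 by move=> y0; rewrite subr_eq0 gt_eqF// v1.
have dv y : 0 < y -> is_derive y 1 v ((1 - v y ^+ 2) / 2).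
  move=> y0; have d1 := is_derive_p y0; have d2 := is_derive_psi y0.
  have d := is_deriveMf (is_deriveNf d1) (is_deriveV (psi_neq0 _ y0) d2).
  apply: is_derive_eq; rewrite v2// /GRing.scale/=.
  have E := energy y0; have n0 := psi_neq0 _ y0.
  transitivity (p y ^+ 2 / psi y ^+ 2 - psi y - 1); first by field.
  rewrite E; field; exact: n0.
pose u y : R := (v y + 1) / (v y - 1) * expR (- y).
have du y : 0 < y -> is_derive y 1 u 0.
  move=> y0; have d := dv _ y0.
  have d1 := is_deriveDf d (is_derive_cst (1 : R) y 1).
  have d2 := is_deriveBf d (is_derive_cst (1 : R) y 1).
  have d3 := is_deriveMf d1 (@is_deriveV R (fun z : R => v z - 1) y _ 1 (v1N _ y0) d2).
  have e1 := is_derive1_comp (is_derive_expR _) (is_deriveNf (is_derive_id y 1)).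
  have d4 := is_deriveMf d3 e1.
  apply: is_derive_eq; rewrite /GRing.scale/=; field; exact: v1N.
(* any point determines the constant value of u *)
pose k := u 1.
have uk y : 0 < y -> u y = k by move=> y0; exact: constant_pos du _ _ y0 ltr01.
have ek y : 0 < y -> (v y + 1) / (v y - 1) = k * expR y.
  by move=> y0; rewrite -(uk _ y0) /u expRN mulfVK// gt_eqF// expR_gt0.
have kE y : 0 < y -> 1 < k * expR y.
  move=> y0; rewrite -ek// ltr_pdivlMr ?mul1r ?subr_gt0 ?v1//.
  lra.
have vE y : 0 < y -> v y = (k * expR y + 1) / (k * expR y - 1).
  move=> y0; have n1 := v1N _ y0.
  have h : k * expR y - 1 != 0 by rewrite subr_eq0 gt_eqF// kE.
  apply/(mulIf h); rewrite mulfVK// -ek//; field; exact: n1.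
have psiE y : 0 < y -> psi y = 6 * (k * expR y) / (k * expR y - 1) ^+ 2.
  move=> y0; have := v2 _ y0; rewrite vE// => h.
  have n1 : k * expR y - 1 != 0 by rewrite subr_eq0 gt_eqF// kE.
  have -> : psi y = 3 / 2 * (((k * expR y + 1) / (k * expR y - 1)) ^+ 2 - 1) by lra.
  by field.
have k1 : 1 <= k.
  apply/ler_addgt0Pl => e e0.
  have [e1|e1] := ltP e 1; last first.
    have := kE 1 ltr01; have := expR_gt0 (1 : R) => a b.
    have : 0 < k by rewrite -(pmulr_lgt0 _ a); lra.
    lra.
  have := kE e e0; have := expR_ge1Dx (- e); rewrite expRN.
  have E0 := expR_gt0 e => h1 h2.
  have : (expR e)^-1 < k by rewrite -[X in X < _]mul1r ltr_pdivrMr.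
  lra.
have {k1}k1 : k = 1.
  apply/eqP; rewrite eq_le k1 andbT leNgt; apply/negP => kgt.
  have [_ _ h _] := psiP.
  have /cvgryPge/(_ (6 * (k * expR 1) / (k - 1) ^+ 2 + 1)) := h => hh.
  have [y [y0 y1 hy]] : exists y : R, [/\ 0 < y, y <= 1 &
      6 * (k * expR 1) / (k - 1) ^+ 2 + 1 <= psi y].
    near (0 : R)^'+ => y; exists y; split; near: y => //.
    - exact: nbhs_right_gt.
    - exact: nbhs_right_le.
  move: hy; rewrite psiE//; apply/negP; rewrite -ltNge.
  apply: (@le_lt_trans _ _ (6 * (k * expR 1) / (k - 1) ^+ 2)); last by rewrite ltrDl.
  have kp : 0 < k by lra.
  have e1 : 1 <= expR y by have := expR_ge1Dx y; lra.
  have km1 : k - 1 <= k * expR y - 1.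
    by rewrite lerD2r -[X in X <= _]mulr1 ler_pM2l.
  apply: ler_pM.
  - apply: mulr_ge0 => //; apply: mulr_ge0; [exact: ltW|exact: expR_ge0].
  - by rewrite invr_ge0 exprn_ge0//; lra.
  - by rewrite ler_pM2l// ler_pM2l// ler_expR.
  - rewrite lef_pV2 ?posrE ?exprn_gt0 ?subr_gt0//; last by rewrite kE.
    by apply: lerXn2r km1; rewrite nnegrE; have := kE _ y0; lra.
by move=> x0; rewrite psiE// profileE// k1 mul1r.
Unshelve. all: by end_near.
Qed.

End uniqueness.

(** * Power series expansion of the rate *)

Section reciprocal_series.
Context {R : realType}.
Variable f : nat -> R.

(** The coefficients of the inverse power series of [f]: each one is given by all
    the previous ones, so the whole list is built by recursion. *)
Fixpoint recip_seq (n : nat) : seq R :=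
  if n is m.+1 then
    rcons (recip_seq m) (- \sum_(k < m.+1) f k.+1 * nth 0 (recip_seq m) (m - k))
  else [:: 1].

Definition recip (n : nat) : R := nth 0 (recip_seq n) n.

Lemma size_recip_seq n : size (recip_seq n) = n.+1.
Proof. by elim: n => //= n ih; rewrite size_rcons ih. Qed.

Lemma nth_recip_seq n i : (i <= n)%N -> nth 0 (recip_seq n) i = recip i.
Proof.
elim: n => [|n ih]; first by rewrite leqn0 => /eqP ->.
rewrite leq_eqVlt => /predU1P[->//|]; rewrite ltnS => ni.
by rewrite /= nth_rcons size_recip_seq ltnS ni ih.
Qed.

Lemma recip0 : recip 0 = 1. Proof. by []. Qed.

Lemma recipS n : recip n.+1 = - \sum_(k < n.+1) f k.+1 * recip (n - k).
Proof.
rewrite /recip /= nth_rcons size_recip_seq ltnn eqxx; congr (- _).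
by apply: eq_bigr => k _; rewrite nth_recip_seq// leq_subr.
Qed.

Hypothesis f0 : f 0 = 1.

Lemma recip_conv n : \sum_(k < n.+1) f k * recip (n - k) = (n == 0%N)%:R.
Proof.
case: n => [|n]; first by rewrite big_ord_recl big_ord0 f0 recip0 mulr1 addr0.
by rewrite big_ord_recl f0 mul1r subn0 recipS addrC subrr.
Qed.

Variable C : R.
Hypothesis fC : forall k, `|f k| <= C ^+ k.

Let C0 : 0 <= C. Proof. by have := fC 1; apply: le_trans; rewrite normr_ge0. Qed.

Lemma recip_bound n : `|recip n| <= (2 * C) ^+ n.
Proof.
elim/ltn_ind: n => -[|n] ih; first by rewrite recip0 normr1 expr0.
rewrite recipS normrN; apply: le_trans (ler_norm_sum _ _ _) _.
apply: (@le_trans _ _ (\sum_(k < n.+1) (2 ^+ (n - k) * C ^+ n.+1))).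
  apply: ler_sum => k _; rewrite normrM.
  have kn : (k <= n)%N by rewrite -ltnS.
  apply: (@le_trans _ _ (C ^+ k.+1 * (2 * C) ^+ (n - k))).
    by rewrite ler_pM// ih// ltnS leq_subr.
  by rewrite exprMn mulrCA -exprD addSn subnKC.
rewrite -mulr_suml exprMn ler_wpM2r ?exprn_ge0//.
suff -> : \sum_(k < n.+1) 2 ^+ (n - k) = 2 ^+ n.+1 - 1 :> R by rewrite gerBl.
elim: n {ih} => [|n ih]; first by rewrite big_ord_recl big_ord0; lra.
rewrite big_ord_recl subn0; under eq_bigr => k _ do rewrite subSS.
by rewrite ih [2 ^+ n.+2]exprS; lra.
Qed.

Variables (a g : R).
Hypothesis a0 : 0 <= a.
Hypothesis aC : C * a <= 1 / 32.
Hypothesis g0 : g != 0.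
Hypothesis cf : (\sum_(0 <= k < n) f k * a ^+ k) @[n --> \oo] --> g.

(** The product of the partial sums of [f] and of [recip f] up to order [n] is 1 up
    to terms of order between [n] and [2 n], which are bounded by
    [(i + 1) (2 C a) ^+ i] and vanish as [n] grows. *)
Lemma recip_series_cvg :
  (\sum_(0 <= k < n) recip k * a ^+ k) @[n --> \oo] --> g^-1.
Proof.
pose F n := \sum_(0 <= k < n) f k * a ^+ k.
pose S n := \sum_(0 <= k < n) recip k * a ^+ k.
(* C a <= 1 / 32 and i < 2 N turn the bound (i + 1) (2 C a)^i into 2 * 4^N / 16^N,
     and the N terms of the tail cost another factor 2^N *)
have FS n : `|F n.+1 * S n.+1 - 1| <= 2 * (1 / 2) ^+ n.+1.
  set N := n.+1.
  have hp (h : nat -> R) : (\poly_(i < N) h i).[a] = \sum_(0 <= k < N) h k * a ^+ k.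
    by rewrite horner_poly big_mkord.
  rewrite /F /S -!hp -hornerM.
  set p := \poly_(i < N) f i; set q := \poly_(i < N) recip i.
  have spq : (size (p * q)%R <= N + N)%N.
    apply: leq_trans (size_polyMleq _ _) _.
    apply: leq_trans (leq_pred _) _.
    by rewrite leq_add// size_poly.
  rewrite (horner_coef_wide _ spq).
  rewrite -(big_mkord xpredT (fun i => (p * q)%R`_i * a ^+ i)).
  rewrite (@big_cat_nat _ _ _ N)//= ?leq_addr//.
  have -> : \sum_(0 <= i < N) (p * q)%R`_i * a ^+ i = 1.
    rewrite big_nat_recl// big1_seq; last first.
      move=> i /andP[_]; rewrite mem_index_iota => /andP[_ iN].
      rewrite coefM (eq_bigr (fun k : 'I_i.+2 => f k * recip (i.+1 - k))).
        by rewrite recip_conv mul0r.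
      move=> k _; rewrite !coef_poly.
      have -> : (k < N)%N by apply: leq_trans (ltn_ord k) _.
      have -> // : (i.+1 - k < N)%N by apply: leq_ltn_trans (leq_subr _ _) _.
    by rewrite coefM big_ord_recl big_ord0 !coef_poly/= f0 recip0 !mulr1 !addr0.
  rewrite addrAC subrr add0r.
  apply: le_trans (ler_norm_sum _ _ _) _.
  apply: (@le_trans _ _ (\sum_(N <= i < N + N) (2 * 4 ^+ N) * (1 / 16) ^+ N)).
    rewrite big_nat [leRHS]big_nat; apply: ler_sum => i /andP[Ni iN].
    rewrite normrM normrX (ger0_norm a0).
    have pq : `|(p * q)%R`_i| <= (i.+1)%:R * (2 * C) ^+ i.
      rewrite coefM; apply: le_trans (ler_norm_sum _ _ _) _.
      rewrite mulr_natl -[X in _ *+ X]card_ord -sumr_const.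
      apply: ler_sum => k _; rewrite normrM.
      have ki : (k <= i)%N by rewrite -ltnS.
      have -> : (2 * C) ^+ i = (2 * C) ^+ k * (2 * C) ^+ (i - k) by rewrite -exprD subnKC.
      have h (c : nat -> R) j : `|(\poly_(i < N) c i)`_j| <= `|c j|.
        by rewrite coef_poly; case: ifP => // _; rewrite normr0.
      apply: ler_pM => //; last exact: le_trans (h _ _) (recip_bound _).
      apply: le_trans (h _ _) _; apply: le_trans (fC _) _.
      have := C0 => c0; by apply: lerXn2r; rewrite ?nnegrE ?mulr_ge0//; lra.
    apply: (@le_trans _ _ (i.+1%:R * (2 * C) ^+ i * a ^+ i)).
      by rewrite ler_wpM2r// exprn_ge0.
    rewrite -mulrA -exprMn; apply: ler_pM => //.
    - by rewrite exprn_ge0// !mulr_ge0.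
    - have h1 : (i.+1 <= 2 * 4 ^ N)%N.
        apply: leq_trans iN _; rewrite addnn -mul2n leq_mul2l/=.
        by apply: ltnW; exact: ltn_expl.
      by rewrite -natrX -natrM ler_nat.
    - have h2 : 0 <= 2 * C * a <= 1 / 16.
        apply/andP; split; first by rewrite !mulr_ge0//; exact: C0.
        by move: aC; lra.
      case/andP: h2 => h2 h3.
      apply: (@le_trans _ _ ((1 / 16) ^+ i)).
        by apply: lerXn2r; rewrite ?nnegrE//; lra.
      by apply: ler_wiXn2l => //; lra.
  rewrite sumr_const_nat addnK.
  have : N%:R <= 2 ^+ N :> R by rewrite -natrX ler_nat ltnW// ltn_expl.
  move=> h; rewrite -[leLHS]mulr_natr.
  apply: (@le_trans _ _ (2 * 4 ^+ N * (1 / 16) ^+ N * 2 ^+ N)).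
    by rewrite ler_wpM2l// !mulr_ge0// exprn_ge0// divr_ge0.
  by rewrite -!mulrA ler_wpM2l// -!exprMn; apply: lerXn2r; rewrite ?nnegrE; lra.
have cF : F n.+1 @[n --> \oo] --> g by rewrite (cvg_shiftS F).
have cS : (F n.+1 * S n.+1) @[n --> \oo] --> (1 : R).
  apply/cvgrPdist_le => e e0.
  have h2 : `|1 / 2 : R| < 1 by rewrite ger0_norm; lra.
  have := cvg_geometric (2 : R) h2; rewrite -(cvg_shiftS (geometric (2 : R) (1 / 2))) /=.
  move=> /cvgrPdist_le/(_ e e0); apply: filterS => n.
  rewrite sub0r normrN ger0_norm ?mulr_ge0 ?exprn_ge0 ?divr_ge0// => h.
  by rewrite distrC; exact: le_trans h.
rewrite -(cvg_shiftS S).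
have : (F n.+1 * S n.+1 / F n.+1) @[n --> \oo] --> g^-1.
  by rewrite -[g^-1]mul1r; apply: cvgM => //; exact: cvgV.
apply: cvg_trans; apply: near_eq_cvg.
have /cvgr_neq0/(_ g0) := cF; apply: filterS => n Fn.
by rewrite mulrAC divff// mul1r.
Qed.

End reciprocal_series.

Section rate_series.
Context {R : realType}.
Implicit Types a q x : R.

Lemma geometric_tail q N n : 0 <= q <= 1 / 2 ->
  \sum_(N <= k < n) q ^+ k <= 2 * q ^+ N.
Proof.
move=> /andP[q0 q1].
have [nN|/ltnW Nn] := leqP n N.
  by rewrite big_geq// mulr_ge0 ?exprn_ge0.
rewrite -(subnKC Nn); move: (n - N)%N => m; elim: m N {Nn} => [|m ih] N.
  by rewrite addn0 big_geq// mulr_ge0 ?exprn_ge0.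
rewrite big_ltn; last by rewrite addnS ltnS leq_addr.
have := ih N.+1; rewrite addSnnS => h.
apply: le_trans (lerD (lexx _) h) _.
have := exprn_ge0 N q0; rewrite exprS; set c := q ^+ N => c0; nra.
Qed.

Lemma series_tail (b : nat -> R) M a l N :
  (forall k, `|b k| <= M ^+ k) -> 0 <= M -> 0 <= a -> M * a <= 1 / 2 ->
  (\sum_(0 <= k < n) b k * a ^+ k) @[n --> \oo] --> l ->
  `|l - \sum_(0 <= k < N) b k * a ^+ k| <= 2 * (M * a) ^+ N.
Proof.
move=> bM M0 a0 Ma cl.
set s := \sum_(0 <= k < N) _.
have : `|\sum_(0 <= k < n) b k * a ^+ k - s| @[n --> \oo] --> `|l - s|.
  by apply: cvg_norm; apply: cvgB => //; exact: cvg_cst.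
move=> cn; rewrite -(cvg_lim _ cn)//; apply: limr_le.
  by apply/cvg_ex; eexists; exact: cn.
exists N => // n /= Nn; rewrite /s (@big_cat_nat _ _ _ N 0 n)//= addrAC subrr add0r.
apply: le_trans (ler_norm_sum _ _ _) _.
apply: le_trans (geometric_tail N n _); last by rewrite mulr_ge0.
apply: ler_sum => k _.
by rewrite normrM normrX (ger0_norm a0) exprMn ler_wpM2r ?exprn_ge0.
Qed.

(** The coefficients of [(e^x + e^(-x) - 2) / x^2] in powers of [a = x^2 / 12]. *)
Definition csch_coef (j : nat) : R := 2 * 12 ^+ j / ((2 * j.+1)`!)%:R.

Lemma cvg_csch_coef a : 0 < a ->
  (\sum_(0 <= k < n) csch_coef k * a ^+ k) @[n --> \oo] -->
  ((expR (Num.sqrt (12 * a)) + expR (- Num.sqrt (12 * a)) - 2) / (12 * a)).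
Proof.
move=> a0; set x := Num.sqrt (12 * a).
have x2 : x ^+ 2 = 12 * a by rewrite sqr_sqrtr// mulr_ge0// ltW.
pose u n := series (exp_coeff x) n + series (exp_coeff (- x)) n - 2.
have cu : u n @[n --> \oo] --> expR x + expR (- x) - 2.
  apply: cvgB; last exact: cvg_cst.
  by apply: cvgD; rewrite /expR; exact: is_cvg_series_exp_coeff.
(* only the even orders of e^x + e^-x survive *)
have un n : u (2 * n.+1)%N = \sum_(0 <= k < n) csch_coef k * a ^+ k * (12 * a).
  rewrite /u /series /=; elim: n => [|n ih].
    rewrite muln1 [RHS]big_geq// !big_nat_recr//= !big_geq//= /exp_coeff/= !expr0 !expr1 !fact0 factS fact0; lra.
  rewrite [in RHS]big_nat_recr//= -ih [(2 * n.+2)%N]mulnS add2n !big_nat_recr//=.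
  set m := (2 * n.+1)%N.
  have Em : m = (n.+1 * 2)%N by rewrite mulnC.
  have e1 : (- x) ^+ m = (12 * a) ^+ n.+1 by rewrite Em mulnC exprM sqrrN x2.
  have e2 : x ^+ m = (12 * a) ^+ n.+1 by rewrite Em mulnC exprM x2.
  rewrite /exp_coeff/= [(- x) ^+ m.+1]exprS [x ^+ m.+1]exprS e1 e2 /csch_coef -/m.
  rewrite [(12 * a) ^+ n.+1]exprSr exprMn; ring.
have cu2 : u (2 * n.+1)%N @[n --> \oo] --> expR x + expR (- x) - 2.
  apply: cvg_comp cu => A [N _ NA]; exists N => // n /= Nn; apply: NA => /=.
  by rewrite mulnS mul2n -addnn; lia.
have : (u (2 * n.+1)%N * (12 * a)^-1) @[n --> \oo] --> (expR x + expR (- x) - 2) * (12 * a)^-1.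
  by apply: cvgM => //; exact: cvg_cst.
apply: cvg_trans; apply: near_eq_cvg; near=> n.
rewrite un -mulr_suml mulfK// gt_eqF// mulr_gt0//.
Unshelve. all: by end_near.
Qed.

Lemma csch_coef_bound k : `|csch_coef k| <= 12 ^+ k.
Proof.
rewrite /csch_coef ger0_norm; last by rewrite divr_ge0// mulr_ge0// exprn_ge0.
rewrite ler_pdivrMr ?ltr0n ?fact_gt0// mulrC ler_wpM2l ?exprn_ge0//.
by rewrite ler_nat; apply: leq_trans (fact_geq _); rewrite mulnS leq_addr.
Qed.

Let b := recip csch_coef.

Let csch0 : csch_coef 0 = 1.
Proof. by rewrite /csch_coef expr0 muln1 mulr1 divff. Qed.

(** [2 a profile x = x^2 / (e^x + e^(-x) - 2)] at [x^2 = 12 a].  The radius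
    [1 / 384] is [1 / 32] divided by the growth rate 12 of [csch_coef]. *)
Lemma profile_series a : 0 < a -> a <= 1 / 384 ->
  (\sum_(0 <= k < n) b k * a ^+ k) @[n --> \oo] -->
  2 * a * profile (Num.sqrt (12 * a)).
Proof.
move=> a0 a1; set x := Num.sqrt (12 * a).
have x0 : 0 < x by rewrite sqrtr_gt0 mulr_gt0.
have e1 := expRB1_gt0 x0; have e0 := expR_gt0 x.
have g0 : (expR x + expR (- x) - 2) / (12 * a) != 0.
  rewrite expRN.
  have -> : expR x + (expR x)^-1 - 2 = (expR x - 1) ^+ 2 / expR x.
    by field; rewrite gt_eqF.
  by rewrite !mulf_neq0 ?invr_neq0 ?expf_neq0 ?mulf_neq0// ?gt_eqF.
have -> : 2 * a * profile x = ((expR x + expR (- x) - 2) / (12 * a))^-1.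
  rewrite profileE// expRN; field.
  rewrite gt_eqF//= gt_eqF//= [expR x - 1 == 0]gt_eqF//= andbT.
  have -> : expR x * expR x + 1 + -2 * expR x = (expR x - 1) ^+ 2 by ring.
  by rewrite expf_neq0// gt_eqF.
apply: (recip_series_cvg _ csch_coef_bound) => //; last exact: cvg_csch_coef.
- exact: ltW.
- lra.
Qed.

(** The terms [- 1 + a] of the rate cancel the first two coefficients. *)
Definition rate_coef (k : nat) : R := b k - (k == 0%N)%:R + (k == 1%N)%:R.

Let csch1 : csch_coef 1 = 1.
Proof. rewrite /csch_coef !mulnS muln0 !add2n !factS fact0 !natrM; lra. Qed.
Let csch2 : csch_coef 2 = 2 / 5.
Proof. rewrite /csch_coef !mulnS muln0 !add2n !factS fact0 !natrM; lra. Qed.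
Let csch3 : csch_coef 3 = 3 / 35.
Proof. rewrite /csch_coef !mulnS muln0 !add2n !factS fact0 !natrM; lra. Qed.
Let csch4 : csch_coef 4 = 2 / 175.
Proof. rewrite /csch_coef !mulnS muln0 !add2n !factS fact0 !natrM; lra. Qed.

Let b0 : b 0 = 1. Proof. by []. Qed.
Let b1 : b 1 = -1.
Proof. rewrite /b recipS !big_ord_recl big_ord0 /= csch1 recip0; lra. Qed.
Let b2 : b 2 = 3 / 5.
Proof.
rewrite /b recipS !big_ord_recl big_ord0 /= csch1 csch2.
rewrite !subn0 !subSS/= -/b b1 b0; lra.
Qed.
Let b3 : b 3 = - (2 / 7).
Proof.
rewrite /b recipS !big_ord_recl big_ord0 /= csch1 csch2 csch3.
rewrite !subn0 !subSS/= -/b b2 b1 b0; lra.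
Qed.
Let b4 : b 4 = 3 / 25.
Proof.
rewrite /b recipS !big_ord_recl big_ord0 /= csch1 csch2 csch3 csch4.
rewrite !subn0 !subSS/= -/b b3 b2 b1 b0; lra.
Qed.

Lemma rate_coefE : [/\ rate_coef 0 = 0, rate_coef 1 = 0, rate_coef 2 = 3 / 5,
  rate_coef 3 = - (2 / 7) & rate_coef 4 = 3 / 25].
Proof. by rewrite /rate_coef b0 b1 b2 b3 b4 /=; split; lra. Qed.

Lemma rate_series a : 0 < a -> a <= 1 / 384 ->
  (\sum_(0 <= k < n) rate_coef k * a ^+ k) @[n --> \oo] -->
  2 * a * profile (Num.sqrt (12 * a)) - 1 + a.
Proof.
move=> a0 a1; have h := profile_series a0 a1.
have : (\sum_(0 <= k < n) b k * a ^+ k - 1 + a) @[n --> \oo] -->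
    2 * a * profile (Num.sqrt (12 * a)) - 1 + a.
  by apply: cvgD; [apply: cvgB => //; exact: cvg_cst|exact: cvg_cst].
apply: cvg_trans; apply: near_eq_cvg; near=> n.
have n2 : (2 <= n)%N by near: n; exists 2%N.
rewrite -(subnKC n2) add2n !big_nat_recl//= /rate_coef b0 b1/=.
under [in RHS]eq_bigr => k _ do rewrite subr0 addr0.
by rewrite expr0 expr1; ring.
Unshelve. all: by end_near.
Qed.

(** The coefficients grow at rate [2 * 12], so the remainder after [N] terms is
    dominated by a geometric series of ratio [24 a <= 1 / 2]. *)
Lemma rate_estimate a N : 0 < a -> a <= 1 / 384 ->
  `|2 * a * profile (Num.sqrt (12 * a)) - 1 + a
     - \sum_(0 <= k < N) rate_coef k * a ^+ k| <= 2 * (24 * a) ^+ N.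
Proof.
move=> a0 a1; apply: series_tail (rate_series a0 a1); [|by []|exact: ltW|lra].
case=> [|[|k]].
- by have [-> _ _ _ _] := rate_coefE; rewrite normr0.
- by have [_ -> _ _ _] := rate_coefE; rewrite normr0.
rewrite /rate_coef/= subr0 addr0.
have h := recip_bound csch_coef_bound k.+2.
rewrite (_ : 24 = 2 * 12 :> R); [exact: h|lra].
Qed.

Lemma profile_at0 :
  (2 * a * profile (Num.sqrt (12 * a))) @[a --> (0 : R)^'+] --> (1 : R).
Proof.
apply/cvgrPdist_le => e e0.
have c0 : 0 < (1 / 384 : R) by lra.
have c1 : 0 < e / 1154 by lra.
near=> a.
have a0 : 0 < a by near: a; exact: nbhs_right_gt.
have a1 : a <= 1 / 384 by near: a; exact: nbhs_right_le.
have a2 : a <= e / 1154 by near: a; exact: nbhs_right_le.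
have := rate_estimate 2 a0 a1.
have [d0 d1 _ _ _] := rate_coefE.
rewrite !big_nat_recr//= big_geq//= d0 d1 !mul0r !addr0 subr0.
set p := 2 * a * _ => h.
have -> : 1 - p = a - (p - 1 + a) by ring.
apply: le_trans (ler_normB _ _) _; rewrite (gtr0_norm a0).
apply: le_trans (lerD (lexx _) h) _.
by rewrite exprMn expr2; nra.
Unshelve. all: by end_near.
Qed.

End rate_series.

(** * Stationary solutions of the limiting equation *)

Section taylor.
Context {R : realType}.
Implicit Types (f : R -> R) (x y z c : R).

Lemma taylor2_ge f f1 f2 c y z :
  (forall x, 0 < x -> is_derive x 1 f (f1 x)) ->
  (forall x, 0 < x -> is_derive x 1 f1 (f2 x)) ->
  0 < y -> 0 < z ->
  (forall x, Num.min y z <= x -> x <= Num.max y z -> c <= f2 x) ->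
  f y + f1 y * (z - y) + c / 2 * (z - y) ^+ 2 <= f z.
Proof.
move=> ff1 f1f2 y0 z0 cf2.
pose h x := f x - f1 y * x - c / 2 * (x - y) ^+ 2.
have dh x : 0 < x -> is_derive x 1 h (f1 x - f1 y - c * (x - y)).
  move=> x0; have d1 := ff1 _ x0.
  have d2 := is_deriveZf (f1 y) (is_derive_id x 1).
  have d3 := is_deriveBf (is_derive_id x 1) (is_derive_cst y x 1).
  have d4 := is_deriveZf (c / 2) (is_deriveXf 2 d3).
  have d5 := is_deriveBf (is_deriveBf d1 d2) d4.
  apply: is_derive_eq; rewrite /=; lra.
have slope a b : 0 < a -> a < b -> Num.min y z <= a -> b <= Num.max y z ->
    c * (b - a) <= f1 b - f1 a.
  move=> a0 ab ma bM; have [u /andP[au ub] ->] := MVT_pos f1f2 a0 ab.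
  rewrite ler_wpM2r ?subr_ge0 ?(ltW ab)// cf2//.
    exact: le_trans ma (ltW au).
  exact: le_trans (ltW ub) bM.
suff : h y <= h z by rewrite /h; lra.
have [yz|zy|->//] := ltgtP y z.
- have [u /andP[yu uz] e] := MVT_pos dh y0 yz.
  rewrite -subr_ge0 e mulr_ge0 ?subr_ge0 ?(ltW yz)//.
  by apply: slope => //; rewrite ?min_l ?max_r// ltW.
- have [u /andP[zu uy] e] := MVT_pos dh z0 zy.
  have u0 : 0 < u by exact: lt_trans zu.
  have s : c * (y - u) <= f1 y - f1 u.
    by apply: slope => //; rewrite ?min_r ?max_l// ltW.
  have : h y - h z <= 0 by rewrite e; nra.
  lra.
Qed.

Lemma taylor2_le f f1 f2 c y z :
  (forall x, 0 < x -> is_derive x 1 f (f1 x)) ->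
  (forall x, 0 < x -> is_derive x 1 f1 (f2 x)) ->
  0 < y -> 0 < z ->
  (forall x, Num.min y z <= x -> x <= Num.max y z -> f2 x <= c) ->
  f z <= f y + f1 y * (z - y) + c / 2 * (z - y) ^+ 2.
Proof.
move=> ff1 f1f2 y0 z0 cf2.
have h := @taylor2_ge (fun x => - f x) (fun x => - f1 x) (fun x => - f2 x) (- c) y z.
have : - f y + - f1 y * (z - y) + - c / 2 * (z - y) ^+ 2 <= - f z.
  apply: h => //.
  - by move=> x x0; apply: is_deriveNf; exact: ff1.
  - by move=> x x0; apply: is_deriveNf; exact: f1f2.
  - by move=> x m M; rewrite lerN2; exact: cf2.
lra.
Qed.

End taylor.

Section scaled_profile.
Context {R : realType}.
Implicit Types x y z : R.

(** What the comparison argument uses of a solution of [V'' = k (V ^+ 2 - w ^+ 2)].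
    [ss_slope] says that [x ^+ 2 * V x] does not decrease, and [ss_lower] that [V]
    decays no faster than [x ^- 2], with a constant which does not depend on [w]. *)
Record steady_state (k w : R) (V V1 : R -> R) : Prop := SteadyState {
  ss_derive : forall x, 0 < x -> is_derive x 1 V (V1 x);
  ss_derive1 : forall x, 0 < x -> is_derive x 1 V1 (k * (V x ^+ 2 - w ^+ 2));
  ss_nonincr : forall x, 0 < x -> V1 x <= 0;
  ss_ge : forall x, 0 < x -> w <= V x;
  ss_slope : forall x, 0 < x -> - (x * V1 x) <= 2 * V x;
  ss_lower : forall x, 0 < x -> (8 * k)^-1 / x ^+ 2 <= V x }.

Definition stationary (k w : R) y : R :=
  2 * w * profile (Num.sqrt (2 * k * w) * y) + w.

(** The derivative of [stationary]. *)
Definition stationary1 (k w : R) y : R :=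
  2 * w * (Num.sqrt (2 * k * w) *
    (- hcoth (Num.sqrt (2 * k * w) * y) * profile (Num.sqrt (2 * k * w) * y))).

(** Dividing by [hcoth x * profile x], the claim is that
    [q x = (2 profile x + 1) / (hcoth x * profile x)] is at least [x].  Indeed
    [q y - y] has a nonnegative derivative and is at least [- y] for small [y]. *)
Lemma profile_slope x : 0 < x -> x * (hcoth x * profile x) <= 2 * profile x + 1.
Proof.
move=> x0.
pose q y : R := (6 * hcoth y ^+ 2 - 4) / (3 * hcoth y * (hcoth y ^+ 2 - 1)).
pose G y : R := q y - y.
have c1 y : 0 < y -> 1 < hcoth y by exact: hcoth_gt1.
have c0 y : 0 < y -> 0 < hcoth y by move=> /c1; exact: lt_trans.
have c2 y : 0 < y -> 0 < hcoth y ^+ 2 - 1.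
  by move=> /c1; set c := hcoth y => h; nra.
have den y : 0 < y -> 0 < 3 * hcoth y * (hcoth y ^+ 2 - 1).
  by move=> y0; rewrite mulr_gt0 ?c2// mulr_gt0 ?c0.
have dG y : 0 < y -> is_derive y 1 G (2 / (3 * hcoth y ^+ 2 * (hcoth y ^+ 2 - 1))).
  move=> y0; have d := is_derive_hcoth y0.
  have d1 := is_deriveBf (is_deriveZf 6 (is_deriveXf 2 d)) (is_derive_cst (4 : R) y 1).
  have d2 := is_deriveMf (is_deriveZf 3 d)
    (is_deriveBf (is_deriveXf 2 d) (is_derive_cst (1 : R) y 1)).
  have n : 3 * hcoth y * (hcoth y ^+ 2 - 1) != 0 by rewrite gt_eqF// den.
  have d3 := @is_deriveV R (fun z : R => 3 * hcoth z * (hcoth z ^+ 2 - 1)) y _ 1 n d2.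
  have d4 := is_deriveBf (is_deriveMf d1 d3) (is_derive_id y 1).
  apply: is_derive_eq; rewrite /GRing.scale/=; field.
  by rewrite !gt_eqF// ?c2 ?c0.
have G0 : 0 <= G x.
  apply/ler_addgt0Pl => e e0.
  pose a := Num.min e x.
  have a0 : 0 < a by rewrite lt_min e0.
  have : G a <= G x.
    apply: (nondecreasing_pos dG) => // [y y0|]; last by rewrite ge_min lexx orbT.
    by rewrite divr_ge0// mulr_ge0 ?(ltW (c2 _ _))// mulr_ge0// sqr_ge0.
  have : a <= e by rewrite ge_min lexx.
  have : 0 <= q a by rewrite /q divr_ge0 ?(ltW (den _ _))//; have := c2 _ a0; lra.
  rewrite {1}/G; lra.
move: G0; rewrite /G subr_ge0 /q ler_pdivlMr ?den// /profile; lra.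
Qed.

Lemma stationary_steady k w : 0 < k -> 0 < w ->
  steady_state k w (stationary k w) (stationary1 k w).
Proof.
move=> k0 w0.
set s := Num.sqrt (2 * k * w).
have s0 : 0 < s by rewrite sqrtr_gt0 !mulr_gt0.
have s2 : s ^+ 2 = 2 * k * w by rewrite sqr_sqrtr// !mulr_ge0// ltW.
have sx x : 0 < x -> 0 < s * x + 0 by move=> x0; rewrite addr0 mulr_gt0.
have E (f : R -> R) : (fun y : R => f (s * y)) = (fun y : R => f (s * y + 0)).
  by apply/funext => y; rewrite addr0.
split.
- move=> x x0.
  have d := is_derive_affine (is_derive_profile (sx _ x0)).
  have d1 := is_deriveDf (is_deriveZf (2 * w) d) (is_derive_cst w x 1).
  have -> : stationary k w = (fun y => 2 * w * profile (s * y + 0) + w).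
    by apply/funext => y; rewrite addr0.
  by apply: is_derive_eq; rewrite /= !addr0.
- move=> x x0.
  have d := is_derive_affine (is_derive_profile2 (sx _ x0)).
  have d1 := is_deriveZf (2 * w) (is_deriveZf s d).
  have -> : stationary1 k w =
      (fun y => 2 * w * (s * (- hcoth (s * y + 0) * profile (s * y + 0)))).
    by apply/funext => y; rewrite addr0.
  apply: is_derive_eq; rewrite /stationary -/s addr0.
  have -> : s * (s * (profile (s * x) ^+ 2 + profile (s * x))) =
    s ^+ 2 * (profile (s * x) ^+ 2 + profile (s * x)) by ring.
  rewrite s2; ring.
- move=> x x0; rewrite /stationary1 -/s.
  have sx0 : 0 < s * x by rewrite mulr_gt0.
  have := hcoth_gt1 sx0; have := profile_gt0 sx0 => p0 c1.
  rewrite mulNr !mulrN oppr_le0; apply: mulr_ge0; first by rewrite mulr_ge0// ltW.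
  apply: mulr_ge0; first exact: ltW.
  by apply: mulr_ge0; [exact/ltW/(lt_trans _ c1)|exact: ltW].
- move=> x x0; rewrite /stationary -/s lerDr ltW// mulr_gt0 ?profile_gt0//; exact: mulr_gt0.
- move=> x x0; rewrite /stationary /stationary1 -/s.
  have sx0 : 0 < s * x by rewrite mulr_gt0.
  have h := profile_slope sx0.
  have : 2 * w * (s * x * (hcoth (s * x) * profile (s * x))) <=
         2 * w * (2 * profile (s * x) + 1) by rewrite ler_pM2l// mulr_gt0.
  lra.
- move=> x x0; rewrite /stationary -/s.
  have sx0 : 0 < s * x by rewrite mulr_gt0.
  suff h : 1 / 8 / (s * x) ^+ 2 <= profile (s * x) + 1 / 2.
    have : 2 * w * (1 / 8 / (s * x) ^+ 2) <= 2 * w * (profile (s * x) + 1 / 2).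
      by rewrite ler_pM2l// mulr_gt0.
    rewrite exprMn s2.
    have -> : 2 * w * (1 / 8 / (2 * k * w * x ^+ 2)) = (8 * k)^-1 / x ^+ 2.
      by field; rewrite !gt_eqF.
    lra.
  move: (s * x) sx0 => {s0 s2 sx E x0 x}x x0 {s}.
  have x20 : 0 < x ^+ 2 by rewrite exprn_gt0.
  have [x1|x1] := leP x (1 / 2).
    have := profile_ge x0; have := expR_ge1Dx (- x) => h1 h2.
    have : 1 / 8 / x ^+ 2 <= 6 * expR (- x) / x ^+ 2.
      by rewrite ler_pM2r ?invr_gt0//; lra.
    lra.
  have := profile_gt0 x0 => p0.
  have : 1 / 8 / x ^+ 2 <= 1 / 2 by rewrite ler_pdivrMr//; nra.
  lra.
Qed.

Lemma stationary_le k w y : 0 < k -> 0 < w -> 0 < y ->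
  stationary k w y <= 24 / (k * y ^+ 2) + w.
Proof.
move=> k0 w0 y0; rewrite /stationary lerD2r.
set s := Num.sqrt (2 * k * w).
have s0 : 0 < s by rewrite sqrtr_gt0 !mulr_gt0.
have s2 : s ^+ 2 = 2 * k * w by rewrite sqr_sqrtr// !mulr_ge0// ltW.
have sy0 : 0 < s * y by rewrite mulr_gt0.
have : 2 * w * profile (s * y) <= 2 * w * (24 / (s * y) ^+ 2).
  by rewrite ler_pM2l ?mulr_gt0// profile_le.
rewrite exprMn s2.
suff -> : 2 * w * (24 / (2 * k * w * y ^+ 2)) = 24 / (k * y ^+ 2) by [].
by field; rewrite !gt_eqF.
Qed.

Section steady_state_theory.
Variables (k w : R) (V V1 : R -> R).
Hypotheses (k0 : 0 < k) (w0 : 0 < w) (ss : steady_state k w V V1).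

Lemma ss_gt0 y : 0 < y -> 0 < V y.
Proof. by move=> y0; apply: lt_le_trans w0 _; exact: (ss_ge ss). Qed.

Lemma ss_le a b : 0 < a -> a <= b -> V b <= V a.
Proof.
move=> a0 ab; rewrite -lerN2.
apply: (@nondecreasing_pos _ (fun x => - V x) (fun x => - V1 x)) => // x x0.
  by apply: is_deriveNf; exact: (ss_derive ss).
by rewrite oppr_ge0; exact: (ss_nonincr ss).
Qed.

(** Integrated form of [ss_slope]: between [a] and [b] the solution changes by a
    factor [(b / a) ^+ 2] at most. *)
Lemma ss_scale a b : 0 < a -> a <= b -> a ^+ 2 * V a <= b ^+ 2 * V b.
Proof.
move=> a0 ab.
apply: (@nondecreasing_pos _ (fun x => x ^+ 2 * V x)
  (fun x => x ^+ 2 * V1 x + V x * (2%:R * x ^+ 1 * 1))) => // x x0.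
  apply: is_deriveMf; last exact: (ss_derive ss).
  by apply: is_deriveXf; exact: is_derive_id.
have := ss_slope ss x0 => h.
have := ss_gt0 x0 => v0; rewrite expr1 mulr1.
have -> : x ^+ 2 * V1 x + V x * (2 * x) = x * (2 * V x - - (x * V1 x)) by ring.
by rewrite mulr_ge0 ?subr_ge0// ltW.
Qed.

Lemma ss_taylor_le m y z : 0 < m -> m <= y -> m <= z ->
  V z <= V y + V1 y * (z - y) + k * (V m ^+ 2 - w ^+ 2) / 2 * (z - y) ^+ 2.
Proof.
move=> m0 my mz.
apply: (taylor2_le (ss_derive ss) (ss_derive1 ss)).
- exact: lt_le_trans my.
- exact: lt_le_trans mz.
move=> x x1 _; have mx : m <= x by apply: le_trans x1; rewrite le_min my.
rewrite ler_pM2l// lerD2r; apply: lerXn2r (ss_le m0 mx); rewrite nnegrE ltW// ss_gt0//.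
exact: lt_le_trans mx.
Qed.

Lemma ss_taylor_ge M y z : 0 < y -> 0 < z -> y <= M -> z <= M ->
  V y + V1 y * (z - y) + k * (V M ^+ 2 - w ^+ 2) / 2 * (z - y) ^+ 2 <= V z.
Proof.
move=> y0 z0 My Mz.
apply: (taylor2_ge (ss_derive ss) (ss_derive1 ss)) => //.
move=> x x1 x2; have x0 : 0 < x by apply: lt_le_trans x1; rewrite lt_min y0.
have xM : x <= M by apply: le_trans x2 _; rewrite ge_max My.
rewrite ler_pM2l// lerD2r; apply: lerXn2r (ss_le x0 xM); rewrite nnegrE ltW// ss_gt0//.
exact: lt_le_trans xM.
Qed.

(** [V] is convex, since [V >= w]. *)
Lemma ss_tangent y z : 0 < y -> 0 < z -> V y + V1 y * (z - y) <= V z.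
Proof.
move=> y0 z0.
have := @taylor2_ge R V V1 _ 0 y z (ss_derive ss) (ss_derive1 ss) y0 z0.
rewrite mul0r mul0r addr0; apply=> x x1 _.
have x0 : 0 < x by apply: lt_le_trans x1; rewrite lt_min y0.
rewrite mulr_ge0 ?(ltW k0)// subr_ge0; apply: lerXn2r (ss_ge ss x0); rewrite nnegrE ltW//.
exact: ss_gt0.
Qed.

End steady_state_theory.

End scaled_profile.

(** * Expectations of real random variables *)

Section expectation.
Context {d : measure_display} {T : measurableType d} {R : realType}
  (P : probability T R).
Implicit Types (f g : T -> R) (c : R).

Definition expect f : R := \int[P]_w f w.
Definition summable f : Prop := P.-integrable setT (EFin \o f).

Lemma summable_measurable f : summable f -> measurable_fun setT f.
Proof. by move=> /measurable_int/measurable_EFinP. Qed.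

Lemma summable_le f g : measurable_fun setT f -> summable g ->
  (forall w, `|f w| <= g w) -> summable f.
Proof.
move=> mf ig fg; apply: le_integrable ig => //; first exact/measurable_EFinP.
by move=> w _ /=; rewrite lee_fin (le_trans (fg w))// ler_norm.
Qed.

Lemma summable_cst c : summable (fun=> c).
Proof. exact: finite_measure_integrable_cst. Qed.

Lemma summable_bounded f c : measurable_fun setT f ->
  (forall w, `|f w| <= c) -> summable f.
Proof. by move=> mf fc; apply: summable_le mf (summable_cst c) fc. Qed.

Lemma summableD f g : summable f -> summable g -> summable (fun w => f w + g w).
Proof. by move=> fi gi; exact: (integrableD measurableT fi gi). Qed.

Lemma summableB f g : summable f -> summable g -> summable (fun w => f w - g w).
Proof. by move=> fi gi; exact: (integrableB measurableT fi gi). Qed.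

Lemma summableZ c f : summable f -> summable (fun w => c * f w).
Proof. by move=> fi; exact: (integrableZl measurableT c fi). Qed.

Lemma measurable_boolR (b : T -> bool) :
  measurable_fun setT b -> measurable_fun setT (fun w => (b w)%:R : R).
Proof.
move=> mb; have -> : (fun w => (b w)%:R : R) = (fun w => if b w then 1 else 0).
  by apply/funext => w; case: (b w).
exact: measurable_fun_ifT.
Qed.

Lemma summable_indic (b : T -> bool) f : measurable_fun setT b ->
  summable f -> summable (fun w => (b w)%:R * f w).
Proof.
move=> mb fi; apply: summable_le (fun w => `|f w|) _ _ _.
- apply: measurable_funM; last exact: summable_measurable.
  exact: measurable_boolR.
- exact: integrable_norm.
- by move=> w; case: (b w); rewrite ?mul1r ?mul0r ?normr0.
Qed.

Lemma expectD f g : summable f -> summable g ->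
  expect (fun w => f w + g w) = expect f + expect g.
Proof. by move=> fi gi; exact: RintegralD. Qed.

Lemma expectB f g : summable f -> summable g ->
  expect (fun w => f w - g w) = expect f - expect g.
Proof. by move=> fi gi; exact: RintegralB. Qed.

Lemma expectZ c f : summable f -> expect (fun w => c * f w) = c * expect f.
Proof. by move=> fi; exact: RintegralZl. Qed.

Lemma expect_cst c : expect (fun=> c) = c.
Proof.
rewrite /expect Rintegral_cst//.
have e : fine (P setT) = 1 by rewrite probability_setT.
by rewrite [X in _ * X]e mulr1.
Qed.

Lemma expect_le f g : summable f -> summable g -> (forall w, f w <= g w) ->
  expect f <= expect g.
Proof. by move=> fi gi fg; apply: le_Rintegral. Qed.

Lemma expect_ge0 f : (forall w, 0 <= f w) -> 0 <= expect f.
Proof. by move=> f0; apply: Rintegral_ge0. Qed.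

Lemma expectE f : summable f -> (expect f)%:E = (\int[P]_w (f w)%:E)%E.
Proof. by move=> fi; rewrite fineK//; exact: integrable_fin_num. Qed.

Lemma expect_cvg (h : nat -> T -> R) f g : (forall n, measurable_fun setT (h n)) ->
  measurable_fun setT f -> summable g -> (forall n w, `|h n w| <= g w) ->
  (forall w, h n w @[n --> \oo] --> f w) ->
  expect (h n) @[n --> \oo] --> expect f.
Proof.
move=> mh mf gi hg hf.
have fi : summable f.
  apply: summable_le mf gi _ => w.
  have hw : `|h n w| @[n --> \oo] --> `|f w| by exact: cvg_norm.
  rewrite -(cvg_lim _ hw)//; apply: limr_le.
    by apply/cvg_ex; eexists; exact: hw.
  by apply: nearW => n; exact: hg.
have := @dominated_cvg _ _ _ P setT measurableT (fun n => EFin \o h n) (EFin \o f)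
  (EFin \o g).
move=> /(_ _ _ _ gi) H; apply: fine_cvg; rewrite expectE//; apply: H => //.
- by move=> n; exact/measurable_EFinP.
- by move=> w _; apply: cvg_EFin; [exact: nearW|exact: hf].
- by move=> n w _ /=; rewrite lee_fin.
Qed.

(** Dominated convergence along integers, extended to all large [K] by monotonicity. *)
Lemma expect_tail f (Z : T -> R) e : summable f -> (forall w, 0 <= f w) ->
  measurable_fun setT Z -> 0 < e ->
  exists K0 : R, forall K, K0 <= K -> expect (fun w => (K < Z w)%R%:R * f w) <= e.
Proof.
move=> fi f0 mZ e0.
have mb (K : R) : measurable_fun setT (fun w => K < Z w).
  exact: measurable_fun_ltr.
have : expect (fun w => (n%:R < Z w)%R%:R * f w) @[n --> \oo] --> expect (fun=> 0).
  apply: (@expect_cvg _ _ f) => //.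
  - by move=> n; apply: summable_measurable; exact: summable_indic.
  - by move=> n w; rewrite normrM (ger0_norm (f0 w)); case: ltP; rewrite ?normr1 ?mul1r ?normr0 ?mul0r.
  - move=> w; apply/cvgrPdist_le => r r0; near=> n.
    have h : Z w <= n%:R by near: n; exact: nbhs_infty_ger.
    by rewrite ltNge h /= mul0r subrr normr0 ltW.
rewrite expect_cst => /cvgrPdist_le/(_ e e0)[n _ /(_ n (leqnn n))] /=.
rewrite sub0r normrN => h; exists n%:R => K nK.
apply: le_trans (le_trans (ler_norm _) h).
apply: expect_le; [exact: summable_indic|exact: summable_indic|move=> w].
rewrite ler_wpM2r// ler_nat; case: (ltP K) => // KZ.
by rewrite (le_lt_trans nK KZ).
Unshelve. all: by end_near.
Qed.

(** The value [N w] splits the space into countably many measurable pieces. *)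
Lemma measurable_random_index (N : T -> nat) (G : nat -> T -> R) :
  measurable_fun setT N -> (forall n, measurable_fun setT (G n)) ->
  measurable_fun setT (fun w => G (N w) w).
Proof.
move=> mN mG _ B mB; rewrite setTI.
rewrite (_ : _ @^-1` B = \bigcup_n ((N @^-1` [set n]) `&` (G n @^-1` B))).
  apply: bigcupT_measurable => n; apply: measurableI.
    by rewrite -[X in measurable X]setTI; exact: mN.
  by rewrite -[X in measurable X]setTI; exact: mG.
apply/seteqP; split=> [w /= Bw|w /= [n _ [/= -> //]]].
by exists (N w).
Qed.

Lemma measurable_random_sum (N : T -> nat) (h : nat -> T -> R) :
  measurable_fun setT N -> (forall n, measurable_fun setT (h n)) ->
  measurable_fun setT (fun w => \sum_(i < N w) h i w).
Proof.
move=> mN mh; apply: (@measurable_random_index N (fun n w => \sum_(i < n) h i w)) => // n.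
by apply: measurable_sum => i; exact: mh.
Qed.

Lemma measurable_random_prod (N : T -> nat) (h : nat -> T -> R) :
  measurable_fun setT N -> (forall n, measurable_fun setT (h n)) ->
  measurable_fun setT (fun w => \prod_(i < N w) h i w).
Proof.
move=> mN mh; apply: (@measurable_random_index N (fun n w => \prod_(i < n) h i w)) => // n.
by apply: measurable_prod => i _; exact: mh.
Qed.

End expectation.

(** * Products of factors close to one *)

Section product_bounds.
Context {R : realType}.
Implicit Types (v g : nat -> R) (a b : R) (n : nat).

Lemma prod_unit g n : (forall i, (i < n)%N -> 0 <= g i <= 1) ->
  0 <= \prod_(i < n) g i <= 1.
Proof.
move=> g01; apply/andP; split.
  by apply: prodr_ge0 => i _; have /andP[] := g01 i (ltn_ord i).
by apply: prodr_ile1 => i _; exact: g01.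
Qed.

Lemma prod_le v g n : (forall i, (i < n)%N -> 0 <= v i <= g i) ->
  \prod_(i < n) v i <= \prod_(i < n) g i.
Proof. by move=> h; apply: ler_prod => i _; exact: h. Qed.

(** The gain [a ^+ 2] over the linear bound, available from two factors on, is what
    makes a critical branching process die out. *)
Lemma expr_lower a n : 0 <= a <= 1 ->
  1 - n%:R * a + (2 <= n)%N%:R * a ^+ 2 <= (1 - a) ^+ n.
Proof.
move=> /andP[a0 a1]; case: n => [|[|n]] /=.
- by rewrite expr0 mulr0n; lra.
- by rewrite expr1 mulr0n; lra.
rewrite mulr1n mul1r; elim: n => [|n ih]; first by rewrite expr2; nra.
rewrite exprS; apply: (@le_trans _ _ ((1 - a) * (1 - n.+2%:R * a + a ^+ 2))).
  rewrite -(natr1 n.+2) -(natr1 n.+1) -(natr1 n); have := ler0n R n; set m := n%:R => m0.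
  have h1 : 0 <= a ^+ 2 * (1 - a) by rewrite mulr_ge0 ?sqr_ge0// subr_ge0.
  have h2 : 0 <= m * a ^+ 2 by rewrite mulr_ge0 ?sqr_ge0.
  have := sqr_ge0 a; lra.
by rewrite ler_wpM2l// subr_ge0.
Qed.

Lemma expr_upper a n : 0 <= a <= 1 ->
  (1 - a) ^+ n <= 1 - n%:R * a + (n%:R * a) ^+ 2.
Proof.
move=> /andP[a0 a1]; elim: n => [|n ih]; first by rewrite expr0; nra.
rewrite exprS; apply: (@le_trans _ _ ((1 - a) * (1 - n%:R * a + (n%:R * a) ^+ 2))).
  by rewrite ler_wpM2l// subr_ge0.
rewrite -(natr1 n); have := ler0n R n; set m := n%:R => m0.
have h1 : 0 <= m * a ^+ 2 by rewrite mulr_ge0 ?sqr_ge0.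
have h2 : 0 <= m ^+ 2 * a ^+ 3 by rewrite mulr_ge0 ?sqr_ge0 ?exprn_ge0.
have h3 := sqr_ge0 a.
have -> : (1 - a) * (1 - m * a + (m * a) ^+ 2) =
  1 - (m + 1) * a + m * a ^+ 2 + (m * a) ^+ 2 - m ^+ 2 * a ^+ 3 by ring.
have -> : ((m + 1) * a) ^+ 2 = (m * a) ^+ 2 + 2 * (m * a ^+ 2) + a ^+ 2 by ring.
lra.
Qed.

(** The union bound; the next two lemmas are its second order refinements, with the
    pair correction evaluated at a lower or upper bound of the [v i]. *)
Lemma prod_defect_union v n : (forall i, (i < n)%N -> 0 <= v i <= 1) ->
  1 - \prod_(i < n) (1 - v i) <= \sum_(i < n) v i.
Proof.
elim: n => [|n ih] v01; first by rewrite !big_ord0 subrr.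
rewrite !big_ord_recr /=.
have h := ih (fun i ni => v01 i (ltnW ni)).
have /andP[p0 p1] : 0 <= \prod_(i < n) (1 - v i) <= 1.
  by apply: (@prod_unit (fun i => 1 - v i)) => i ni; have /andP[? ?] := v01 i (ltnW ni); apply/andP; split; lra.
have /andP[v0 v1] := v01 n (ltnSn n); nra.
Qed.

Lemma prod_defect_upper v n a :
  (forall i, (i < n)%N -> a <= v i <= 1) -> 0 <= a ->
  1 - \prod_(i < n) (1 - v i) <=
  \sum_(i < n) v i - n%:R * (n%:R - 1) / 2 * a ^+ 2 + n%:R ^+ 3 * a ^+ 3.
Proof.
elim: n => [|n ih] v01 a0; first by rewrite !big_ord0; lra.
rewrite !big_ord_recr /=.
have h := ih (fun i ni => v01 i (ltnW ni)) a0.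
have /andP[v0 v1] := v01 n (ltnSn n).
have a1 : a <= 1 by exact: le_trans v1.
have p1 : \prod_(i < n) (1 - v i) <= 1 - n%:R * a + (n%:R * a) ^+ 2.
  apply: le_trans (@expr_upper a n _); last by rewrite a0.
  rewrite -[X in _ <= _ ^+ X]card_ord -prodr_const.
  apply: (@prod_le (fun i => 1 - v i) (fun=> 1 - a)) => i ni.
  by have /andP[? ?] := v01 i (ltnW ni); apply/andP; split; lra.
have /andP[p0 p2] : 0 <= \prod_(i < n) (1 - v i) <= 1.
  by apply: (@prod_unit (fun i => 1 - v i)) => i ni; have /andP[? ?] := v01 i (ltnW ni); apply/andP; split; lra.
move: p0 p1 p2 h; set p := \prod_(i < n) _; set S := \sum_(i < n) _.
set u := v n in v0 v1 *.
rewrite -(natr1 n); have := ler0n R n; set m := n%:R => m0 p0 p1 p2 h.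
have h1 : a * (m * a - (m * a) ^+ 2) <= u * (1 - p).
  apply: (@le_trans _ _ (a * (1 - p))); first by rewrite ler_wpM2l//; lra.
  by rewrite ler_wpM2r// subr_ge0.
have h2 : 0 <= (2 * m ^+ 2 + 3 * m + 1) * a ^+ 3.
  by rewrite mulr_ge0 ?exprn_ge0//; have := sqr_ge0 m; lra.
have -> : 1 - p * (1 - u) = 1 - p + u - u * (1 - p) by ring.
have e1 : (m + 1) * (m + 1 - 1) / 2 * a ^+ 2 = m * (m - 1) / 2 * a ^+ 2 + m * a ^+ 2 by field.
have e2 : (m + 1) ^+ 3 * a ^+ 3 = m ^+ 3 * a ^+ 3 + m ^+ 2 * a ^+ 3 + (2 * m ^+ 2 + 3 * m + 1) * a ^+ 3 by ring.
have e3 : a * (m * a - (m * a) ^+ 2) = m * a ^+ 2 - m ^+ 2 * a ^+ 3 by ring.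
rewrite e1 e2; lra.
Qed.

Lemma prod_defect_lower v n b :
  (forall i, (i < n)%N -> 0 <= v i <= 1) -> (forall i, (i < n)%N -> v i <= b) ->
  0 <= b ->
  \sum_(i < n) v i - n%:R * (n%:R - 1) / 2 * b ^+ 2 <= 1 - \prod_(i < n) (1 - v i).
Proof.
elim: n => [|n ih] v01 vb b0; first by rewrite !big_ord0; lra.
rewrite !big_ord_recr /=.
have h := ih (fun i ni => v01 i (ltnW ni)) (fun i ni => vb i (ltnW ni)) b0.
have h0 : 1 - \prod_(i < n) (1 - v i) <= n%:R * b.
  apply: (le_trans (prod_defect_union (fun i ni => v01 i (ltnW ni)))).
  rewrite mulr_natl -[X in _ *+ X]card_ord -sumr_const; apply: ler_sum => i _.
  by apply: vb; exact: (ltnW (ltn_ord i)).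
have /andP[v0 v1] := v01 n (ltnSn n); have vnb := vb n (ltnSn n).
have /andP[p0 p2] : 0 <= \prod_(i < n) (1 - v i) <= 1.
  by apply: (@prod_unit (fun i => 1 - v i)) => i ni; have /andP[? ?] := v01 i (ltnW ni); apply/andP; split; lra.
move: p0 p2 h h0; set p := \prod_(i < n) _; set S := \sum_(i < n) _.
set u := v n in v0 v1 vnb *.
rewrite -(natr1 n); set m := n%:R => p0 p2 h h0.
have h1 : u * (1 - p) <= b * (m * b).
  by apply: ler_pM => //; rewrite subr_ge0.
have -> : 1 - p * (1 - u) = 1 - p + u - u * (1 - p) by ring.
have e1 : (m + 1) * (m + 1 - 1) / 2 * b ^+ 2 = m * (m - 1) / 2 * b ^+ 2 + b * (m * b) by field.
rewrite e1; lra.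
Qed.

(** Raising each of [n] factors by [p] changes the product by no more than the
    probability that one of [n] independent events of probability [p] occurs. *)
Lemma prod_shift g p n : (forall i, (i < n)%N -> 0 <= g i <= 1) -> 0 <= p <= 1 ->
  \prod_(i < n) Num.min 1 (g i + p) <= \prod_(i < n) g i + (1 - (1 - p) ^+ n).
Proof.
move=> + /andP[p0 p1]; elim: n => [|n ih] g01; first by rewrite !big_ord0 expr0; lra.
have h := ih (fun i ni => g01 i (ltnW ni)).
rewrite !big_ord_recr /= exprS.
have /andP[g0 g1] := g01 n (ltnSn n).
have /andP[G0 G1] := prod_unit (fun i ni => g01 i (ltnW ni)).
have /andP[A0 A1] : 0 <= \prod_(i < n) Num.min 1 (g i + p) <= 1.
  apply: (@prod_unit (fun i => Num.min 1 (g i + p))) => i ni.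
  have /andP[? ?] := g01 i (ltnW ni).
  by rewrite ge_min lexx /= andbT le_min ler01/=; lra.
have /andP[q0 q1] : 0 <= (1 - p) ^+ n <= 1.
  by rewrite exprn_ge0 ?exprn_ile1//; lra.
have m1 : Num.min 1 (g n + p) <= 1 by rewrite ge_min lexx.
have m2 : Num.min 1 (g n + p) <= g n + p by rewrite ge_min lexx orbT.
have m0 : 0 <= Num.min 1 (g n + p) by rewrite le_min ler01/=; lra.
move: h G0 G1 A0 A1 q0 q1 m0 m1 m2 g0 g1.
set A := \prod_(i < n) Num.min _ _; set G := \prod_(i < n) g i.
set q := (1 - p) ^+ n; set m := Num.min _ _; set u := g n.
move=> h G0 G1 A0 A1 q0 q1 m0 m1 m2 g0 g1.
have [c|c] := leP (1 - q) A; last first.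
  apply: (@le_trans _ _ (1 - q)); last by nra.
  by apply: le_trans (ltW c); rewrite ler_piMr.
have [c2|c2] := leP p m; last first.
  have : A * m <= m by rewrite ler_piMl.
  nra.
have k1 : (A - (1 - q)) * (m - p) <= G * u.
  by apply: ler_pM; rewrite ?subr_ge0//; lra.
have k2 : (1 - A) * p >= 0 by rewrite mulr_ge0// subr_ge0.
have k3 : (1 - m) * (1 - q) >= 0 by rewrite mulr_ge0// subr_ge0.
nra.
Qed.

End product_bounds.

(** * The branching operator *)

Section offspring.
Context {R : realType} {d : measure_display} {T : measurableType d}
  {P : probability T R}.
Variables (sigma2 eta2 : R) (N : T -> nat) (X : nat -> T -> R) (M D : T -> R).

Let E := expect P.

(** The form of the standing assumptions used by the analysis: [M] stands for
    [Lambda] and bounds the displacements at every sample point.  Integrability is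
    asked explicitly, the value of [expect] being arbitrary without it. *)
Record offspring_law : Prop := OffspringLaw {
  ol_mN : measurable_fun setT N;
  ol_mX : forall i, measurable_fun setT (X i);
  ol_mM : measurable_fun setT M;
  ol_mD : measurable_fun setT D;
  ol_M0 : forall w, 0 <= M w;
  ol_D0 : forall w, 0 <= D w;
  ol_XM : forall w i, (i < N w)%N -> X i w <= M w;
  ol_IN2 : summable P (fun w => (N w)%:R ^+ 2);
  ol_EN : E (fun w => (N w)%:R) = 1;
  ol_EN2 : E (fun w => (N w)%:R ^+ 2) = sigma2 + 1;
  ol_IS2 : summable P (fun w => \sum_(i < N w) X i w ^+ 2);
  ol_ES2 : E (fun w => \sum_(i < N w) X i w ^+ 2) = eta2;
  ol_ES1 : E (fun w => \sum_(i < N w) X i w) = 0;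
  ol_ID : summable P D;
  ol_ED : E D = 1;
  ol_tail : forall e, 0 < e -> exists2 m0 : R, 0 < m0 &
    forall m, m0 <= m -> E (fun w => (m < M w)%R%:R) <= e / m ^+ 4 }.

Hypothesis ol : offspring_law.
Hypotheses (sigma20 : 0 < sigma2) (eta20 : 0 < eta2).

Definition pair_count w : R := (N w)%:R * ((N w)%:R - 1).
Definition spread w : R := \sum_(i < N w) `|X i w|.
(** Bounds all the random quantities of the law at once: the second order gains are
    only evaluated where it is at most a large constant. *)
Definition total_size w : R := M w + (N w)%:R + D w + spread w.

Let mN : measurable_fun setT (fun w => (N w)%:R : R).
Proof. by apply: (measurable_random_index (G := fun n _ => n%:R)) => //; exact: ol_mN. Qed.

Let mMlt (m : R) : measurable_fun setT (fun w => m < M w).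
Proof. by apply: measurable_fun_ltr => //; exact: ol_mM. Qed.

Let mMle (m : R) : measurable_fun setT (fun w => M w <= m).
Proof. by apply: measurable_fun_ler => //; exact: ol_mM. Qed.

Lemma summable_N : summable P (fun w => (N w)%:R).
Proof.
apply: summable_le mN (summableD (summable_cst P 1) (ol_IN2 ol)) _ => w.
rewrite ger0_norm//; have := sqr_ge0 ((N w)%:R - 1 / 2 : R); nra.
Qed.

Lemma pair_count_ge0 w : 0 <= pair_count w.
Proof.
rewrite /pair_count; case: (N w) => [|n]; first by rewrite mul0r.
by rewrite -natr1 addrK mulr_ge0// addr_ge0.
Qed.

Let pairsE w : pair_count w = (N w)%:R ^+ 2 - (N w)%:R.
Proof. by rewrite /pair_count mulrBr mulr1. Qed.

Lemma summable_pair_count : summable P pair_count.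
Proof.
have -> : pair_count = (fun w => (N w)%:R ^+ 2 - (N w)%:R) by exact/funext.
exact: summableB (ol_IN2 ol) summable_N.
Qed.

Lemma expect_pair_count : E pair_count = sigma2.
Proof.
have -> : pair_count = (fun w => (N w)%:R ^+ 2 - (N w)%:R) by exact/funext.
rewrite /E expectB//; [|exact: ol_IN2|exact: summable_N].
have := ol_EN ol; have := ol_EN2 ol; rewrite /E => -> ->; lra.
Qed.

Lemma measurable_spread : measurable_fun setT spread.
Proof.
apply: (measurable_random_sum (h := fun i w => `|X i w|)); first exact: ol_mN.
by move=> i; apply: measurableT_comp => //; exact: ol_mX.
Qed.

Lemma spread_ge0 w : 0 <= spread w.
Proof. by apply: sumr_ge0 => i _. Qed.

(** Young's inequality, with the weight left free. *)
Lemma spread_young w a : 0 < a ->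
  spread w <= a / 2 * (\sum_(i < N w) X i w ^+ 2) + (2 * a)^-1 * (N w)%:R.
Proof.
move=> a0; rewrite /spread mulr_sumr.
have -> : (2 * a)^-1 * (N w)%:R = \sum_(i < N w) (2 * a)^-1.
  by rewrite sumr_const card_ord mulr_natr.
rewrite -big_split/=; apply: ler_sum => i _.
rewrite -[X i w ^+ 2]real_normK ?num_real//; move: `|X i w| => x.
have := sqr_ge0 (a * x - 1) => h.
rewrite -subr_ge0.
have -> : a / 2 * x ^+ 2 + (2 * a)^-1 - x = (2 * a)^-1 * (a * x - 1) ^+ 2.
  by field; rewrite gt_eqF.
by rewrite mulr_ge0// invr_ge0 mulr_ge0// ltW.
Qed.

Lemma summable_spread : summable P spread.
Proof.
apply: summable_le measurable_spread (summableD
  (summableZ (1 / 2) (ol_IS2 ol)) (summableZ (2 * 1)^-1 summable_N)) _ => w.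
by rewrite ger0_norm ?spread_ge0// spread_young.
Qed.

Lemma summable_sum : summable P (fun w => \sum_(i < N w) X i w).
Proof.
apply: summable_le summable_spread _.
  by apply: measurable_random_sum; [exact: ol_mN|exact: ol_mX].
by move=> w; exact: ler_norm_sum.
Qed.

Lemma measurable_total_size : measurable_fun setT total_size.
Proof.
apply: measurable_funD measurable_spread.
apply: measurable_funD (ol_mD ol); apply: measurable_funD (ol_mM ol) mN.
Qed.

Lemma total_size_bounds w K : total_size w <= K ->
  [/\ M w <= K, (N w)%:R <= K, D w <= K &
      forall i, (i < N w)%N -> `|X i w| <= K].
Proof.
rewrite /total_size; have := ol_M0 ol w; have := ol_D0 ol w; have := spread_ge0 w.
have := ler0n R (N w) => N0 s0 D0 M0 h.
split; [lra|lra|lra|] => i iN.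
apply: (@le_trans _ _ (spread w)); last lra.
rewrite /spread (bigD1 (Ordinal iN))//= lerDl.
by apply: sumr_ge0 => j _.
Qed.

(** Young's inequality [N <= c1 N^2 + c2] with [c1] of order [m ^- 2]: the second
    moment of [N] and the tail of order [m ^- 4] contribute equally. *)
Lemma tail_N e : 0 < e -> exists2 m0 : R, 0 < m0 &
  forall m, m0 <= m -> E (fun w => (m < M w)%R%:R * (N w)%:R) <= e / m ^+ 2.
Proof.
move=> e0; pose b := e / (sigma2 + 1).
have s1 : 0 < sigma2 + 1 by have := sigma20; lra.
have b0 : 0 < b by rewrite divr_gt0.
have [m0 m00 h] := ol_tail ol (mulr_gt0 e0 b0).
exists m0 => // m m0m; have mp : 0 < m by exact: lt_le_trans m0m.
have mp2 : 0 < m ^+ 2 by rewrite exprn_gt0.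
have im : summable P (fun w => (m < M w)%R%:R).
  apply: (@summable_bounded _ _ _ _ _ 1); first exact: measurable_boolR.
  by move=> w; case: (_ < _); rewrite ?normr1 ?normr0.
pose c1 := b / (2 * m ^+ 2); pose c2 := m ^+ 2 / (2 * b).
have c10 : 0 < c1 by rewrite /c1 divr_gt0// mulr_gt0.
have c20 : 0 < c2 by rewrite /c2 divr_gt0// mulr_gt0.
apply: (@le_trans _ _ (c1 * (sigma2 + 1) + c2 * E (fun w => (m < M w)%R%:R))).
  rewrite -(ol_EN2 ol) /E -!expectZ//; last exact: ol_IN2.
  rewrite -expectD//; [|exact: summableZ (ol_IN2 ol)|exact: summableZ].
  apply: expect_le.
  - exact: summable_indic (mMlt m) summable_N.
  - apply: summableD; first exact: summableZ (ol_IN2 ol).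
    exact: summableZ.
  move=> w; have [_|_] := ltP m (M w); last first.
    by rewrite mul0r mulr0 addr0 mulr_ge0 ?sqr_ge0// ltW.
  rewrite mul1r mulr1; move: (_%:R) => x; rewrite -subr_ge0.
  have -> : c1 * x ^+ 2 + c2 - x = (b * x - m ^+ 2) ^+ 2 / (2 * b * m ^+ 2).
    by rewrite /c1 /c2; field; rewrite !gt_eqF.
  apply: divr_ge0; first exact: sqr_ge0.
  by apply: mulr_ge0; [apply: mulr_ge0 => //|]; exact: ltW.
have := h _ m0m => hm.
apply: (@le_trans _ _ (c1 * (sigma2 + 1) + c2 * (e * b / m ^+ 4))).
  by rewrite lerD2l ler_wpM2l// ltW.
rewrite /c1 /c2 /b le_eqVlt; apply/orP; left; apply/eqP; field.
by rewrite !gt_eqF.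
Qed.

(** The same interpolation, now between [tail_N] and the second moment of the
    displacements. *)
Lemma tail_spread e : 0 < e -> exists2 m0 : R, 0 < m0 &
  forall m, m0 <= m -> E (fun w => (m < M w)%R%:R * spread w) <= e / m.
Proof.
move=> e0; pose b := e / eta2.
have b0 : 0 < b by rewrite divr_gt0.
have [m0 m00 h] := tail_N (mulr_gt0 e0 b0).
exists m0 => // m m0m; have mp : 0 < m by exact: lt_le_trans m0m.
have bm : 0 < b / m by rewrite divr_gt0.
have iN := summable_indic (mMlt m) summable_N.
apply: (@le_trans _ _ (b / m / 2 * eta2 +
    (2 * (b / m))^-1 * E (fun w => (m < M w)%R%:R * (N w)%:R))).
  rewrite -(ol_ES2 ol) /E -!expectZ//; last exact: ol_IS2.
  rewrite -expectD//; [|exact: summableZ (ol_IS2 ol)|exact: summableZ].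
  apply: expect_le.
  - exact: summable_indic (mMlt m) summable_spread.
  - apply: summableD; first exact: summableZ (ol_IS2 ol).
    exact: summableZ.
  move=> w; have [_|_] := ltP m (M w).
    by rewrite !mul1r; exact: spread_young.
  rewrite !mul0r mulr0 addr0; apply: mulr_ge0; first by rewrite divr_ge0// ltW.
  by apply: sumr_ge0 => i _; exact: sqr_ge0.
have := h _ m0m => hm.
apply: (@le_trans _ _ (b / m / 2 * eta2 + (2 * (b / m))^-1 * (e * b / m ^+ 2))).
  by rewrite lerD2l ler_wpM2l// invr_ge0 mulr_ge0// ltW.
rewrite /b le_eqVlt; apply/orP; left; apply/eqP; field.
by rewrite !gt_eqF.
Qed.

Definition branching_step (t : R) (F : R -> R) (y : R) w : R :=
  expR (- (t * D w)) * (M w <= y)%R%:R * \prod_(i < N w) F (y - X i w).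

Definition branching (t : R) (F : R -> R) (y : R) : R := E (branching_step t F y).

Definition unit_fun (F : R -> R) : Prop :=
  measurable_fun setT F /\ forall y, 0 <= F y <= 1.

Lemma measurable_branching_step t F y : measurable_fun setT F -> measurable_fun setT (branching_step t F y).
Proof.
move=> mF; apply: measurable_funM.
  apply: measurable_funM; last exact: measurable_boolR.
  apply: measurableT_comp => //; apply: measurableT_comp => //.
  by apply: measurable_funM => //; exact: ol_mD.
apply: (measurable_random_prod (h := fun i w => F (y - X i w))); first exact: ol_mN.
move=> i; apply: measurableT_comp => //.
by apply: measurable_funB => //; exact: ol_mX.
Qed.

Lemma branching_step_unit t F y w : 0 <= t -> unit_fun F -> 0 <= branching_step t F y w <= 1.
Proof.
move=> t0 [_ F01]; rewrite /branching_step.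
have /andP[p0 p1] : 0 <= \prod_(i < N w) F (y - X i w) <= 1.
  by apply: (@prod_unit _ (fun i => F (y - X i w))).
have e0 := expR_ge0 (- (t * D w)).
have e1 : expR (- (t * D w)) <= 1.
  by rewrite -expR0 ler_expR oppr_le0 mulr_ge0// (ol_D0 ol).
case: (M w <= y); rewrite ?mulr1 ?mulr0 ?mul0r ?lexx ?ler01//.
by rewrite mulr_ge0//= mulr_ile1.
Qed.

Lemma summable_branching_step t F y : 0 <= t -> unit_fun F -> summable P (branching_step t F y).
Proof.
move=> t0 F01; apply: (@summable_bounded _ _ _ _ _ 1).
  by apply: measurable_branching_step; case: F01.
by move=> w; have /andP[h0 h1] := branching_step_unit y w t0 F01; rewrite ger0_norm.
Qed.

Lemma branching_unit t F y : 0 <= t -> unit_fun F -> 0 <= branching t F y <= 1.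
Proof.
move=> t0 F01; apply/andP; split.
  by apply: expect_ge0 => w; have /andP[] := branching_step_unit y w t0 F01.
rewrite /branching /E -[leRHS](expect_cst P 1).
apply: expect_le; [exact: summable_branching_step|exact: summable_cst|move=> w].
by have /andP[] := branching_step_unit y w t0 F01.
Qed.

Lemma branching_le t t' F G y y' : 0 <= t' -> t' <= t -> y <= y' ->
  unit_fun F -> unit_fun G ->
  (forall x, F (y - x) <= G (y' - x)) -> branching t F y <= branching t' G y'.
Proof.
move=> t0 tt yy uF uG FG.
apply: expect_le; [apply: summable_branching_step => //; exact: le_trans tt|exact: summable_branching_step|move=> w].
rewrite /branching_step; apply: ler_pM.
- by rewrite mulr_ge0// expR_ge0.
- by apply: prodr_ge0 => i _; have [_ /(_ (y - X i w))/andP[]] := uF.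
- apply: ler_pM; rewrite ?expR_ge0//.
    by rewrite ler_expR lerN2 ler_wpM2r// (ol_D0 ol).
  rewrite ler_nat; have [My|//] := leP (M w) y.
  by rewrite (le_trans My yy).
- apply: (@prod_le _ (fun i => F (y - X i w)) (fun i => G (y' - X i w))) => i _.
  by have [_ /(_ (y - X i w))/andP[-> _]] := uF; rewrite FG.
Qed.

(** The Laplace functional of the tree cut at generation [n]. *)
Fixpoint laplace_trunc (t : R) (n : nat) : R -> R :=
  if n is m.+1 then branching t (laplace_trunc t m) else fun=> 1.

(** Bounds and monotonicity are proved together because each step of the recursion
    uses both. *)
Lemma laplace_trunc_spec n : (forall t, 0 <= t -> unit_fun (laplace_trunc t n)) /\
  (forall t t' y y', 0 <= t' -> t' <= t -> y <= y' -> laplace_trunc t n y <= laplace_trunc t' n y').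
Proof.
elim: n => [|n [ihu ihm]].
  split=> // t t0; split=> [|y]; first exact: measurable_cst.
  by rewrite ler01 lexx.
have mono : forall t t' y y', 0 <= t' -> t' <= t -> y <= y' ->
    laplace_trunc t n.+1 y <= laplace_trunc t' n.+1 y'.
  move=> t t' y y' t0 tt yy; apply: branching_le => //.
  - by apply: ihu; exact: le_trans tt.
  - exact: ihu.
  - by move=> x; apply: ihm => //; rewrite lerD2r.
split => // t t0; split; last by move=> y; apply: branching_unit => //; exact: ihu.
by apply: nondecreasing_measurable => // y y' yy; exact: mono.
Qed.

Lemma laplace_trunc_unit n t : 0 <= t -> unit_fun (laplace_trunc t n).
Proof. by have [h _] := laplace_trunc_spec n; exact: h. Qed.

Lemma laplace_trunc_le n t t' y y' : 0 <= t' -> t' <= t -> y <= y' ->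
  laplace_trunc t n y <= laplace_trunc t' n y'.
Proof. by have [_ h] := laplace_trunc_spec n; exact: h. Qed.

Lemma laplace_trunc_decr n t y : 0 <= t -> laplace_trunc t n.+1 y <= laplace_trunc t n y.
Proof.
move=> t0; elim: n y => [|n ih] y.
  by have [_ /(_ y)/andP[]] := laplace_trunc_unit 1 t0.
by apply: branching_le => //; [exact: (laplace_trunc_unit n.+1 t0)|exact: laplace_trunc_unit|move=> x; exact: ih].
Qed.

(** The iterates decrease, so the infimum is their limit. *)
Definition laplace_functional (t y : R) : R := inf (range (fun n => laplace_trunc t n y)).

Section fixed_t.
Variable t : R.
Hypothesis t0 : 0 <= t.

Let lb y : has_lbound (range (fun n => laplace_trunc t n y)).
Proof.
by exists 0 => _ [n _ <-]; have [_ /(_ y)/andP[]] := laplace_trunc_unit n t0.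
Qed.

Lemma laplace_le_trunc n y : laplace_functional t y <= laplace_trunc t n y.
Proof. by apply: ge_inf => //; exists n. Qed.

Lemma laplace_ge c y : (forall n, c <= laplace_trunc t n y) -> c <= laplace_functional t y.
Proof.
move=> h; apply: lb_le_inf; first by exists (laplace_trunc t 0 y), 0%N.
by move=> _ [n _ <-].
Qed.

Lemma laplace_cvg y : laplace_trunc t n y @[n --> \oo] --> laplace_functional t y.
Proof.
apply: (@nonincreasing_cvgn R (fun n => laplace_trunc t n y)) => //.
by apply/nonincreasing_seqP => n; exact: laplace_trunc_decr.
Qed.

Lemma laplace_bounds y : 0 <= laplace_functional t y <= 1.
Proof.
apply/andP; split; last exact: laplace_le_trunc 0%N y.
by apply: laplace_ge => n; have [_ /(_ y)/andP[]] := laplace_trunc_unit n t0.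
Qed.

End fixed_t.

Lemma laplace_le t t' y y' : 0 <= t' -> t' <= t -> y <= y' ->
  laplace_functional t y <= laplace_functional t' y'.
Proof.
move=> t0 tt yy; apply: laplace_ge => n.
apply: le_trans (laplace_trunc_le n t0 tt yy); apply: laplace_le_trunc.
exact: le_trans tt.
Qed.

Lemma laplace_unit t : 0 <= t -> unit_fun (laplace_functional t).
Proof.
move=> t0; split; last by move=> y; exact: laplace_bounds.
by apply: nondecreasing_measurable => // y y' yy; exact: laplace_le.
Qed.

(** A function which the operator does not decrease lies below all the iterates
    started from 1; where it is already known to lie below the limit there is
    nothing to verify, which provides the boundary condition. *)
Lemma comparison_below t G : 0 <= t -> unit_fun G ->
  (forall y, G y <= laplace_functional t y \/ G y <= branching t G y) ->
  forall y, G y <= laplace_functional t y.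
Proof.
move=> t0 uG h y; apply: laplace_ge => n.
elim: n y => [|n ih] y; first by have [_ /(_ y)/andP[]] := uG.
have [hl|hb] := h y; first by apply: le_trans hl _; exact: laplace_le_trunc.
by apply: le_trans hb _; apply: branching_le => //; exact: laplace_trunc_unit.
Qed.

(** [laplace_functional t] lies below every iterate, so its image lies below every
    next iterate. *)
Lemma branching_laplace t y : 0 <= t -> branching t (laplace_functional t) y <= laplace_functional t y.
Proof.
move=> t0; apply: laplace_ge => -[|n].
  by have /andP[] := branching_unit y t0 (laplace_unit t0).
apply: branching_le => //; [exact: laplace_unit|exact: laplace_trunc_unit|].
by move=> x; exact: laplace_le_trunc.
Qed.

(** The probability that the genealogical tree reaches generation [n]. *)
Fixpoint survival (n : nat) : R :=
  if n is m.+1 then E (fun w => 1 - (1 - survival m) ^+ N w) else 1.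

Lemma summable_pow (p : R) : 0 <= p <= 1 -> summable P (fun w => 1 - (1 - p) ^+ N w).
Proof.
move=> /andP[p0 p1]; apply: summableB; first exact: summable_cst.
apply: (@summable_bounded _ _ _ _ _ 1).
  by apply: (measurable_random_index (G := fun n _ => (1 - p) ^+ n)); [exact: ol_mN|].
by move=> w; rewrite ger0_norm ?exprn_ge0 ?exprn_ile1//; lra.
Qed.

Lemma survival_unit n : 0 <= survival n <= 1.
Proof.
elim: n => [|n ih] /=; first by rewrite ler01 lexx.
have /andP[p0 p1] := ih.
have q w : 0 <= (1 - survival n) ^+ N w <= 1 by rewrite exprn_ge0 ?exprn_ile1//; lra.
apply/andP; split.
  by apply: expect_ge0 => w; have /andP[? ?] := q w; rewrite subr_ge0.
rewrite /E -[leRHS](expect_cst P 1).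
apply: expect_le; [exact: summable_pow|exact: summable_cst|move=> w].
by have /andP[? ?] := q w; rewrite gerBl.
Qed.

(** The iteration starts from 1, at distance at most [survival 0] above [G], and the
    operator propagates such an error no worse than survival probabilities. *)
Lemma laplace_trunc_above t G : 0 <= t -> unit_fun G -> (forall y, branching t G y <= G y) ->
  forall n y, laplace_trunc t n y <= G y + survival n.
Proof.
move=> t0 uG h; elim=> [|n ih] y /=.
  by have [_ /(_ y)/andP[? _]] := uG; rewrite lerDr.
have ps := survival_unit n.
pose G' y := Num.min 1 (G y + survival n).
have uG' : unit_fun G'.
  split; first by apply: measurable_minr => //; apply: measurable_funD => //; case: uG.
  move=> x; have [_ /(_ x)/andP[? ?]] := uG; have /andP[? ?] := ps.
  by rewrite /G' le_min ler01 ge_min lexx/= addr_ge0.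
apply: (@le_trans _ _ (branching t G' y)).
  apply: branching_le => //; first exact: laplace_trunc_unit.
  by move=> x; rewrite le_min ih andbT; have [_ /(_ (y - x))/andP[]] := laplace_trunc_unit n t0.
apply: (@le_trans _ _ (branching t G y + E (fun w => 1 - (1 - survival n) ^+ N w))); last first.
  by rewrite lerD2r.
rewrite /branching /E -expectD; [|exact: summable_branching_step|exact: summable_pow].
apply: expect_le; [exact: summable_branching_step| |move=> w].
  by apply: summableD; [exact: summable_branching_step|exact: summable_pow].
rewrite /branching_step.
have [_ uG1] := uG.
have := @prod_shift _ (fun i => G (y - X i w)) (survival n) (N w) (fun i _ => uG1 _) ps.
rewrite -/G'; set A := \prod_(i < N w) _; set B := \prod_(i < N w) _.
set q := 1 - _ ^+ _ => AB.
have q0 : 0 <= q.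
  by rewrite subr_ge0 exprn_ile1//; case/andP: ps; lra.
have e0 := expR_ge0 (- (t * D w)).
have e1 : expR (- (t * D w)) <= 1.
  by rewrite -expR0 ler_expR oppr_le0 mulr_ge0// (ol_D0 ol).
set c := expR _ * _.
have /andP[c0 c1] : 0 <= c <= 1.
  by rewrite /c; case: (M w <= y); rewrite ?mulr1 ?mulr0 ?e0 ?e1 ?lexx ?ler01.
have : c * A <= c * (B + q) by rewrite ler_wpM2l.
have : c * q <= q by rewrite ler_piMl.
lra.
Qed.

End offspring.

(** * Extinction and a priori smallness of the defect *)

Ltac solve_summable := repeat first
  [ assumption | apply: summableB | apply: summableD | apply: summableZ
  | apply: summable_cst ].

Section asymptotics.
Context {R : realType} {d : measure_display} {T : measurableType d}
  {P : probability T R}.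
Variables (sigma2 eta2 : R) (N : T -> nat) (X : nat -> T -> R) (M D : T -> R).
Hypothesis ol : offspring_law (P := P) sigma2 eta2 N X M D.
Hypotheses (sigma20 : 0 < sigma2) (eta20 : 0 < eta2).

Let E := expect P.
Let pairs := pair_count (R := R) N.
Let spr := spread N X.
Let total := total_size N X M D.
Let laplace := laplace_functional (P := P) N X M D.
Let branch := branching (P := P) N X M D.
Let step := branching_step N X M D.
Let surv := survival (P := P) N.

Let mhle (K : R) : measurable_fun setT (fun w => total w <= K).
Proof. by apply: measurable_fun_ler => //; exact: (measurable_total_size ol). Qed.

Let mhlt (K : R) : measurable_fun setT (fun w => K < total w).
Proof. by apply: measurable_fun_ltr => //; exact: (measurable_total_size ol). Qed.

Let summable_bool (b : T -> bool) : measurable_fun setT b -> summable P (fun w => (b w)%:R).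
Proof.
move=> mb; apply: (@summable_bounded _ _ _ _ _ 1); first exact: measurable_boolR.
by move=> w; case: (b w); rewrite ?normr1 ?normr0.
Qed.

Lemma expect_total_size f e : summable P f -> (forall w, 0 <= f w) -> 0 < e ->
  exists2 K0 : R, 0 < K0 & forall K, K0 <= K ->
    E f - e <= E (fun w => (total w <= K)%R%:R * f w).
Proof.
move=> fi f0 e0; have [K0 h] := expect_tail fi f0 (measurable_total_size ol) e0.
exists (Num.max 1 K0); first by rewrite lt_max ltr01.
move=> K; rewrite ge_max => /andP[_ /h hK].
have -> : (fun w => (total w <= K)%R%:R * f w) =
    (fun w => f w - (K < total w)%R%:R * f w).
  by apply/funext => w; rewrite leNgt; case: (_ < _); rewrite ?mul1r ?mul0r ?subrr ?subr0.
rewrite /E expectB//; last exact: summable_indic (mhlt K) fi.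
by rewrite lerD2l lerN2.
Qed.

(** Truncating at [K0] keeps half of the mean number of pairs of siblings: this
    yields a quadratic gain with an explicit constant [c]. *)
Section gain.
Variable K0 : R.
Hypotheses (K00 : 0 < K0)
  (hK0 : sigma2 / 2 <= E (fun w => (total w <= K0)%R%:R * pairs w)).

Let gain w : R := (total w <= K0)%R%:R * pairs w.
Let c : R := K0^-1 ^+ 2 * E gain.

Let c_gt0 : 0 < c.
Proof.
rewrite mulr_gt0 ?exprn_gt0 ?invr_gt0//; apply: lt_le_trans hK0.
by rewrite divr_gt0.
Qed.

Let summable_gain : summable P gain.
Proof. exact: summable_indic (mhle K0) (summable_pair_count ol). Qed.

Let expr_gain p w : 0 <= p <= 1 ->
  1 - (1 - p) ^+ N w <= p * (N w)%:R - p ^+ 2 * (K0^-1 ^+ 2 * gain w).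
Proof.
move=> p01; have h := expr_lower (N w) p01.
suff : K0^-1 ^+ 2 * gain w <= (2 <= N w)%N%:R.
  by move=> h2; have : p ^+ 2 * (K0^-1 ^+ 2 * gain w) <= p ^+ 2 * (2 <= N w)%N%:R;
    [rewrite ler_wpM2l ?sqr_ge0|lra].
rewrite /gain; have [hw|_] := leP (total w) K0; last by rewrite mul0r mulr0.
rewrite mul1r; have [_ NK _ _] := total_size_bounds ol hw.
have [N2|N1] := leqP 2 (N w); last first.
  rewrite (_ : pairs w = 0) ?mulr0// /pairs /pair_count.
  by case: (N w) N1 => [|[|]]//; rewrite ?mul0r// subrr mulr0.
rewrite exprVn mulrC ler_pdivrMr ?exprn_gt0// mul1r /pairs /pair_count.
have := ler0n R (N w); nra.
Qed.

(** Criticality cancels the linear term and leaves the quadratic gain. *)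
Lemma survival_step n : surv n.+1 <= surv n - c * surv n ^+ 2.
Proof.
have ps : 0 <= surv n <= 1 by exact: (survival_unit ol).
apply: (@le_trans _ _ (E (fun w => surv n * (N w)%:R - surv n ^+ 2 * (K0^-1 ^+ 2 * gain w)))).
  apply: expect_le; last by move=> w; exact: expr_gain.
    exact: (summable_pow ol).
  by have iN := summable_N ol; solve_summable.
have iN := summable_N ol.
rewrite /E expectB; [|by solve_summable|by solve_summable]; rewrite !expectZ//; last by solve_summable.
have := ol_EN ol; rewrite /E => ->; rewrite mulr1 lerD2l lerN2.
by rewrite [leLHS]mulrC /c.
Qed.

Lemma survival_to0 e : 0 < e -> exists n, surv n <= e.
Proof.
move=> e0; apply: contrapT => /forallNP h.
have h1 n : surv n <= 1 - n%:R * (c * e ^+ 2).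
  elim: n => [|n ih]; first by rewrite mul0r subr0.
  apply: le_trans (survival_step n) _; rewrite -(natr1 n) mulrDl mul1r.
  have : e ^+ 2 <= surv n ^+ 2.
    have : e < surv n by rewrite ltNge; apply/negP/h.
    by move=> es; rewrite lerXn2r ?nnegrE ?ltW//; exact: lt_trans es.
  have := c_gt0 => cp es; have : c * e ^+ 2 <= c * surv n ^+ 2 by rewrite ler_pM2l.
  lra.
have ce : 0 < c * e ^+ 2 by rewrite mulr_gt0 ?exprn_gt0.
have [n hn] : exists n : nat, (c * e ^+ 2)^-1 < n%:R.
  by exists (Num.truncn (c * e ^+ 2)^-1).+1; exact: truncnS_gt.
have := h1 n.+1; rewrite -(natr1 n).
have /andP[s0 _] := survival_unit ol n.+1.
have : 1 < n%:R * (c * e ^+ 2) by rewrite -ltr_pdivrMr// div1r.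
rewrite /surv in s0 *; lra.
Qed.

(** The unknown of the limiting equation. *)
Let defect t y : R := 1 - laplace t y.

(** Where [total <= K] the children move by [K] at most and see a barrier no closer
    than [y - K]; the rest of the space costs its probability. *)
Lemma defect_step t y K : 0 <= t -> K0 <= K -> K <= y ->
  defect t y <= t + E (fun w => (K < total w)%R%:R) + defect t (y - K)
                - c * defect t (y - K) ^+ 2.
Proof.
move=> t0 KK Ky; set om := defect t (y - K).
have uL := laplace_unit ol t0.
have om01 : 0 <= om <= 1.
  by have [_ /(_ (y - K))/andP[a b]] := uL; rewrite /om /defect /laplace; apply/andP; split; lra.
have iN := summable_N ol; have iD := ol_ID ol; have iH := summable_bool (mhlt K).
have iS := summable_branching_step ol y t0 uL.
apply: (@le_trans _ _ (E (fun w => t * D w + (K < total w)%R%:R +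
    (om * (N w)%:R - om ^+ 2 * (K0^-1 ^+ 2 * gain w))))); last first.
  rewrite /E expectD; [|by solve_summable|by solve_summable]; rewrite expectD; [|by solve_summable|by solve_summable].
  rewrite expectB; [|by solve_summable|by solve_summable]; rewrite !expectZ//; last by solve_summable.
  have := ol_EN ol; have := ol_ED ol; rewrite /E => -> ->.
  rewrite /c /E /defect; lra.
apply: (@le_trans _ _ (1 - branch t (laplace t) y)).
  by rewrite /defect lerD2l lerN2; exact: (branching_laplace ol).
rewrite /branch /branching -[X in X - _](expect_cst P 1) -expectB; [|by solve_summable|by solve_summable].
apply: expect_le; [by solve_summable|by solve_summable|move=> w].
have := expr_gain w om01 => hg.
have /andP[s0 s1] := branching_step_unit ol y w t0 uL.
have tD : 0 <= t * D w by rewrite mulr_ge0// (ol_D0 ol).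
have [Kh|hK] := ltP K (total w).
  have g0 : gain w = 0 by rewrite /gain leNgt (le_lt_trans KK Kh) mul0r.
  have : 0 <= om * (N w)%:R by rewrite mulr_ge0//; case/andP: om01.
  rewrite g0 !mulr0 /=; lra.
have [MK _ _ XK] := total_size_bounds ol hK.
rewrite /step /branching_step (le_trans MK Ky) mulr1 /= mulr0n addr0.
have pw : (1 - om) ^+ N w <= \prod_(i < N w) laplace t (y - X i w).
  rewrite -[X in _ ^+ X]card_ord -prodr_const.
  apply: (@prod_le _ (fun=> 1 - om) (fun i => laplace t (y - X i w))) => i iN'.
  rewrite /om /defect subKr; apply/andP; split.
    by have [_ /(_ (y - K))/andP[a _]] := uL.
  apply: (laplace_le ol) => //; rewrite lerD2l lerN2.
  by apply: le_trans (ler_norm _) (XK i iN').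
have /andP[p0 p1] : 0 <= \prod_(i < N w) laplace t (y - X i w) <= 1.
  apply: (@prod_unit _ (fun i => laplace t (y - X i w))) => i _.
  by have [_] := uL; exact.
have := expR_ge1Dx (- (t * D w)); have := expR_ge0 (- (t * D w)).
rewrite -/(laplace t); set e := expR _; set p := \prod_(i < N w) _ => e0 e1.
have : (1 - t * D w) * p <= e * p by rewrite ler_wpM2r.
rewrite -/p in pw p0 p1; nra.
Qed.

(** The infimum [l] of the defect over all [t > 0] and [y] is its limit as [t] tends
    to 0 and [y] to infinity.  Passing to the limit in [defect_step] gives
    [l <= l - c l ^+ 2 + o(1)], hence [l = 0]. *)
Lemma defect_small_of_gain e : 0 < e -> exists L : R, exists2 t1 : R, 0 < t1 &
  forall t y, 0 <= t -> t <= t1 -> L <= y -> 1 - laplace t y <= e.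
Proof.
move=> e0.
pose A := [set defect u.1 u.2 | u in [set u : R * R | 0 < u.1]].
have A0 : A !=set0 by exists (defect 1 0); exists (1, 0) => //=.
have lbA : has_lbound A.
  exists 0 => _ [[t y] /= t0 <-]; rewrite /defect subr_ge0.
  by have /andP[] := laplace_bounds ol (ltW t0) y.
have l0 : 0 <= inf A.
  apply: lb_le_inf => // _ [[t y] /= t0 <-]; rewrite /defect subr_ge0.
  by have /andP[] := laplace_bounds ol (ltW t0) y.
have mono t y t' y' : 0 <= t' -> t' <= t -> y <= y' -> defect t' y' <= defect t y.
  by move=> *; rewrite /defect lerD2l lerN2; exact: (laplace_le ol).
have inA t y : 0 < t -> A (defect t y) by move=> t0; exists (t, y).
suff le0 : inf A = 0.
  have [_ [[t y] /= t0 <-] h] : exists2 y, A y & y < e by apply: inf_lt => //; rewrite le0.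
  exists y, t => // t' y' t'0 tt yy; apply: le_trans (ltW h).
  exact: mono.
apply/eqP; rewrite eq_le l0 andbT leNgt; apply/negP => lp.
(* t, the tail and the distance to the infimum add up to less than 4 eta *)
pose l := inf A; pose eta := c * l ^+ 2 / 4.
have cp := c_gt0.
have eta0 : 0 < eta by rewrite /eta divr_gt0// mulr_gt0// exprn_gt0.
have [K1 hK1] := expect_tail (summable_cst P 1) (fun=> ler01) (measurable_total_size ol) eta0.
pose K := Num.max K0 K1.
have KK0 : K0 <= K by rewrite le_max lexx.
have hK : E (fun w => (K < total w)%R%:R) <= eta.
  apply: le_trans (hK1 K _); last by rewrite le_max lexx orbT.
  rewrite le_eqVlt; apply/orP; left; apply/eqP; congr expect.
  by apply/funext => w; rewrite mulr1.
have [_ [[t1 y1] /= t10 <-] h1] := inf_adherent eta0 (conj A0 lbA).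
pose t := Num.min t1 eta; pose y := Num.max K (y1 + K).
have t0 : 0 < t by rewrite lt_min t10.
have tt1 : t <= t1 by rewrite ge_min lexx.
have teta : t <= eta by rewrite ge_min lexx orbT.
have Ky : K <= y by rewrite le_max lexx.
have y1y : y1 <= y - K by rewrite lerBrDr le_max lexx orbT.
have h2 : l <= defect t y by apply: ge_inf => //; exact: inA.
have h3 : l <= defect t (y - K) by apply: ge_inf => //; exact: inA.
have h4 : defect t (y - K) <= defect t1 y1 by apply: mono => //; exact: ltW.
have h5 := defect_step (ltW t0) KK0 Ky.
have h6 : c * l ^+ 2 <= c * defect t (y - K) ^+ 2.
  rewrite ler_pM2l//; apply: (lerXn2r _ _ _ h3); rewrite nnegrE; first exact: ltW.
  exact: le_trans (ltW lp) h3.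
have h7 : c * l ^+ 2 = 4 * eta by rewrite /eta; lra.
rewrite -/l in h1 lp.
lra.
Qed.

End gain.
End asymptotics.

(** * Local comparison with stationary solutions *)

(** The numerical ends of the two local comparisons.  Here [v], [Vm] and [Vm'] are the
    values of the solution at [y], [(1 - h) y] and [(1 + h) y]; [F], [Fn] and [C] come
    from large displacements; [H], [H2] and [HD] are truncated moments.  The factor
    [1 + eps] or [1 - eps] leaves a margin of order [s2 eps v ^+ 2], while each error
    is at most a small multiple of it. *)
Section arithmetic.
Context {R : realType}.

Lemma super_arith (s2 e2 eps w v Vm Vm' F C H K delta : R) :
  0 < s2 -> 0 < e2 -> 0 < eps -> eps <= 1 -> 0 < K -> 0 < v -> v <= delta ->
  delta <= s2 * eps / (64 * K ^+ 3) ->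
  0 <= Vm -> Vm <= (1 + eps / 16) * v ->
  (1 - eps / 16) * v <= Vm' -> Vm' <= v ->
  F <= s2 * eps / 40 * v ^+ 2 -> C <= s2 * eps / 40 * v ^+ 2 ->
  s2 - s2 * eps / 40 <= H ->
  F + (s2 / 2 * w ^+ 2 + ((1 + eps) * v +
    ((1 + eps) * (s2 / e2 * (Vm ^+ 2 - w ^+ 2) / 2) * e2 +
    ((1 + eps) * C + (- (((1 + eps) * Vm') ^+ 2 / 2) * H +
      K ^+ 3 * ((1 + eps) * Vm') ^+ 3))))) <= (1 + eps) * v.
Proof.
move=> s20 e20 ep0 ep1 K0 v0 vd dK Vm0 hVm hVm' Vm'v hF hC hH.
have v20 : 0 < v ^+ 2 by rewrite exprn_gt0.
have Vm'0 : 0 < Vm' by apply: lt_le_trans hVm'; rewrite mulr_gt0//; lra.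
have K30 : 0 < K ^+ 3 by rewrite exprn_gt0.
have Vm2 : Vm ^+ 2 <= (1 + eps / 16) ^+ 2 * v ^+ 2.
  rewrite -exprMn; apply: (lerXn2r _ _ _ hVm); rewrite nnegrE//.
  exact: le_trans hVm.
have Vm'2 : (1 - eps / 16) ^+ 2 * v ^+ 2 <= Vm' ^+ 2.
  by rewrite -exprMn; apply: (lerXn2r _ _ _ hVm'); rewrite nnegrE ?(ltW Vm'0)// mulr_ge0 ?ltW//; lra.
have cub : K ^+ 3 * ((1 + eps) * Vm') ^+ 3 <= s2 * eps / 8 * v ^+ 2.
  have c1 : ((1 + eps) * Vm') ^+ 3 <= (2 * v) ^+ 3.
    apply: lerXn2r; rewrite ?nnegrE; [|by rewrite mulr_ge0// ltW|].
      by rewrite mulr_ge0// ltW//; lra.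
    by apply: ler_pM => //; [clear -ep0; lra|exact: ltW|clear -ep1; lra].
  apply: (@le_trans _ _ (K ^+ 3 * (2 * v) ^+ 3)); first by rewrite ler_pM2l.
  have c2 : K ^+ 3 * v <= s2 * eps / 64.
    have : K ^+ 3 * v <= K ^+ 3 * (s2 * eps / (64 * K ^+ 3)).
      by rewrite ler_pM2l//; exact: le_trans dK.
    suff -> : K ^+ 3 * (s2 * eps / (64 * K ^+ 3)) = s2 * eps / 64 by [].
    by field; rewrite gt_eqF.
  have -> : K ^+ 3 * (2 * v) ^+ 3 = 8 * (K ^+ 3 * v) * v ^+ 2 by ring.
  by rewrite ler_pM2r//; lra.
have se0 : 0 < s2 * eps by rewrite mulr_gt0.
have H2 : ((1 + eps) * Vm') ^+ 2 * (s2 - s2 * eps / 40) <= ((1 + eps) * Vm') ^+ 2 * H.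
  by rewrite ler_wpM2l ?sqr_ge0.
have se1 : s2 * eps <= s2 by rewrite ler_piMr// ltW.
have H3 : (1 + eps) ^+ 2 * ((1 - eps / 16) ^+ 2 * v ^+ 2) * (s2 - s2 * eps / 40) <=
    ((1 + eps) * Vm') ^+ 2 * (s2 - s2 * eps / 40).
  by rewrite ler_wpM2r ?exprMn ?ler_wpM2l ?sqr_ge0//; lra.
have -> : (1 + eps) * (s2 / e2 * (Vm ^+ 2 - w ^+ 2) / 2) * e2 =
   (1 + eps) * (s2 / 2) * Vm ^+ 2 - (1 + eps) * (s2 / 2 * w ^+ 2).
  by field; rewrite gt_eqF.
have H4 : (1 + eps) * (s2 / 2) * Vm ^+ 2 <=
   (1 + eps) * (s2 / 2) * ((1 + eps / 16) ^+ 2 * v ^+ 2).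
  by rewrite ler_wpM2l// mulr_ge0//; clear -ep0 s20; lra.
have w2 : 0 <= eps * (s2 / 2 * w ^+ 2).
  by apply: mulr_ge0; [exact: ltW|apply: mulr_ge0; [clear -s20; lra|exact: sqr_ge0]].
have H5 : (1 + eps) * C <= (1 + eps) * (s2 * eps / 40 * v ^+ 2).
  by rewrite ler_wpM2l//; clear -ep0; lra.
suff H6 : (s2 * eps / 40 + (1 + eps) * (s2 / 2) * (1 + eps / 16) ^+ 2
   + (1 + eps) * (s2 * eps / 40)
   - (1 + eps) ^+ 2 * (1 - eps / 16) ^+ 2 * (s2 - s2 * eps / 40) / 2
   + s2 * eps / 8) * v ^+ 2 <= 0 by lra.
rewrite pmulr_lle0//.
have q1 : (1 + eps) ^+ 2 * (1 - eps / 16) ^+ 2 <= 4.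
  have a1 : (1 + eps) ^+ 2 <= 4 by clear -ep0 ep1; nra.
  have a2 : (1 - eps / 16) ^+ 2 <= 1 by clear -ep0 ep1; nra.
  by rewrite -[4]mulr1; apply: ler_pM => //; exact: sqr_ge0.
have q2 : (1 + eps / 16) ^+ 2 - (1 + eps) * (1 - eps / 16) ^+ 2 <= - (eps / 2).
  have : 3 / 4 <= (1 - eps / 16) ^+ 2 by clear -ep0 ep1; nra.
  move=> q; have : eps * (3 / 4) <= eps * (1 - eps / 16) ^+ 2 by rewrite ler_pM2l.
  clear; lra.
have q3 : (1 + eps) * (s2 / 2) * ((1 + eps / 16) ^+ 2 - (1 + eps) * (1 - eps / 16) ^+ 2)
    <= (1 + eps) * (s2 / 2) * - (eps / 2).
  by rewrite ler_wpM2l// mulr_ge0//; clear -ep0 s20; lra.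
have q4 : s2 * eps / 40 * ((1 + eps) ^+ 2 * (1 - eps / 16) ^+ 2) <= s2 * eps / 40 * 4.
  by rewrite ler_wpM2l//; clear -se0; lra.
have q5 : 0 <= s2 * eps * eps by rewrite mulr_ge0 ?ltW.
have q6 : (1 + eps) * (s2 * eps / 40) <= 2 * (s2 * eps / 40) by rewrite ler_wpM2r//; clear -se0 ep1; lra.
lra.
Qed.

Lemma sub_arith (s2 e2 eps w v Vm Vm' Fn C H2 HD K delta : R) :
  0 < s2 -> 0 < e2 -> 0 < eps -> eps < 1 -> 0 < K -> 0 < v -> w <= v -> 0 < w ->
  v <= delta -> delta <= 1 -> Vm <= delta ->
  K * delta <= eps / 4 -> K * (s2 / 2 * delta) <= eps / 4 ->
  0 <= Vm -> Vm <= (1 + eps / 16) * v ->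
  (1 - eps / 16) * v <= Vm' -> w <= Vm' ->
  Fn <= s2 * eps / 40 * v -> C <= s2 * eps / 40 * v ^+ 2 ->
  e2 - s2 * eps / 40 / (s2 / e2) <= H2 -> 1 - eps / 4 <= HD ->
  (1 - eps) * v <= (1 - eps) * v - (1 - eps) * C - (1 - eps) * v * Fn
    + (1 - eps) * (s2 / e2 * (Vm' ^+ 2 - w ^+ 2) / 2) * H2
    + s2 / 2 * w ^+ 2 * ((1 - K * (s2 / 2 * w ^+ 2)) * (1 - K * ((1 - eps) * Vm))) * HD
    - ((1 - eps) * Vm) ^+ 2 / 2 * s2.
Proof.
move=> s20 e20 ep0 ep1 K0 v0 wv w0 vd d1 Vmd Kd Ktd Vm0 hVm hVm' wVm' hF hC hH2 hHD.
set t := s2 / 2 * w ^+ 2.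
have t0 : 0 < t by rewrite mulr_gt0 ?exprn_gt0// divr_gt0.
have v20 : 0 < v ^+ 2 by rewrite exprn_gt0.
have se0 : 0 < s2 * eps by rewrite mulr_gt0.
have lam0 : 0 < 1 - eps by lra.
have tK : K * t <= eps / 4.
  apply: le_trans Ktd; rewrite ler_pM2l// /t ler_pM2l ?divr_gt0//.
  have wd : w <= delta by exact: le_trans vd.
  have w1 : w <= 1 by exact: le_trans d1.
  by apply: le_trans wd; rewrite expr2 ler_piMl// ltW.
have Kb : K * ((1 - eps) * Vm) <= eps / 4.
  apply: le_trans Kd; rewrite ler_pM2l//; apply: le_trans Vmd.
  by rewrite ler_piMl//; lra.
have hD : (1 - eps) * t <= t * ((1 - K * t) * (1 - K * ((1 - eps) * Vm))) * HD.
  have a1 : (1 - eps / 4) * (1 - eps / 4) <= (1 - K * t) * (1 - K * ((1 - eps) * Vm)).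
    by apply: ler_pM; clear -ep0 ep1 tK Kb; lra.
  have a2 : (1 - eps / 4) * (1 - eps / 4) * (1 - eps / 4) <=
      (1 - K * t) * (1 - K * ((1 - eps) * Vm)) * HD.
    by apply: ler_pM => //; [rewrite mulr_ge0//; clear -ep1; lra|clear -ep1; lra].
  rewrite -mulrA [leLHS]mulrC ler_pM2l//; apply: le_trans a2.
  have : 0 <= (3 - eps / 4) * (eps / 4) ^+ 2 by rewrite mulr_ge0 ?sqr_ge0//; clear -ep1; lra.
  clear -ep0; lra.
have hFv : (1 - eps) * v * Fn <= (1 - eps) * v * (s2 * eps / 40 * v).
  by rewrite ler_wpM2l// mulr_ge0// ltW.
have hC' : (1 - eps) * C <= (1 - eps) * (s2 * eps / 40 * v ^+ 2).
  by rewrite ler_wpM2l// ltW.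
have Vm2 : Vm ^+ 2 <= (1 + eps / 16) ^+ 2 * v ^+ 2.
  rewrite -exprMn; apply: (lerXn2r _ _ _ hVm); rewrite nnegrE//.
  exact: le_trans hVm.
have Vm'2 : (1 - eps / 16) ^+ 2 * v ^+ 2 <= Vm' ^+ 2.
  by rewrite -exprMn; apply: (lerXn2r _ _ _ hVm'); rewrite nnegrE ?mulr_ge0 ?(ltW v0)//; clear -ep1 w0 wVm'; lra.
have w2 : 0 <= Vm' ^+ 2 - w ^+ 2.
  by rewrite subr_ge0; apply: (lerXn2r _ _ _ wVm'); rewrite nnegrE; clear -w0 wVm'; lra.
have b1 : (1 - eps) * (s2 / e2 * (Vm' ^+ 2 - w ^+ 2) / 2) * (e2 - s2 * eps / 40 / (s2 / e2))
    <= (1 - eps) * (s2 / e2 * (Vm' ^+ 2 - w ^+ 2) / 2) * H2.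
  rewrite ler_wpM2l//; apply: mulr_ge0; first exact: ltW.
  by apply: divr_ge0 => //; apply: mulr_ge0 => //; exact/divr_ge0/ltW/e20/ltW.
have b2 : (1 - eps) * (s2 / e2 * (Vm' ^+ 2 - w ^+ 2) / 2) * (e2 - s2 * eps / 40 / (s2 / e2))
  = (1 - eps) * (s2 - s2 * eps / 40) / 2 * (Vm' ^+ 2 - w ^+ 2).
  by field; rewrite !gt_eqF.
have se1 : s2 * eps <= s2 by rewrite ler_piMr// ltW.
have b3 : (1 - eps) * (s2 - s2 * eps / 40) / 2 * ((1 - eps / 16) ^+ 2 * v ^+ 2) <=
    (1 - eps) * (s2 - s2 * eps / 40) / 2 * Vm' ^+ 2.
  by rewrite ler_wpM2l// divr_ge0// mulr_ge0//; clear -lam0 se1 s20; lra.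
have b4 : 0 <= (1 - eps) * (s2 * eps / 40) / 2 * w ^+ 2.
  by rewrite mulr_ge0 ?sqr_ge0// divr_ge0// mulr_ge0//; clear -lam0 se0; lra.
have b5 : (1 - eps) ^+ 2 * Vm ^+ 2 * s2 <= (1 - eps) ^+ 2 * ((1 + eps / 16) ^+ 2 * v ^+ 2) * s2.
  by rewrite ler_wpM2r ?(ltW s20)// ler_wpM2l ?sqr_ge0.
suff H6 : 0 <= ((1 - eps) * ((s2 - s2 * eps / 40) / 2 * (1 - eps / 16) ^+ 2
    - (1 - eps) * (1 + eps / 16) ^+ 2 * s2 / 2 - 2 * (s2 * eps / 40))) * v ^+ 2.
  rewrite exprMn /t in hD *; lra.
apply: mulr_ge0; last exact: ltW.
apply: mulr_ge0; first exact: ltW.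
have q1 : eps / 2 <= (1 - eps / 16) ^+ 2 - (1 - eps) * (1 + eps / 16) ^+ 2.
  have : 1 <= (1 + eps / 16) ^+ 2 by clear -ep0; nra.
  move=> q; have : eps * 1 <= eps * (1 + eps / 16) ^+ 2 by rewrite ler_pM2l.
  clear -ep0; lra.
have q2 : s2 / 2 * (eps / 2) <= s2 / 2 * ((1 - eps / 16) ^+ 2 - (1 - eps) * (1 + eps / 16) ^+ 2).
  by rewrite ler_pM2l// divr_gt0.
have q3 : s2 * eps / 40 * (1 - eps / 16) ^+ 2 <= s2 * eps / 40 * 1.
  by rewrite ler_wpM2l//; [clear -se0; lra|clear -ep0 ep1; nra].
clear -q2 q3 se0; lra.
Qed.

End arithmetic.

Ltac forget_after H0 :=
  repeat match goal with H : _ |- _ =>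
    lazymatch H with H0 => fail 1 | _ => clear H end end.

Section comparison.
Context {R : realType} {d : measure_display} {T : measurableType d}
  {P : probability T R}.
Variables (sigma2 eta2 : R) (N : T -> nat) (X : nat -> T -> R) (M D : T -> R).
Hypothesis ol : offspring_law (P := P) sigma2 eta2 N X M D.
Hypotheses (sigma20 : 0 < sigma2) (eta20 : 0 < eta2).

Let E := expect P.
Let pairs := pair_count (R := R) N.
Let spr := spread N X.
Let total := total_size N X M D.
Let laplace := laplace_functional (P := P) N X M D.
Let branch := branching (P := P) N X M D.
Let step := branching_step N X M D.
Let S1 w := \sum_(i < N w) X i w.
Let S2 w := \sum_(i < N w) X i w ^+ 2.

Let gain_exists : exists2 K0 : R, 0 < K0 &
  sigma2 / 2 <= E (fun w => (total w <= K0)%R%:R * pairs w).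
Proof.
have s2 : 0 < sigma2 / 2 by rewrite divr_gt0.
have [K0 K00 h] := expect_total_size ol (summable_pair_count ol) (@pair_count_ge0 R _ T N) s2.
exists K0 => //; apply: le_trans (h _ (lexx _)).
rewrite (expect_pair_count ol); lra.
Qed.

Lemma defect_small e : 0 < e -> exists L : R, exists2 t1 : R, 0 < t1 &
  forall t y, 0 <= t -> t <= t1 -> L <= y -> 1 - laplace t y <= e.
Proof. by have [K0 K00 h] := gain_exists; exact: (defect_small_of_gain ol sigma20 K00 h). Qed.

(** The error in [laplace_trunc_above] vanishes because the tree dies out. *)
Lemma comparison_above t G : 0 <= t -> unit_fun G -> (forall y, branch t G y <= G y) ->
  forall y, laplace t y <= G y.
Proof.
move=> t0 uG h y; apply/ler_addgt0Pr => e e0.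
have [K0 K00 hK] := gain_exists.
have [n hn] := survival_to0 ol sigma20 K00 hK e0.
apply: le_trans (laplace_le_trunc ol t0 n y) _.
apply: le_trans (laplace_trunc_above ol t0 uG h n y) _.
by rewrite lerD2l.
Qed.

Section local.
Variables (eps : R).
Hypotheses (eps0 : 0 < eps) (eps1 : eps <= 1).
Let k : R := sigma2 / eta2.
(* h is the relative size of a displacement considered as large: it changes the
   solution by a factor 1 + 4 h = 1 + eps / 16 *)
Let h : R := eps / 64.
(* each error is kept below e1 v^2 *)
Let e1 : R := sigma2 * eps / 40.

Let k0 : 0 < k. Proof. by rewrite divr_gt0. Qed.
Let h0 : 0 < h. Proof. by rewrite divr_gt0. Qed.
Let h1 : h <= 1 / 64. Proof. by rewrite /h; have := eps1; lra. Qed.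
Let e10 : 0 < e1. Proof. by rewrite divr_gt0// mulr_gt0. Qed.

Let far (y : R) w : R := (h * y < M w)%R%:R.

Let mMlt (m : R) : measurable_fun setT (fun w => m < M w).
Proof. by apply: measurable_fun_ltr => //; exact: (ol_mM ol). Qed.

Let mhle (K : R) : measurable_fun setT (fun w => total w <= K).
Proof. by apply: measurable_fun_ler => //; exact: (measurable_total_size ol). Qed.

Let summable_far y : summable P (far y).
Proof.
apply: (@summable_bounded _ _ _ _ _ 1); first exact: measurable_boolR.
by move=> w; rewrite /far; case: (_ < _); rewrite ?normr1 ?normr0.
Qed.

(** The lower bound on [v] is the one of [ss_lower]: the tail [o(y ^- 4)] of [M] is
    small compared with [v ^+ 2], and the tails of [N] and of the displacements
    compare in the same way. *)
Lemma far_negligible : exists2 B : R, 0 < B & forall y v, B <= y ->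
  (8 * k)^-1 / y ^+ 2 <= v ->
  [/\ E (far y) <= e1 * v ^+ 2,
      E (fun w => far y w * (N w)%:R) <= e1 * v &
      2 / y * E (fun w => far y w * spr w) <= e1 * v].
Proof.
pose ea := e1 * h ^+ 4 / (64 * k ^+ 2).
pose eb := e1 * h / (16 * k).
pose ec := e1 * h ^+ 2 / (8 * k).
have ea0 : 0 < ea by apply: divr_gt0; apply: mulr_gt0 => //; exact: exprn_gt0.
have eb0 : 0 < eb by apply: divr_gt0; apply: mulr_gt0.
have ec0 : 0 < ec by apply: divr_gt0; apply: mulr_gt0 => //; exact: exprn_gt0.
have [ma ma0 ha] := ol_tail ol ea0.
have [mb mb0 hb] := tail_spread ol sigma20 eta20 eb0.
have [mc mc0 hc] := tail_N ol sigma20 ec0.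
pose B := (ma + mb + mc) / h.
have B0 : 0 < B by rewrite divr_gt0// !addr_gt0.
exists B => // y v By hv.
have y0 : 0 < y by exact: lt_le_trans By.
have hy : ma + mb + mc <= h * y by rewrite mulrC -ler_pdivrMr.
have k8 : 0 < (8 * k)^-1 / y ^+ 2.
  by apply: divr_gt0; [rewrite invr_gt0 mulr_gt0|exact: exprn_gt0].
split.
- apply: (le_trans (ha (h * y) _)); first by lra.
  have -> : ea / (h * y) ^+ 4 = e1 * ((8 * k)^-1 / y ^+ 2) ^+ 2.
    by rewrite /ea; field; rewrite !gt_eqF.
  by rewrite ler_pM2l//; apply: (lerXn2r _ _ _ hv); rewrite nnegrE ltW// (lt_le_trans k8).
- apply: (le_trans (hc (h * y) _)); first by lra.
  have -> : ec / (h * y) ^+ 2 = e1 * ((8 * k)^-1 / y ^+ 2).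
    by rewrite /ec; field; rewrite !gt_eqF.
  by rewrite ler_pM2l.
- have hb' : E (fun w => far y w * spr w) <= eb / (h * y) by apply: hb; lra.
  apply: (@le_trans _ _ (2 / y * (eb / (h * y)))).
    by rewrite ler_pM2l// divr_gt0.
  have -> : 2 / y * (eb / (h * y)) = e1 * ((8 * k)^-1 / y ^+ 2).
    by rewrite /eb; field; rewrite !gt_eqF.
  by rewrite ler_pM2l.
Qed.

Section profile_at_y.
Variables (w0 : R) (V V1 : R -> R) (y : R).
Hypotheses (w00 : 0 < w0) (ss : steady_state k w0 V V1) (y0 : 0 < y).
Let t : R := sigma2 / 2 * w0 ^+ 2.

Let hy1 : 0 < (1 - h) * y. Proof. by rewrite mulr_gt0//; have := h1; lra. Qed.
Let V0 : 0 < V y. Proof. exact: (ss_gt0 w00 ss). Qed.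

(** [y ^+ 2 * V y] does not decrease. *)
Lemma near_below : V ((1 - h) * y) <= (1 + 4 * h) * V y.
Proof.
have hh0 := h0; have hh1 := h1.
have le1 : (1 - h) * y <= y by rewrite ler_piMl ?(ltW y0)//; lra.
have s : (1 - h) ^+ 2 * V ((1 - h) * y) <= V y.
  rewrite -(ler_pM2l (exprn_gt0 2 y0)); apply: le_trans (ss_scale w00 ss hy1 le1).
  by rewrite le_eqVlt; apply/orP; left; apply/eqP; ring.
have h2 : 0 < (1 - h) ^+ 2 by rewrite exprn_gt0//; lra.
rewrite -(ler_pM2l h2); apply: le_trans s _.
rewrite mulrA ler_peMl ?(ltW V0)//; nra.
Qed.

Lemma near_above : (1 - 4 * h) * V y <= V ((1 + h) * y).
Proof.
have hh0 := h0; have hh1 := h1.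
have le1 : y <= (1 + h) * y by rewrite ler_peMl ?(ltW y0)//; lra.
have s : V y <= (1 + h) ^+ 2 * V ((1 + h) * y).
  rewrite -(ler_pM2l (exprn_gt0 2 y0)); apply: le_trans (ss_scale w00 ss y0 le1) _.
  by rewrite le_eqVlt; apply/orP; left; apply/eqP; ring.
have h2 : 0 < (1 + h) ^+ 2 by rewrite exprn_gt0//; lra.
rewrite -(ler_pM2l h2); apply: le_trans s.
rewrite mulrA ler_piMl ?(ltW V0)//; nra.
Qed.

(** Expansion around [y], with the second derivative bounded by its value at the
    lowest point reached by displacements of at most [h y]. *)
Lemma sum_taylor_le w : M w <= h * y ->
  \sum_(i < N w) V (y - X i w) <=
  V y * (N w)%:R - V1 y * S1 w + k * (V ((1 - h) * y) ^+ 2 - w0 ^+ 2) / 2 * S2 w.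
Proof.
move=> Mh.
have -> : V y * (N w)%:R = \sum_(i < N w) V y by rewrite sumr_const card_ord mulr_natr.
rewrite /S1 /S2 !mulr_sumr -sumrB -big_split/=; apply: ler_sum => i _.
have xh : X i w <= h * y by apply: le_trans Mh; apply: (ol_XM ol).
have le1 : (1 - h) * y <= y by rewrite ler_piMl ?(ltW y0)//; have := h0; lra.
have le2 : (1 - h) * y <= y - X i w by lra.
apply: le_trans (ss_taylor_le k0 w00 ss hy1 le1 le2) _.
rewrite (_ : y - X i w - y = - X i w) ?sqrrN; last by ring.
by rewrite mulrN.
Qed.

(** Convexity alone, whatever the size of the displacements to the left. *)
Lemma sum_taylor_ge w : M w <= h * y ->
  V y * (N w)%:R - V1 y * S1 w <= \sum_(i < N w) V (y - X i w).
Proof.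
move=> Mh.
have -> : V y * (N w)%:R = \sum_(i < N w) V y by rewrite sumr_const card_ord mulr_natr.
rewrite /S1 mulr_sumr -sumrB; apply: ler_sum => i _.
have xh : X i w <= h * y by apply: le_trans Mh; apply: (ol_XM ol).
have le2 : (1 - h) * y <= y - X i w by lra.
have := ss_tangent k0 w00 ss y0 (lt_le_trans hy1 le2).
rewrite (_ : y - X i w - y = - X i w); last by ring.
by rewrite mulrN.
Qed.

(** The second order term requires two-sided control of the displacements. *)
Lemma sum_taylor_ge2 w : M w <= h * y ->
  (forall i, (i < N w)%N -> `|X i w| <= h * y) ->
  V y * (N w)%:R - V1 y * S1 w + k * (V ((1 + h) * y) ^+ 2 - w0 ^+ 2) / 2 * S2 w
  <= \sum_(i < N w) V (y - X i w).
Proof.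
move=> Mh Xh.
have -> : V y * (N w)%:R = \sum_(i < N w) V y by rewrite sumr_const card_ord mulr_natr.
rewrite /S1 /S2 !mulr_sumr -sumrB -big_split/=; apply: ler_sum => i _.
have := Xh _ (ltn_ord i); rewrite ler_norml => /andP[xl xh].
have le1 : y <= (1 + h) * y by rewrite ler_peMl ?(ltW y0)//; have := h0; lra.
have le2 : (1 - h) * y <= y - X i w by lra.
have le3 : y - X i w <= (1 + h) * y by lra.
apply: le_trans (ss_taylor_ge k0 w00 ss y0 (lt_le_trans hy1 le2) le1 le3).
rewrite (_ : y - X i w - y = - X i w) ?sqrrN; last by ring.
by rewrite mulrN.
Qed.

Lemma far_first_order w : V1 y * S1 w <= - V1 y * spr w.
Proof.
have v1 := ss_nonincr ss y0.
rewrite mulNr -mulrN -subr_ge0 -mulrBr mulr_le0//.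
rewrite subr_le0 lerNl; apply: le_trans (ler_norm_sum _ _ _).
by rewrite -normrN ler_norm.
Qed.

End profile_at_y.

(** Both local estimates compare one step of the operator with a linear combination
    of these random variables; its expectation is computed here once for all. *)
Let lin_comb (c0 c1 c2 c3 c4 c5 c6 c7 c8 c9 c10 c11 K y : R) w : R :=
  c0 * far y w + (c1 * D w + (c2 * (N w)%:R + (c3 * S1 w + (c4 * S2 w +
  (c5 * (far y w * spr w) + (c6 * (far y w * (N w)%:R) +
  (c7 * ((total w <= K)%R%:R * pairs w) +
  (c8 * ((total w <= K)%R%:R * S2 w) +
  (c9 * ((total w <= K)%R%:R * D w) + (c10 * pairs w + c11)))))))))).

Let lin_combE c0 c1 c2 c3 c4 c5 c6 c7 c8 c9 c10 c11 K y :
  let f := lin_comb c0 c1 c2 c3 c4 c5 c6 c7 c8 c9 c10 c11 K y in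
  summable P f /\
  E f = c0 * E (far y) + (c1 + (c2 + (c4 * eta2 +
  (c5 * E (fun w => far y w * spr w) + (c6 * E (fun w => far y w * (N w)%:R) +
  (c7 * E (fun w => (total w <= K)%R%:R * pairs w) +
  (c8 * E (fun w => (total w <= K)%R%:R * S2 w) +
  (c9 * E (fun w => (total w <= K)%R%:R * D w) + (c10 * sigma2 + c11))))))))).
Proof.
have i0 := summable_far y; have i1 := ol_ID ol; have i2 := summable_N ol.
have i3 : summable P S1 := summable_sum ol; have i4 : summable P S2 := ol_IS2 ol.
have i5 : summable P (fun w => far y w * spr w).
  exact: summable_indic (mMlt _) (summable_spread ol).
have i6 : summable P (fun w => far y w * (N w)%:R).
  exact: summable_indic (mMlt _) (summable_N ol).
have i10 : summable P pairs := summable_pair_count ol.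
have i7 := summable_indic (mhle K) i10.
have i8 := summable_indic (mhle K) i4.
have i9 := summable_indic (mhle K) i1.
split; first by rewrite /lin_comb; solve_summable.
have -> : E (lin_comb c0 c1 c2 c3 c4 c5 c6 c7 c8 c9 c10 c11 K y) =
  c0 * E (far y) + (c1 * E D + (c2 * E (fun w => (N w)%:R) + (c3 * E S1 + (c4 * E S2 +
  (c5 * E (fun w => far y w * spr w) + (c6 * E (fun w => far y w * (N w)%:R) +
  (c7 * E (fun w => (total w <= K)%R%:R * pairs w) +
  (c8 * E (fun w => (total w <= K)%R%:R * S2 w) +
  (c9 * E (fun w => (total w <= K)%R%:R * D w) + (c10 * E pairs + c11)))))))))).
  rewrite /E /lin_comb.
  do 11 (rewrite expectD; [|by solve_summable|by solve_summable]; rewrite expectZ//; congr (_ + _)).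
  exact: expect_cst.
have -> : E D = 1 := ol_ED ol; have -> : E S1 = 0 := ol_ES1 ol.
have -> : E S2 = eta2 := ol_ES2 ol; have -> : E pairs = sigma2 := expect_pair_count ol.
have -> : E (fun w => (N w)%:R) = 1 := ol_EN ol.
by rewrite mulr0 !mulr1 add0r.
Qed.

(** With [u = (1 + eps) V], the terms of first order cancel by criticality and the
    terms of second order are
    [(1 + eps) sigma2 / 2 * (V ^+ 2 - w0 ^+ 2) + t - (1 + eps) ^+ 2 sigma2 / 2 * V ^+ 2],
    at most [- eps (1 + eps) sigma2 / 2 * V ^+ 2].  The gain from pairs of siblings
    is used only where [total <= K]; large [M] is paid by [far_negligible]. *)
Theorem branching_ge_stationary : exists2 B : R, 0 < B & exists2 delta : R, 0 < delta &
  forall w0 V V1 y G z, 0 < w0 -> steady_state k w0 V V1 -> B <= y ->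
  V (y / 2) <= delta -> unit_fun G -> h * y <= z ->
  (forall x, x <= h * y -> 1 - (1 + eps) * V (y - x) <= G (z - x)) ->
  1 - (1 + eps) * V y <= branch (sigma2 / 2 * w0 ^+ 2) G z.
Proof.
have [B1 B10 hB1] := far_negligible.
have [K K0 hK] := expect_total_size ol (summable_pair_count ol) (@pair_count_ge0 R _ T N) e10.
pose delta := Num.min (1 / 2) (sigma2 * eps / (64 * K ^+ 3)).
have delta0 : 0 < delta.
  by rewrite lt_min divr_gt0//=; apply: divr_gt0; apply: mulr_gt0 => //; exact: exprn_gt0.
exists (Num.max B1 (K / h)); first by rewrite lt_max B10.
exists delta => // w0 V V1 y G z w00 ss; rewrite ge_max => /andP[By Ky] Vd uG hyz GV.
have y0 : 0 < y by exact: lt_le_trans By.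
have hh0 := h0; have hh1 := h1; have ep0 := eps0; have ep1 := eps1.
have s20 := sigma20; have kk0 := k0.
set lam := 1 + eps; set t := sigma2 / 2 * w0 ^+ 2.
have lam0 : 0 < lam by rewrite /lam; lra.
have t0 : 0 <= t by rewrite mulr_ge0 ?sqr_ge0// divr_ge0// ltW.
have Khy : K <= h * y by rewrite mulrC -ler_pdivrMr.
set m := (1 - h) * y; set m' := (1 + h) * y.
have m0 : 0 < m by rewrite mulr_gt0//; lra.
have ym : y / 2 <= m by rewrite /m; nra.
have V0 : 0 < V y by exact: (ss_gt0 w00 ss).
have y20 : 0 < y / 2 by rewrite divr_gt0.
have Vm : V m <= delta by apply: le_trans (ss_le ss y20 ym) Vd.
have Vy : V y <= delta by apply: le_trans (ss_le ss y20 _) Vd; move: y0; forget_after B1; lra.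
have d1 : delta <= 1 / 2 by rewrite ge_min lexx.
have d2 : delta <= sigma2 * eps / (64 * K ^+ 3) by rewrite ge_min lexx orbT.
have m'0 : 0 < m' by rewrite mulr_gt0//; move: hh0; forget_after B1; lra.
have ym' : y <= m' by rewrite /m'; move: hh0 y0; forget_after B1; nra.
have Vm'0 : 0 < V m' by exact: (ss_gt0 w00 ss).
have Vm'y : V m' <= V y by exact: (ss_le ss y0).
set a := lam * V m'.
have a0 : 0 < a by rewrite mulr_gt0.
have K30 : 0 < K ^+ 3 by rewrite exprn_gt0.
pose kap := k * (V m ^+ 2 - w0 ^+ 2).
have kap0 : 0 <= kap.
  rewrite mulr_ge0 ?(ltW k0)// subr_ge0; apply: (lerXn2r _ _ _ (ss_ge ss m0)); rewrite nnegrE ltW//.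
  exact: (ss_gt0 w00 ss).
have v1 := ss_nonincr ss y0.
have [if_ Ef] := lin_combE 1 t (lam * V y) (- (lam * V1 y)) (lam * (kap / 2))
  (- (lam * V1 y)) 0 (- (a ^+ 2 / 2)) 0 0 0 (K ^+ 3 * a ^+ 3) K y.
set f := lin_comb _ _ _ _ _ _ _ _ _ _ _ _ _ _ in if_ Ef.
have pointwise w : 1 - step t G z w <= f w.
  have /andP[s0 s1] : 0 <= step t G z w <= 1 by exact: (branching_step_unit ol).
  have tD : 0 <= t * D w by rewrite mulr_ge0// (ol_D0 ol).
  have ff := far_first_order ss y0 w.
  have S20 : 0 <= S2 w by apply: sumr_ge0 => i _; exact: sqr_ge0.
  have sz0 : 0 <= spr w by exact: spread_ge0.
  have N0 : 0 <= (N w)%:R :> R by [].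
  have p0 : 0 <= pairs w by exact: pair_count_ge0.
  have K3a3 : 0 <= K ^+ 3 * a ^+ 3 by rewrite mulr_ge0 ?exprn_ge0 ?(ltW K0) ?(ltW a0).
  have c4 : 0 <= lam * (kap / 2) * S2 w.
    by apply: mulr_ge0 => //; apply: mulr_ge0; [exact: ltW|exact: divr_ge0].
  have c2 : 0 <= lam * V y * (N w)%:R.
    by apply: mulr_ge0 => //; apply: mulr_ge0; exact: ltW.
  rewrite /f /lin_comb !mul0r !add0r /far.
  have [Mfar|Mnear] := ltP (h * y) (M w).
    have -> : (total w <= K) = false.
      apply/negbTE/negP => /(total_size_bounds ol)[MK _ _ _].
      by have := lt_le_trans Mfar MK; rewrite ltNge Khy.
    have c5 : lam * (V1 y * S1 w) <= lam * (- V1 y * spr w) by rewrite ler_pM2l.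
    rewrite !mulr1n !mulr0n !mul1r !mul0r !mulr0; lra.
  rewrite !mulr0n !mul0r mulr0.
  pose v i := lam * V (y - X i w).
  have near i : (i < N w)%N -> m <= y - X i w.
    move=> iN; have := ol_XM ol iN => xM.
    by rewrite /m; move: xM Mnear; forget_after B1; lra.
  have v01 i : (i < N w)%N -> 0 <= v i <= 1.
    move=> iN; have m1 := near i iN.
    have Vp : 0 < V (y - X i w) by apply: (ss_gt0 w00 ss); exact: lt_le_trans m1.
    have Vq : V (y - X i w) <= 1 / 2.
      by apply: le_trans (le_trans (ss_le ss m0 m1) _) d1.
    by rewrite /v /lam; move: Vp Vq ep0 ep1; forget_after B1; nra.
  have sv : \sum_(i < N w) v i <= lam * V y * (N w)%:R - lam * V1 y * S1 w + lam * (kap / 2) * S2 w.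
    rewrite /v -mulr_sumr.
    have := sum_taylor_le w00 ss y0 Mnear; rewrite -/m -/kap => hh.
    have := ler_wpM2l (ltW lam0) hh; rewrite /S1 /S2; forget_after B1; lra.
  have stepE : 1 - step t G z w <= t * D w + (1 - \prod_(i < N w) (1 - v i)).
    have pw : \prod_(i < N w) (1 - v i) <= \prod_(i < N w) G (z - X i w).
      apply: (@prod_le _ (fun i => 1 - v i) (fun i => G (z - X i w))) => i iN.
      have /andP[v0 v1'] := v01 i iN.
      by rewrite subr_ge0 v1' /= /v; apply: GV; apply: le_trans Mnear; exact: (ol_XM ol).
    have /andP[q0 q1] : 0 <= \prod_(i < N w) (1 - v i) <= 1.
      by apply: (@prod_unit _ (fun i => 1 - v i)) => i iN; rewrite subr_ge0 gerBl; have /andP[-> ->] := v01 i iN.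
    rewrite /step /branching_step (le_trans Mnear hyz) mulr1.
    have e0 := expR_ge1Dx (- (t * D w)); have e1' := expR_ge0 (- (t * D w)).
    move: q0 q1 pw e0 e1'; set q := \prod_(i < N w) _; set p := \prod_(i < N w) _.
    set e := expR _ => q0 q1 pw e0 e1'.
    have k1 : e * q <= e * p by rewrite ler_wpM2l.
    have k2 : (1 - t * D w) * q <= e * q by rewrite ler_wpM2r.
    have k3 : t * D w * q <= t * D w by rewrite ler_piMr.
    move: k1 k2 k3; forget_after B1; lra.
  have [Hh|_] := leP (total w) K; last first.
    rewrite mulr0n mul0r mulr0 add0r.
    have := prod_defect_union v01; lra.
  rewrite mulr1n mul1r.
  have [_ NK _ XK] := total_size_bounds ol Hh.
  have va i : (i < N w)%N -> a <= v i <= 1.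
    move=> iN; have /andP[_ ->] := v01 i iN; rewrite andbT /a /v ler_pM2l//.
    apply: (ss_le ss); first exact: lt_le_trans (near i iN).
    have := XK i iN; rewrite ler_norml => /andP[x1 x2].
    by rewrite /m'; move: x1 XK Khy; forget_after B1; lra.
  have := prod_defect_upper va (ltW a0).
  have N3 : (N w)%:R ^+ 3 * a ^+ 3 <= K ^+ 3 * a ^+ 3.
    by rewrite ler_wpM2r ?exprn_ge0 ?(ltW a0)//; apply: lerXn2r; rewrite ?nnegrE// ltW.
  rewrite /pairs /pair_count; lra.
have uS := summable_branching_step ol z t0 uG.
have fin : 1 - branch t G z <= E f.
  rewrite /branch /branching -[X in X - _](expect_cst P 1) -expectB; [|by solve_summable|by solve_summable].
  by apply: expect_le; [by solve_summable|by []|exact: pointwise].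
suff : E f <= lam * V y by move: fin; forget_after B1; lra.
have [f1 _ f3] := hB1 y (V y) By (ss_lower ss y0).
have slope := ss_slope ss y0.
have nb := near_below w00 ss y0; have na := near_above w00 ss y0.
rewrite -/m in nb; rewrite -/m' in na.
have hk := hK K (lexx _); rewrite (expect_pair_count ol) in hk.
set PH := E (fun w => (total w <= K)%R%:R * pairs w).
set cross := E (fun w => far y w * spr w) in f3.
have cross0 : 0 <= cross.
  by apply: expect_ge0 => w; rewrite mulr_ge0// spread_ge0.
have hC : - V1 y * cross <= e1 * V y ^+ 2.
  apply: (@le_trans _ _ (2 / y * cross * V y)); last first.
    by rewrite expr2 mulrA ler_wpM2r// ltW.
  rewrite mulrAC ler_wpM2r// mulrAC ler_pdivlMr//; move: slope; forget_after B1; lra.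
have e16 : 4 * h = eps / 16 by rewrite /h; forget_after B1; lra.
rewrite e16 in nb na.
have Vm0 : 0 <= V m by apply/ltW/(ss_gt0 w00 ss).
have := @super_arith R sigma2 eta2 eps w0 (V y) (V m) (V m') (E (far y)) (- V1 y * cross) PH K
  delta sigma20 eta20 eps0 eps1 K0 V0 Vy d2 Vm0 nb na Vm'y f1 hC hk.
apply: le_trans; rewrite Ef -/PH -/cross /kap /a /t /lam /k.
by rewrite !mul0r !add0r mul1r -!mulrA; lra.
Qed.

(** The mirror image: for [u = (1 - eps) V] the terms of second order are at least
    [eps (1 - eps) sigma2 / 2 * V ^+ 2].  Now the gains are the second moment of the
    displacements and the decoration, and they are used only where [total <= K]. *)
Theorem branching_le_stationary : eps < 1 ->
  exists2 B : R, 0 < B & exists2 delta : R, 0 < delta &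
  forall w0 V V1 y G z, 0 < w0 -> steady_state k w0 V V1 -> B <= y ->
  V (y / 2) <= delta -> unit_fun G ->
  (forall x, x <= h * y -> G (z - x) <= 1 - (1 - eps) * V (y - x)) ->
  branch (sigma2 / 2 * w0 ^+ 2) G z <= 1 - (1 - eps) * V y.
Proof.
move=> eps1'.
have [B1 B10 hB1] := far_negligible.
have kk0 := k0; have s20 := sigma20; have ep0 := eps0.
have eD : 0 < eps / 4 by rewrite divr_gt0.
have eS : 0 < e1 / k by rewrite divr_gt0.
have S2_ge0 w : 0 <= S2 w by apply: sumr_ge0 => i _; exact: sqr_ge0.
have [Ka Ka0 hKa] := expect_total_size ol (ol_IS2 ol) S2_ge0 eS.
have [Kb Kb0 hKb] := expect_total_size ol (ol_ID ol) (ol_D0 ol) eD.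
pose K := Num.max Ka Kb.
have K0 : 0 < K by rewrite lt_max Ka0.
have hS := hKa K; have hD := hKb K.
pose delta := Num.min 1 (Num.min (eps / 4 / K) (eps / 4 / (K * (sigma2 / 2)))).
have delta0 : 0 < delta.
  by rewrite !lt_min ltr01 divr_gt0//=; apply: divr_gt0 => //; apply: mulr_gt0 => //; exact: divr_gt0.
exists (Num.max B1 (K / h)); first by rewrite lt_max B10.
exists delta => // w0 V V1 y G z w00 ss; rewrite ge_max => /andP[By Ky] Vd uG GV.
have y0 : 0 < y by exact: lt_le_trans By.
have hh0 := h0; have hh1 := h1.
set lam := 1 - eps; set t := sigma2 / 2 * w0 ^+ 2.
have lam0 : 0 < lam by rewrite subr_gt0.
have lam1 : lam <= 1 by rewrite gerBl ltW.
have t0 : 0 <= t by rewrite mulr_ge0 ?sqr_ge0// divr_ge0// ltW.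
have Khy : K <= h * y by rewrite mulrC -ler_pdivrMr.
set m := (1 - h) * y; set m' := (1 + h) * y.
have m0 : 0 < m by rewrite mulr_gt0//; move: hh1; forget_after B1; lra.
have ym : y / 2 <= m by rewrite /m; move: hh1 y0; forget_after B1; nra.
have V0 : 0 < V y by exact: (ss_gt0 w00 ss).
have y20 : 0 < y / 2 by rewrite divr_gt0.
have Vm : V m <= delta by apply: le_trans (ss_le ss y20 ym) Vd.
have Vy : V y <= delta by apply: le_trans (ss_le ss y20 _) Vd; move: y0; forget_after B1; lra.
have d1 : delta <= 1 by rewrite ge_min lexx.
have d2 : K * delta <= eps / 4.
  by rewrite mulrC -ler_pdivlMr// !ge_min lexx !orbT.
have d3 : K * (sigma2 / 2 * delta) <= eps / 4.
  rewrite mulrA mulrC -ler_pdivlMr; first by rewrite !ge_min lexx !orbT.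
  by apply: mulr_gt0 => //; exact: divr_gt0.
have m'0 : 0 < m' by rewrite mulr_gt0//; move: hh0; forget_after B1; lra.
have ym' : y <= m' by rewrite /m'; move: hh0 y0; forget_after B1; nra.
have Vm0 : 0 < V m by exact: (ss_gt0 w00 ss).
have wy : w0 <= V y by exact: (ss_ge ss).
have wm' : w0 <= V m' by exact: (ss_ge ss).
pose b := lam * V m.
have b0 : 0 <= b by rewrite mulr_ge0// ltW.
have bd : b <= delta by apply: le_trans Vm; rewrite ler_piMl// ltW.
pose kap := k * (V m' ^+ 2 - w0 ^+ 2).
have kap0 : 0 <= kap.
  rewrite mulr_ge0 ?(ltW k0)// subr_ge0; apply: (lerXn2r _ _ _ wm'); rewrite nnegrE ltW//.
  exact: lt_le_trans wm'.
have v1 := ss_nonincr ss y0.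
have tK : K * t <= 1.
  have wd : w0 <= delta by exact: le_trans Vy.
  have w2 : w0 ^+ 2 <= delta.
    by apply: (le_trans _ wd); rewrite expr2 ler_piMl ?(ltW w00)//; exact: le_trans d1.
  apply: le_trans (le_trans d3 _); last by move: ep0 eps1'; forget_after B1; lra.
  by rewrite ler_pM2l// ler_pM2l// divr_gt0.
have Kb1 : K * b <= 1.
  apply: (@le_trans _ _ (K * delta)); first by rewrite ler_pM2l.
  apply: le_trans d2 _; move: ep0 eps1'; forget_after B1; lra.
pose cD := t * ((1 - K * t) * (1 - K * b)).
have cD0 : 0 <= cD by rewrite mulr_ge0// mulr_ge0// subr_ge0.
have [if_ Ef] := lin_combE 0 0 (lam * V y) (- (lam * V1 y)) 0
  (lam * V1 y) (- (lam * V y)) 0 (lam * (kap / 2)) cD (- (b ^+ 2 / 2)) 0 K y.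
set f := lin_comb _ _ _ _ _ _ _ _ _ _ _ _ _ _ in if_ Ef.
have pointwise w : f w <= 1 - step t G z w.
  have /andP[s0 s1] : 0 <= step t G z w <= 1 by exact: (branching_step_unit ol).
  have tD : 0 <= t * D w by rewrite mulr_ge0// (ol_D0 ol).
  have S20 := S2_ge0 w.
  have p0 : 0 <= pairs w by exact: pair_count_ge0.
  have c10 : 0 <= b ^+ 2 / 2 * pairs w by rewrite mulr_ge0// divr_ge0// sqr_ge0.
  rewrite /f /lin_comb !mul0r !add0r addr0 /far.
  have [Mfar|Mnear] := ltP (h * y) (M w).
    have -> : (total w <= K) = false.
      apply/negbTE/negP => /(total_size_bounds ol)[MK _ _ _].
      by have := lt_le_trans Mfar MK; rewrite ltNge Khy.
    have ff : - (lam * V1 y) * S1 w <= - (lam * V1 y) * spr w.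
      have sS : S1 w <= spr w by apply: ler_sum => i _; exact: ler_norm.
      by rewrite ler_wpM2l// oppr_ge0 pmulr_rle0.
    rewrite mulr1n !mulr0n !mul1r !mul0r !mulr0 !add0r.
    by move: ff c10 s1; forget_after B1; lra.
  rewrite !mulr0n !mul0r !mulr0 !add0r.
  pose v i := lam * V (y - X i w).
  have near i : (i < N w)%N -> m <= y - X i w.
    move=> iN; have := ol_XM ol iN => xM.
    by rewrite /m; move: xM Mnear; forget_after B1; lra.
  have vb i : (i < N w)%N -> v i <= b.
    move=> iN; have m1 := near i iN.
    by rewrite /v /b ler_pM2l//; exact: (ss_le ss m0 m1).
  have v01 i : (i < N w)%N -> 0 <= v i <= 1.
    move=> iN; have m1 := near i iN.
    have Vp : 0 < V (y - X i w) by apply: (ss_gt0 w00 ss); exact: lt_le_trans m1.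
    apply/andP; split; first by rewrite /v mulr_ge0// ltW.
    exact: le_trans (vb i iN) (le_trans bd d1).
  have pg : \prod_(i < N w) G (z - X i w) <= \prod_(i < N w) (1 - v i).
    apply: (@prod_le _ (fun i => G (z - X i w)) (fun i => 1 - v i)) => i iN.
    have [_ /(_ (z - X i w))/andP[-> _]] := uG.
    by apply: GV; apply: le_trans Mnear; exact: (ol_XM ol).
  have pg0 : 0 <= \prod_(i < N w) G (z - X i w).
    by apply: prodr_ge0 => i _; have [_ /(_ (z - X i w))/andP[]] := uG.
  have /andP[q0 q1] : 0 <= \prod_(i < N w) (1 - v i) <= 1.
    by apply: (@prod_unit _ (fun i => 1 - v i)) => i iN; rewrite subr_ge0 gerBl; have /andP[-> ->] := v01 i iN.
  have dl := prod_defect_lower v01 vb b0.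
  have dg := prod_defect_union v01.
  have sv0 : \sum_(i < N w) v i <= K * b \/ ~ (total w <= K).
    have [Hh|Hh] := boolP (total w <= K); [left|by right].
    have [_ NK _ _] := total_size_bounds ol Hh.
    apply: (@le_trans _ _ ((N w)%:R * b)); last by rewrite ler_wpM2r.
    rewrite mulr_natl -[X in _ *+ X]card_ord -sumr_const.
    by apply: ler_sum => i _; exact: vb.
  have stepE : step t G z w <= expR (- (t * D w)) * \prod_(i < N w) (1 - v i).
    have /andP[eb0 eb1] : 0 <= expR (- (t * D w)) * (M w <= z)%R%:R <= expR (- (t * D w)).
      by case: (M w <= z); rewrite ?mulr1 ?mulr0 ?expR_ge0 ?lexx.
    by rewrite /step /branching_step; apply: ler_pM.
  move: pg q0 q1 dl dg stepE; rewrite -/(\prod_(i < N w) (1 - v i)).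
  set q := \prod_(i < N w) (1 - v i); set S := \sum_(i < N w) v i in sv0 *.
  move=> pg q0 q1 dl dg stepE.
  have e0 := expR_ge0 (- (t * D w)).
  have [Hh|Hh] := leP (total w) K; last first.
    rewrite !mulr0n !mul0r !mulr0 !add0r.
    have e1' : expR (- (t * D w)) <= 1 by rewrite -expR0 ler_expR oppr_le0.
    have eq : expR (- (t * D w)) * q <= q by rewrite ler_piMl.
    have st : lam * (V y * (N w)%:R - V1 y * S1 w) <= S.
      by rewrite /S /v -mulr_sumr ler_wpM2l ?(ltW lam0)//; exact: (sum_taylor_ge w00 ss y0 Mnear).
    by rewrite /pairs /pair_count; move: eq st dl stepE; forget_after B1; lra.
  have [MK NK DK XK] := total_size_bounds ol Hh.
  have SK : S <= K * b by case: sv0 => // /(_ Hh).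
  rewrite !mulr1n !mul1r.
  have Xh i : (i < N w)%N -> `|X i w| <= h * y.
    by move=> iN; apply: le_trans (XK i iN) Khy.
  have st : lam * (V y * (N w)%:R - V1 y * S1 w + kap / 2 * S2 w) <= S.
    by rewrite /S /v -mulr_sumr ler_wpM2l ?(ltW lam0)//; exact: (sum_taylor_ge2 w00 ss y0 Mnear Xh).
  (* e^-x <= 1 - x + x^2, from (1 - x + x^2) (1 + x) >= 1 *)
  have ex : expR (- (t * D w)) <= 1 - t * D w * (1 - t * D w).
    rewrite expRN -[leLHS]mul1r ler_pdivrMr ?expR_gt0//.
    have := expR_ge1Dx (t * D w); move: tD; set x := t * D w; set e := expR x.
    move=> x0 xe.
    have x3 : 0 <= x ^+ 3 by rewrite exprn_ge0.
    apply: (@le_trans _ _ ((1 - x * (1 - x)) * (1 + x))); first by move: x3; forget_after B1; lra.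
    by rewrite ler_wpM2l//; have := sqr_ge0 (x - 1 / 2); forget_after B1; lra.
  have tDK : t * D w <= K * t by rewrite mulrC ler_wpM2r.
  have qK : 1 - K * b <= q by move: dg SK; forget_after B1; lra.
  have k1 : expR (- (t * D w)) * q <= (1 - t * D w * (1 - t * D w)) * q by rewrite ler_wpM2r.
  have k2 : t * D w * ((1 - K * t) * (1 - K * b)) <= t * D w * ((1 - t * D w) * q).
    rewrite ler_wpM2l//; apply: ler_pM; rewrite ?subr_ge0//.
    by rewrite lerD2l lerN2.
  have k3 : cD * D w = t * D w * ((1 - K * t) * (1 - K * b)) by rewrite /cD; ring.
  by rewrite k3 /pairs /pair_count; move: k1 k2 st dl stepE tD qK; forget_after B1; lra.
have uS := summable_branching_step ol z t0 uG.
have fin : E f <= 1 - branch t G z.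
  rewrite /branch /branching -[X in _ <= X - _](expect_cst P 1) -expectB; [|by solve_summable|by solve_summable].
  by apply: expect_le; [by []|by solve_summable|exact: pointwise].
suff : lam * V y <= E f by move: fin; forget_after B1; lra.
have [_ f2 f3] := hB1 y (V y) By (ss_lower ss y0).
have slope := ss_slope ss y0.
have nb := near_below w00 ss y0; have na := near_above w00 ss y0.
rewrite -/m in nb; rewrite -/m' in na.
have hs : eta2 - e1 / k <= E (fun w => (total w <= K)%R%:R * S2 w).
  by have -> : eta2 = E S2 := esym (ol_ES2 ol); apply: hS; rewrite le_max lexx.
have hd : 1 - eps / 4 <= E (fun w => (total w <= K)%R%:R * D w).
  by move: hD; rewrite (ol_ED ol); apply; rewrite le_max lexx orbT.
set HS := E (fun w => (total w <= K)%R%:R * S2 w) in hs.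
set HD := E (fun w => (total w <= K)%R%:R * D w) in hd.
set cross := E (fun w => far y w * spr w) in f3.
set FN := E (fun w => far y w * (N w)%:R) in f2.
have cross0 : 0 <= cross.
  by apply: expect_ge0 => w; rewrite mulr_ge0// spread_ge0.
have hC : - V1 y * cross <= e1 * V y ^+ 2.
  apply: (@le_trans _ _ (2 / y * cross * V y)); last first.
    by rewrite expr2 mulrA ler_wpM2r// ltW.
  rewrite mulrAC ler_wpM2r// mulrAC ler_pdivlMr//; move: slope; forget_after B1; lra.
have e16 : 4 * h = eps / 16 by rewrite /h; forget_after B1; lra.
rewrite e16 in nb na.
have := @sub_arith R sigma2 eta2 eps w0 (V y) (V m) (V m') FN (- V1 y * cross) HS HD K
  delta sigma20 eta20 eps0 eps1' K0 V0 wy w00 Vy d1 Vm d2 d3 (ltW Vm0) nb na wm' f2 hC hs hd.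
move=> /le_trans; apply; rewrite Ef -/HS -/HD -/cross -/FN /cD /kap /b /t /lam /k.
by rewrite !mul0r !add0r; lra.
Qed.

End local.
End comparison.

(** * Global bounds on the defect *)

Section sandwich.
Context {R : realType} {d : measure_display} {T : measurableType d}
  {P : probability T R}.
Variables (sigma2 eta2 : R) (N : T -> nat) (X : nat -> T -> R) (M D : T -> R).
Hypothesis ol : offspring_law (P := P) sigma2 eta2 N X M D.
Hypotheses (sigma20 : 0 < sigma2) (eta20 : 0 < eta2).

Let laplace := laplace_functional (P := P) N X M D.
Let branch := branching (P := P) N X M D.
Let k : R := sigma2 / eta2.
Let k0 : 0 < k. Proof. by rewrite divr_gt0. Qed.

(** For small [w0] the solution is small beyond a distance which does not depend on
    [w0]. *)
Let stationary_small (delta : R) : 0 < delta -> exists2 B : R, 0 < B &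
  exists2 w1 : R, 0 < w1 & forall w0 b, 0 < w0 -> w0 <= w1 -> B <= b ->
    stationary k w0 (b / 2) <= delta.
Proof.
move=> d0; have kk0 := k0.
pose B := Num.max 2 (96 / (k * (delta / 2)) * 2).
have kd : 0 < k * (delta / 2) by rewrite mulr_gt0// divr_gt0.
exists B; first by rewrite lt_max ltr0n.
exists (delta / 2); first by rewrite divr_gt0.
move=> w0 b w00 w01 Bb.
have b2 : 2 <= b by apply: le_trans Bb; rewrite le_max lexx.
have bb : 96 / (k * (delta / 2)) * 2 <= b by apply: le_trans Bb; rewrite le_max lexx orbT.
have b0 : 0 < b / 2 by lra.
apply: le_trans (stationary_le k0 w00 b0) _.
suff : 24 / (k * (b / 2) ^+ 2) <= delta / 2 by lra.
rewrite ler_pdivrMr; last by rewrite mulr_gt0// exprn_gt0.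
have h1 : 96 <= (b / 2) * (k * (delta / 2)) by rewrite -ler_pdivrMr//; lra.
have -> : delta / 2 * (k * (b / 2) ^+ 2) = b / 2 * ((b / 2) * (k * (delta / 2))) by ring.
have : 1 * 96 <= b / 2 * (b / 2 * (k * (delta / 2))) by apply: ler_pM => //; lra.
lra.
Qed.

Variable eps : R.
Hypotheses (eps0 : 0 < eps) (eps1 : eps < 1).

Let t_ge0 (w0 : R) : 0 <= sigma2 / 2 * w0 ^+ 2.
Proof. by rewrite mulr_ge0 ?sqr_ge0// divr_ge0// ltW. Qed.

(** The supersolution is [1 - (1 - eps) V] shifted by [B] into the region where the
    local comparison applies, and 0 below the barrier, where a single step already
    kills everything because [M >= 0]. *)
Lemma defect_ge_stationary : exists2 B : R, 0 < B & exists2 w1 : R, 0 < w1 &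
  forall w0 z, 0 < w0 -> w0 <= w1 -> 0 <= z ->
  (1 - eps) * stationary k w0 (z + B) <= 1 - laplace (sigma2 / 2 * w0 ^+ 2) z.
Proof.
have [B0 B00 [delta delta0 hB]] := branching_le_stationary ol sigma20 eta20 eps0 (ltW eps1) eps1.
pose delta' := Num.min delta 1.
have delta'0 : 0 < delta' by rewrite lt_min delta0 ltr01.
have d'd : delta' <= delta by rewrite ge_min lexx.
have d'1 : delta' <= 1 by rewrite ge_min lexx orbT.
have [B1 B10 [w1 w10 hw]] := stationary_small delta'0.
pose B := Num.max B0 B1.
have Bp : 0 < B by rewrite lt_max B00.
have BB0 : B0 <= B by rewrite le_max lexx.
have BB1 : B1 <= B by rewrite le_max lexx orbT.
exists B => //; exists w1 => // w0 z w00 w01 z0.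
set V := stationary k w0.
have ss := stationary_steady k0 w00.
have Vsmall y : B <= y -> V (y / 2) <= delta' by move=> By; apply: hw => //; exact: le_trans By.
have Vsmall' y : B / 2 <= y -> V y <= delta'.
  by move=> By; rewrite (_ : y = y * 2 / 2); [apply: Vsmall; lra|lra].
have V0 y : 0 < y -> 0 < V y by move=> y0; exact: (ss_gt0 w00 ss).
pose G x : R := if x < 0 then 0 else 1 - (1 - eps) * V (x + B).
have lam0 : 0 <= 1 - eps by have := eps1; lra.
have lam1 : 1 - eps <= 1 by have := eps0; lra.
have G01 x : 0 <= G x <= 1.
  rewrite /G; case: ltP => x0; first by rewrite lexx ler01.
  have h1 : V (x + B) <= delta' by apply: Vsmall'; lra.
  have h2 : 0 < V (x + B) by apply: V0; lra.
  apply/andP; split; last by rewrite gerBl mulr_ge0// ltW.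
  by rewrite subr_ge0 mulr_ile1//; [exact: ltW|exact: le_trans d'1].
have uG : unit_fun G.
  split=> //; apply: nondecreasing_measurable => // x x' xx.
  have [xn|xp] := ltP x 0; first by rewrite {1}/G xn; have /andP[] := G01 x'.
  rewrite /G !ltNge xp (le_trans xp xx)/= lerD2l lerN2 ler_wpM2l//.
  by apply: (ss_le ss); lra.
suff h : laplace (sigma2 / 2 * w0 ^+ 2) z <= G z.
  by move: h; rewrite /G ltNge z0/=; lra.
apply: (comparison_above ol sigma20 (t_ge0 w0) uG) => x.
have [xn|xp] := ltP x 0.
  rewrite {2}/G xn /branching.
  rewrite (_ : branching_step _ _ _ _ _ _ _ = fun=> 0) ?expect_cst//.
  apply/funext => w; rewrite /branching_step (_ : (M w <= x) = false) ?mulr0 ?mul0r//.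
  by apply/negbTE; rewrite -ltNge (lt_le_trans xn)// (ol_M0 ol).
rewrite {2}/G ltNge xp /=.
apply: (hB w0 V (stationary1 k w0)) => //.
- lra.
- by apply: le_trans d'd; apply: Vsmall; lra.
- move=> u uh; have e0 := eps0; have e1 := eps1.
  have hh : eps / 64 * (x + B) <= (x + B) / 2.
    by rewrite mulrC ler_wpM2l//; lra.
  rewrite /G; case: ltP => xu.
    have h1 : V (x + B - u) <= delta' by apply: Vsmall'; lra.
    have h2 : 0 < V (x + B - u) by apply: V0; lra.
    by rewrite subr_ge0 mulr_ile1//; [exact: ltW|exact: le_trans d'1].
  by rewrite (_ : x - u + B = x + B - u)//; ring.
Qed.

(** The subsolution is [1 - (1 + eps) V] from a level [L] on.  Beyond [L] the defect is
    at most [small], a lower bound of [V] over the first stretch of length [b]; from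
    there on the local comparison applies. *)
Lemma defect_le_stationary : exists2 B : R, 0 < B & exists2 w1 : R, 0 < w1 &
  forall w0 z, 0 < w0 -> w0 <= w1 -> 2 * B <= z ->
  1 - laplace (sigma2 / 2 * w0 ^+ 2) z <= (1 + eps) * stationary k w0 (z - B).
Proof.
have [B0 B00 [delta delta0 hB]] := branching_ge_stationary ol sigma20 eta20 eps0 (ltW eps1).
pose delta' := Num.min delta (1 / 2).
have delta'0 : 0 < delta' by rewrite lt_min delta0 divr_gt0.
have d'd : delta' <= delta by rewrite ge_min lexx.
have d'1 : delta' <= 1 / 2 by rewrite ge_min lexx orbT.
have [B1 B10 [w1 w10 hw]] := stationary_small delta'0.
pose b := Num.max B0 B1.
have bp : 0 < b by rewrite lt_max B00.
have bB0 : B0 <= b by rewrite le_max lexx.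
have bB1 : B1 <= b by rewrite le_max lexx orbT.
pose small := (8 * k)^-1 / (2 * b) ^+ 2.
have small0 : 0 < small.
  by apply: divr_gt0; [rewrite invr_gt0 mulr_gt0|rewrite exprn_gt0// mulr_gt0].
have [L0 [t1 t10 hL]] := defect_small ol sigma20 small0.
pose L := Num.max L0 0.
have LL0 : L0 <= L by rewrite le_max lexx.
have L0' : 0 <= L by rewrite le_max lexx orbT.
pose w2 := Num.min w1 (Num.min 1 (t1 / (sigma2 / 2))).
have s20 : 0 < sigma2 / 2 by rewrite divr_gt0.
exists (L + b); first by lra.
exists w2; first by rewrite !lt_min w10 ltr01/= divr_gt0.
move=> w0 z w00; rewrite !le_min => /and3P[w01 w0le1 w0t] zB.
set V := stationary k w0.
have ss := stationary_steady k0 w00.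
have tt1 : sigma2 / 2 * w0 ^+ 2 <= t1.
  rewrite mulrC -ler_pdivlMr//; apply: le_trans w0t.
  by rewrite expr2 ler_piMl// ltW.
have Vsmall y : b <= y -> V (y / 2) <= delta' by move=> By; apply: hw => //; exact: le_trans By.
have Vsmall' y : b / 2 <= y -> V y <= delta'.
  by move=> By; rewrite (_ : y = y * 2 / 2); [apply: Vsmall; lra|lra].
have V0 y : 0 < y -> 0 < V y by move=> y0; exact: (ss_gt0 w00 ss).
pose G x : R := if x < L then 0 else 1 - (1 + eps) * V (x - L + b).
have lam0 : 0 <= 1 + eps by have := eps0; lra.
have lam1 : 1 + eps <= 2 by have := eps1; lra.
have G01 x : 0 <= G x <= 1.
  rewrite /G; case: ltP => x0; first by rewrite lexx ler01.
  have h1 : V (x - L + b) <= delta' by apply: Vsmall'; lra.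
  have h2 : 0 < V (x - L + b) by apply: V0; lra.
  apply/andP; split; last by rewrite gerBl mulr_ge0// ltW.
  rewrite subr_ge0; apply: (@le_trans _ _ (2 * (1 / 2))); last by lra.
  by apply: ler_pM => //; [exact: ltW|exact: le_trans d'1].
have uG : unit_fun G.
  split=> //; apply: nondecreasing_measurable => // x x' xx.
  have [xn|xp] := ltP x L; first by rewrite {1}/G xn; have /andP[] := G01 x'.
  rewrite /G !ltNge xp (le_trans xp xx)/= lerD2l lerN2 ler_wpM2l//.
  by apply: (ss_le ss); lra.
have zL : L <= z by lra.
have h : G z <= laplace (sigma2 / 2 * w0 ^+ 2) z.
  apply: (comparison_below ol (t_ge0 w0) uG) => x.
  have [xn|xp] := ltP x L.
    by left; rewrite /G xn; have /andP[] := laplace_bounds ol (t_ge0 w0) x.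
  have [xb|bx] := ltP x (L + b).
    left; rewrite /G ltNge xp /=.
    have h1 := hL _ x (t_ge0 w0) tt1 (le_trans LL0 xp).
    have h2 : small <= V (2 * b) by apply: (ss_lower ss); lra.
    have h3 : V (2 * b) <= V (x - L + b) by apply: (ss_le ss); lra.
    have h4 : 0 < V (x - L + b) by apply: V0; lra.
    have h5 : 0 <= eps * V (x - L + b) by rewrite mulr_ge0// ltW.
    rewrite /laplace in h1 *; lra.
  right; rewrite {1}/G ltNge xp /=.
  have e0 := eps0; have e1 := eps1.
  have hh : eps / 64 * (x - L + b) <= (x - L + b) / 2.
    by rewrite mulrC ler_wpM2l//; lra.
  apply: (hB w0 V (stationary1 k w0)) => //.
  - lra.
  - by apply: le_trans d'd; apply: Vsmall; lra.
  - lra.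
  - move=> u uh; rewrite /G ltNge (_ : L <= x - u)/=; last by lra.
    by rewrite (_ : x - u - L + b = x - L + b - u)//; ring.
have : V (z - L + b) <= V (z - (L + b)) by apply: (ss_le ss); lra.
move=> /(ler_wpM2l lam0).
move: h; rewrite /G ltNge zL /=; lra.
Qed.

End sandwich.

(** * Independence and equality in law *)

Section independence.
Local Open Scope ereal_scope.
Context {R : realType}.

Lemma integral_same_law d1 d2 d3 (T1 : measurableType d1) (T2 : measurableType d2)
    (U : measurableType d3) (P1 : probability T1 R) (P2 : probability T2 R)
    (X1 : T1 -> U) (X2 : T2 -> U) (phi : U -> \bar R) :
  measurable_fun setT X1 -> measurable_fun setT X2 -> measurable_fun setT phi ->
  (forall x, 0 <= phi x) ->
  (forall A, measurable A -> P1 (X1 @^-1` A) = P2 (X2 @^-1` A)) ->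
  \int[P1]_w phi (X1 w) = \int[P2]_w phi (X2 w).
Proof.
move=> m1 m2 mphi phi0 e.
pose Y1 : {mfun T1 >-> U} := mfun_Sub (mem_set m1).
pose Y2 : {mfun T2 >-> U} := mfun_Sub (mem_set m2).
transitivity (\int[distribution P1 Y1]_x phi x).
  by rewrite ge0_integral_distribution.
transitivity (\int[distribution P2 Y2]_x phi x); last first.
  by rewrite ge0_integral_distribution.
by apply: eq_measure_integral => A mA _; exact: e.
Qed.

(** The law of the pair is the product of the laws, to which Tonelli's theorem
    applies. *)
Lemma integral_independent d d1 d2 (T : measurableType d) (U1 : measurableType d1)
    (U2 : measurableType d2) (P : probability T R) (X1 : T -> U1) (X2 : T -> U2)
    (h : U1 * U2 -> \bar R) :
  measurable_fun setT X1 -> measurable_fun setT X2 -> measurable_fun setT h ->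
  (forall x, 0 <= h x) ->
  (forall A B, measurable A -> measurable B ->
     P (X1 @^-1` A `&` X2 @^-1` B) = P (X1 @^-1` A) * P (X2 @^-1` B)) ->
  \int[P]_w h (X1 w, X2 w) = \int[P]_w \int[P]_w' h (X1 w, X2 w').
Proof.
move=> m1 m2 mh h0 ind.
pose Y1 : {mfun T >-> U1} := mfun_Sub (mem_set m1).
pose Y2 : {mfun T >-> U2} := mfun_Sub (mem_set m2).
have m12 : measurable_fun setT (fun w => (X1 w, X2 w)) by exact: measurable_fun_pair.
pose Y : {mfun T >-> (U1 * U2)%type} := mfun_Sub (mem_set m12).
have -> : \int[P]_w h (X1 w, X2 w) = \int[distribution P Y]_x h x.
  by rewrite ge0_integral_distribution.
have -> : \int[distribution P Y]_x h x =
    \int[(distribution P Y1 \x distribution P Y2)%E]_x h x.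
  apply: eq_measure_integral => A mA _; apply/esym.
  exact: product_measure_unique.
rewrite fubini_tonelli1//.
rewrite /fubini_F ge0_integral_distribution//; last 2 first.
- exact: (measurable_fun_fubini_tonelli_F (m2 := distribution P Y2)).
- by move=> x; exact: integral_ge0.
apply: eq_integral => w _ /=.
rewrite ge0_integral_distribution//.
by apply: measurableT_comp => //; exact: measurable_fun_pair.
Qed.

(** The uniqueness theorem for measures on a pi-system, applied to one family and
    then to the other. *)
Lemma independent_sigma d (T : measurableType d) (P : probability T R)
    (G1 G2 : set (set T)) :
  G1 `<=` measurable -> G2 `<=` measurable -> setI_closed G1 -> setI_closed G2 ->
  G1 setT -> G2 setT ->
  (forall A B, G1 A -> G2 B -> P (A `&` B) = P A * P B) ->
  forall A B, <<s G1 >> A -> <<s G2 >> B -> P (A `&` B) = P A * P B.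
Proof.
move=> m1 m2 I1 I2 T1 T2 ind.
have step (G : set (set T)) (B : set T) : G `<=` measurable -> setI_closed G ->
    G setT -> measurable B -> (forall A, G A -> P (A `&` B) = P A * P B) ->
    forall A, <<s G >> A -> P (A `&` B) = P A * P B.
  move=> mG IG TG mB e A sA.
  pose r : {nonneg R} := NngNum (fine_ge0 (measure_ge0 P B)).
  have rE : r%:num%:E = P B by rewrite fineK// fin_num_measure.
  pose m : {measure set T -> \bar R} := mrestr P mB.
  pose m' : {measure set T -> \bar R} := mscale r P.
  have m'E C : m' C = P C * P B by rewrite /m' /= /mscale rE muleC.
  rewrite -m'E -[LHS]/(m A).
  apply: (g_sigma_algebra_measure_unique G mG (fun=> setT)) => //.
  - by rewrite bigcup_const//; exists 0%N.
  - by move=> C GC; rewrite m'E; exact: e.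
  - by move=> _; rewrite /m /= /mrestr; apply: le_lt_trans (probability_le1 _ _) _ => //; [exact: measurableI|exact: ltry].
have sm (G : set (set T)) : G `<=` measurable -> <<s G >> `<=` measurable.
  by move=> mG; apply: smallest_sub => //; exact: sigma_algebra_measurable.
move=> A B sA sB.
apply: (step G1) => //; first exact: (sm G2).
move=> {sA}A GA; rewrite setIC muleC; apply: (step G2) => //; first exact: m1.
by move=> C GC; rewrite setIC muleC; exact: ind.
Qed.

End independence.

(** * Marks and cylinder events *)

Section marks.
Context {R : realType}.

Definition mark_gen : set (set (mark R)) :=
  [set (fun m : mark R => m.1.1.1) @^-1` A | A in measurable] `|`
  \bigcup_i [set (fun m : mark R => m.1.1.2 i) @^-1` B | B in measurable] `|`
  [set (fun m : mark R => m.1.2) @^-1` B | B in measurable] `|`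
  [set (fun m : mark R => m.2) @^-1` B | B in measurable].

(** The space of marks with its sigma-algebra, so that [mark_events] are its
    measurable sets. *)
Definition markT := g_sigma_algebraType mark_gen.

Lemma measurable_mark_size : measurable_fun setT (fun m : markT => m.1.1.1).
Proof. by move=> _ B mB; rewrite setTI; apply: sub_sigma_algebra; do 3 left; exists B. Qed.

Lemma measurable_mark_atom i : measurable_fun setT (fun m : markT => m.1.1.2 i).
Proof.
by move=> _ B mB; rewrite setTI; apply: sub_sigma_algebra; do 2 left; right; exists i => //; exists B.
Qed.

Lemma measurable_mark_lambda : measurable_fun setT (fun m : markT => m.1.2).
Proof. by move=> _ B mB; rewrite setTI; apply: sub_sigma_algebra; left; right; exists B. Qed.

Lemma measurable_mark_decor : measurable_fun setT (fun m : markT => m.2).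
Proof. by move=> _ B mB; rewrite setTI; apply: sub_sigma_algebra; right; exists B. Qed.

Lemma measurable_mark_of d (T : measurableType d) (P : probability T R) (s : scheme P) :
  measurable_fun setT (mark_of s : T -> markT).
Proof.
apply: (@measurability _ _ T markT setT (mark_of s) mark_gen) => //.
have m d' (V : measurableType d') (f : T -> V) (g : mark R -> V) B :
    measurable_fun setT f -> (forall w, g (mark_of s w) = f w) -> measurable B ->
    measurable ([set: T] `&` mark_of s @^-1` (g @^-1` B)).
  move=> mf gf mB; rewrite setTI (_ : _ @^-1` _ = f @^-1` B).
    by rewrite -[X in measurable X]setTI; exact: mf.
  by apply/seteqP; split=> w /=; rewrite gf.
move=> _ [_ [[[[B mB <-]|[i _ [B mB <-]]]|[B mB <-]]|[B mB <-]] <-].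
- by apply: (m _ _ (natoms s)) => //; exact: measurable_funPT.
- by apply: (m _ _ (atom s i)) => //; exact: measurable_funPT.
- by apply: (m _ _ (lambda s)) => //; exact: measurable_funPT.
- by apply: (m _ _ (decor s)) => //; exact: measurable_funPT.
Qed.

(** The integrand of the branching operator as a function of the mark.  The flag [b]
    tells whether the barrier is imposed, and [F] may depend on the child, as it does
    for subtrees at a fixed sample point. *)
Definition mark_step (t : R) (b : bool) (F : nat -> R -> R) (x : R) (m : mark R) : R :=
  expR (- (t * m.2)) * (b ==> (m.1.2 <= x)%R)%:R *
  \prod_(i < m.1.1.1) F i (x - m.1.1.2 i).

End marks.
Arguments mark_gen R : clear implicits.
Arguments markT R : clear implicits.

Section cylinders.
Context {R : realType} {d : measure_display} {T : measurableType d}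
  {P : probability T R} (S : word -> scheme P).

Definition cylinders (I : set word) : set (set T) :=
  [set C | exists (J : {fset word}) (A : word -> set (mark R)),
     [/\ forall u, u \in J -> I u, forall u, u \in J -> mark_events (A u) &
         C = \bigcap_(u in [set` J]) mark_of (S u) @^-1` A u]].

Let mmark u (A : set (mark R)) : mark_events A -> measurable (mark_of (S u) @^-1` A).
Proof. by move=> mA; rewrite -[X in measurable X]setTI; exact: measurable_mark_of. Qed.

Lemma cylinders_measurable I : cylinders I `<=` measurable.
Proof.
move=> _ [J [A [JI mA ->]]].
apply: fin_bigcap_measurable; first exact: finite_fset.
by move=> u /= uJ; apply: mmark; exact: mA.
Qed.

Lemma cylinders_setT I : cylinders I setT.
Proof.
exists fset0, (fun=> setT); split => //.
by rewrite set_fset0 bigcap_set0.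
Qed.

(** The two families of words may overlap: the sides of each cylinder are first
    extended by [setT] to all words. *)
Lemma cylinders_setI I : setI_closed (cylinders I).
Proof.
move=> _ _ [J1 [A1 [J1I mA1 ->]]] [J2 [A2 [J2I mA2 ->]]].
pose B1 u := if u \in J1 then A1 u else setT.
pose B2 u := if u \in J2 then A2 u else setT.
have mB1 u : mark_events (B1 u).
  by rewrite /B1; case: ifP => [/mA1//|_]; exact: (@measurableT _ (markT R)).
have mB2 u : mark_events (B2 u).
  by rewrite /B2; case: ifP => [/mA2//|_]; exact: (@measurableT _ (markT R)).
exists (J1 `|` J2)%fset, (fun u => B1 u `&` B2 u); split.
- by move=> u; rewrite inE => /orP[/J1I|/J2I].
- by move=> u _; apply: (@measurableI _ (markT R)); [exact: mB1|exact: mB2].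
apply/seteqP; split=> w /=.
  move=> [h1 h2] u /= _; split; rewrite /B1 /B2; case: ifPn => // uJ.
    exact: h1.
  exact: h2.
move=> h; split=> u /= uJ.
  have /= := h u; rewrite inE uJ => /(_ isT)[]; by rewrite /B1 uJ.
have /= := h u; rewrite inE uJ orbT => /(_ isT)[_]; by rewrite /B2 uJ.
Qed.

Hypothesis indep : independent_schemes S.

(** Cylinders over disjoint sets of words are independent by definition. *)
Lemma cylinders_independent I1 I2 : (forall u, I1 u -> I2 u -> False) ->
  forall A B, <<s cylinders I1 >> A -> <<s cylinders I2 >> B ->
  P (A `&` B) = (P A * P B)%E.
Proof.
move=> dis; apply: independent_sigma;
  [exact: cylinders_measurable|exact: cylinders_measurable|
   exact: cylinders_setI|exact: cylinders_setI|
   exact: cylinders_setT|exact: cylinders_setT|].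
move=> _ _ [J1 [A1 [J1I mA1 ->]]] [J2 [A2 [J2I mA2 ->]]].
pose A u := if u \in J1 then A1 u else A2 u.
have JJ u : u \in J1 -> u \in J2 = false.
  by move=> u1; apply/negbTE/negP => u2; exact: dis (J1I _ u1) (J2I _ u2).
have -> : (\bigcap_(u in [set` J1]) mark_of (S u) @^-1` A1 u) `&`
    (\bigcap_(u in [set` J2]) mark_of (S u) @^-1` A2 u) =
    \bigcap_(u in [set` (J1 `|` J2)%fset]) mark_of (S u) @^-1` A u.
  apply/seteqP; split=> w /=.
    move=> [h1 h2] u /=; rewrite inE /A; case: ifPn => [uJ1 _|_ /= uJ2]; [exact: h1|exact: h2].
  move=> h; split=> u /= uJ; have /= := h u; rewrite inE uJ ?orbT => /(_ isT); rewrite /A ?uJ//.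
  by case: ifP => // u1; rewrite JJ in uJ.
rewrite !indep//; last first.
  by move=> u; rewrite inE /A; case: ifPn => [uJ1 _|_ /=]; [exact: mA1|exact: mA2].
rewrite (bigID (mem J1)) /=; congr (_ * _)%E.
- rewrite -big_filter (perm_big (enum_fset J1)) /=.
    by rewrite big_seq [RHS]big_seq; apply: eq_bigr => u uJ; rewrite /A uJ.
  apply: uniq_perm; rewrite ?filter_uniq ?fset_uniq// => u.
  by rewrite mem_filter inE; case: (boolP (u \in J1)).
- rewrite -big_filter (perm_big (enum_fset J2)) /=.
    rewrite big_seq [RHS]big_seq; apply: eq_bigr => u uJ; rewrite /A.
    by case: ifP => // u1; rewrite JJ in uJ.
  apply: uniq_perm; rewrite ?filter_uniq ?fset_uniq// => u.
  by rewrite mem_filter inE; case: (boolP (u \in J1)) => //= /JJ ->.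
Qed.

End cylinders.

(** * The branching property *)

Lemma measurable_compT d1 d2 d3 (T1 : measurableType d1) (T2 : measurableType d2)
    (T3 : measurableType d3) (f : T2 -> T3) (g : T1 -> T2) :
  measurable_fun setT f -> measurable_fun setT g ->
  measurable_fun setT (fun x => f (g x)).
Proof. by move=> mf mg; exact: (measurableT_comp mf mg). Qed.

Section mark_step_theory.
Context {R : realType}.
Implicit Types (t x : R) (b : bool).

Lemma measurable_mark_step t b d (U : measurableType d) (F : nat -> R -> U -> R)
    (x : U -> R) (m : U -> markT R) :
  measurable_fun setT x -> measurable_fun setT m ->
  (forall i, measurable_fun setT (fun p : R * U => F i p.1 p.2)) ->
  measurable_fun setT (fun z => mark_step t b (fun i x' => F i x' z) (x z) (m z)).
Proof.
move=> mx mm mF; rewrite /mark_step; apply: measurable_funM.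
  apply: measurable_funM.
    apply: measurableT_comp => //; apply: measurableT_comp => //.
    apply: measurable_funM => //.
    exact: (measurableT_comp measurable_mark_decor mm).
  apply: measurable_boolR.
  case: b => /=; last exact: measurable_cst.
  apply: measurable_fun_ler => //.
  exact: (measurableT_comp measurable_mark_lambda mm).
apply: (measurable_random_prod (N := fun z => (m z).1.1.1)
  (h := fun i z => F i (x z - (m z).1.1.2 i) z)).
  exact: (measurableT_comp measurable_mark_size mm).
move=> i; apply: (@measurable_compT _ _ _ _ _ _ (fun p : R * U => F i p.1 p.2)
  (fun z => (x z - (m z).1.1.2 i, z))) => //.
apply: measurable_fun_pair => //; apply: measurable_funB => //.
exact: (measurableT_comp (measurable_mark_atom i) mm).
Qed.

Lemma mark_step_unit t b (F : nat -> R -> R) x (m : mark R) :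
  0 <= t -> 0 <= m.2 -> (forall i y, 0 <= F i y <= 1) ->
  0 <= mark_step t b F x m <= 1.
Proof.
move=> t0 m0 F01; rewrite /mark_step.
have e0 := expR_ge0 (- (t * m.2)).
have e1 : expR (- (t * m.2)) <= 1 by rewrite -expR0 ler_expR oppr_le0 mulr_ge0.
have /andP[p0 p1] : 0 <= \prod_(i < m.1.1.1) F i (x - m.1.1.2 i) <= 1.
  by apply: (@prod_unit _ (fun i => F i (x - m.1.1.2 i))).
case: (b ==> _); rewrite ?mulr1 ?mulr0 ?mul0r ?lexx ?ler01//.
by rewrite mulr_ge0//= mulr_ile1.
Qed.

End mark_step_theory.

Section branching.
Context {R : realType} {d : measure_display} {T : measurableType d}
  {P : probability T R} (S : word -> scheme P).
Context {d0 : measure_display} {T0 : measurableType d0}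
  {P0 : probability T0 R} (s : scheme P0).
Hypotheses (indep : independent_schemes S) (law : forall u, same_law s (S u)).
Variables (t : R) (b : bool).
Hypothesis t0 : 0 <= t.

(** The sample space with the sigma-algebra generated by the marks of the words in
    [I]: being measurable on it means to depend on these marks only. *)
Definition sub_sigma (I : set word) := g_sigma_algebraType (cylinders S I).

Definition descendants (u : word) : set word := [set v | prefix u v].

(** The contribution of the subtree rooted at [u], cut [n] generations below, for a
    barrier at distance [x] from the position of [u]. *)
Fixpoint subtree (n : nat) (u : word) (x : R) (w : T) : R :=
  if n is m.+1 then
    mark_step t b (fun i x' => subtree m (rcons u i) x' w) x (mark_of (S u) w)
  else 1.

(** The expected value of [subtree], computed from the law of one mark. *)
Fixpoint laplace_rec (n : nat) (x : R) : R :=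
  if n is m.+1 then
    expect P0 (fun w => mark_step t b (fun=> laplace_rec m) x (mark_of s w))
  else 1.

Lemma measurable_sub_mark I u : I u ->
  @measurable_fun _ _ (sub_sigma I) (markT R) setT (mark_of (S u)).
Proof.
move=> Iu _ A mA; rewrite setTI; apply: sub_sigma_algebra.
exists [fset u]%fset, (fun=> A); split.
- by move=> v; rewrite inE => /eqP ->.
- by move=> v _; exact: mA.
- apply/seteqP; split=> w /=; first by move=> h v /=; rewrite inE => /eqP ->.
  by move=> /(_ u); apply; rewrite /= inE.
Qed.

Lemma measurable_sub_id I : @measurable_fun _ _ T (sub_sigma I) setT id.
Proof.
move=> _ A mA; rewrite setTI; move: mA.
by apply: (@smallest_sub _ _ (cylinders S I)); [exact: sigma_algebra_measurable|exact: cylinders_measurable].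
Qed.

(** Measurability is joint in the position of the barrier, because the children of a
    random mark see barriers at random positions. *)
Lemma measurable_subtree n u I : descendants u `<=` I ->
  measurable_fun setT (fun p : R * sub_sigma I => subtree n u p.1 p.2).
Proof.
elim: n u => [|n ih] u uI /=; first exact: measurable_cst.
apply: (@measurable_mark_step _ _ _ _ (R * sub_sigma I)%type
  (fun i x' (p : R * sub_sigma I) => subtree n (rcons u i) x' p.2)
  fst (fun p => mark_of (S u) p.2)).
- exact: measurable_fst.
- apply: (measurableT_comp (measurable_sub_mark _)) => //; apply: uI.
  exact: prefix_refl.
- move=> i.
  apply: (@measurable_compT _ _ _ _ _ _ (fun p : R * sub_sigma I => subtree n (rcons u i) p.1 p.2)
    (fun p : R * (R * sub_sigma I) => (p.1, p.2.2))).
    apply: ih => v /= uv; apply: uI; apply: prefix_trans uv.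
    exact: prefix_rcons.
  apply: measurable_fun_pair => //.
  by apply: measurableT_comp => //; exact: measurable_snd.
Qed.

Lemma measurable_subtreeT n u x : measurable_fun setT (subtree n u x).
Proof.
apply: (@measurable_compT _ _ _ _ _ _ (fun p : R * sub_sigma (descendants u) => subtree n u p.1 p.2)
  (fun w : T => (x, w : sub_sigma (descendants u)))); first exact: measurable_subtree.
by apply: measurable_fun_pair => //; exact: measurable_sub_id.
Qed.

Lemma subtree_unit n u x w : 0 <= subtree n u x w <= 1.
Proof.
elim: n u x => [|n ih] u x /=; first by rewrite ler01 lexx.
by apply: mark_step_unit => //; exact: decor_ge0.
Qed.

(** The subtrees of the children of [u] depend on disjoint sets of marks. *)
Lemma subtree_children n (F : R -> R) (u : word) k (xs : nat -> R) :
  (forall v x, (\int[P]_w (subtree n v x w)%:E = (F x)%:E)%E) ->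
  (\int[P]_w (\prod_(i < k) subtree n (rcons u i) (xs i) w)%:E =
   (\prod_(i < k) F (xs i))%:E)%E.
Proof.
move=> hF; elim: k => [|k ih].
  under eq_integral do rewrite big_ord0.
  by rewrite big_ord0 integral_cst// mul1e; exact: probability_setT.
pose I1 : set word := [set v | exists2 i, (i < k)%N & prefix (rcons u i) v].
pose I2 := descendants (rcons u k).
pose Y1 (w : T) := \prod_(i < k) subtree n (rcons u i) (xs i) w.
pose Y2 (w : T) := subtree n (rcons u k) (xs k) w.
have Y10 w : 0 <= Y1 w.
  by apply: prodr_ge0 => i _; have /andP[] := subtree_unit n (rcons u i) (xs i) w.
have Y20 w : 0 <= Y2 w by have /andP[] := subtree_unit n (rcons u k) (xs k) w.
have mY1 : @measurable_fun _ _ (sub_sigma I1) R setT Y1.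
  apply: measurable_prod => i _.
  apply: (@measurable_compT _ _ _ _ _ _ (fun p : R * sub_sigma I1 => subtree n (rcons u i) p.1 p.2)
    (fun w : sub_sigma I1 => (xs i, w))); last exact: measurable_fun_pair.
  by apply: measurable_subtree => v uv; exists i.
have mY2 : @measurable_fun _ _ (sub_sigma I2) R setT Y2.
  apply: (@measurable_compT _ _ _ _ _ _ (fun p : R * sub_sigma I2 => subtree n (rcons u k) p.1 p.2)
    (fun w : sub_sigma I2 => (xs k, w))); last exact: measurable_fun_pair.
  exact: measurable_subtree.
pose h (p : sub_sigma I1 * sub_sigma I2) : \bar R := (Y1 p.1 * Y2 p.2)%:E.
under eq_integral => w _ do rewrite big_ord_recr /= -/(Y1 w) -/(Y2 w) -/(h (w, w)).
have dis v : I1 v -> I2 v -> False.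
  move=> [i ik /prefixP[v1 e1]] /prefixP[v2]; rewrite e1 !cat_rcons.
  move=> /eqP; rewrite eqseq_cat// eqxx /= eqseq_cons => /andP[/eqP e _].
  by rewrite e ltnn in ik.
have mh : measurable_fun setT h.
  apply/measurable_EFinP; apply: measurable_funM.
    exact: (measurableT_comp mY1 measurable_fst).
  exact: (measurableT_comp mY2 measurable_snd).
rewrite (@integral_independent _ _ _ _ T (sub_sigma I1) (sub_sigma I2) P id id h)//.
- rewrite big_ord_recr /= EFinM -ih.
  under eq_integral => w _.
    have -> : (\int[P]_w' h (w, w') = (Y1 w)%:E * (F (xs k))%:E)%E.
      rewrite -(hF (rcons u k)) -ge0_integralZl//.
      - by apply/measurable_EFinP; exact: measurable_subtreeT.
      - by move=> w' _; rewrite lee_fin; exact: Y20.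
      - by rewrite lee_fin.
    over.
  rewrite ge0_integralZr//.
  - by apply/measurable_EFinP; apply: measurable_prod => i _; exact: measurable_subtreeT.
  - by move=> w _; rewrite lee_fin.
  - rewrite -(hF (rcons u k)); apply: integral_ge0 => w _; rewrite lee_fin; exact: Y20.
- exact: measurable_sub_id.
- exact: measurable_sub_id.
- by move=> p; rewrite lee_fin mulr_ge0.
- by move=> A B mA mB; exact: (cylinders_independent indep dis).
Qed.

(** The mark of [u] is independent of the marks of its descendants: integrating over
    the latter first replaces each subtree by its expected value, and what remains
    depends on the law of one mark. *)
Lemma integral_subtree n u x : (\int[P]_w (subtree n u x w)%:E = (laplace_rec n x)%:E)%E.
Proof.
elim: n u x => [|n ih] u x.
  by rewrite /= integral_cst// mul1e; exact: probability_setT.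
have F01 y : 0 <= laplace_rec n y <= 1.
  rewrite -!lee_fin -(ih [::]); apply/andP; split.
    by apply: integral_ge0 => w _; rewrite lee_fin; have /andP[] := subtree_unit n [::] y w.
  rewrite -[leRHS](@probability_setT _ _ _ P) -[X in (_ <= X)%E]mul1e -integral_cst//.
  apply: ge0_le_integral => //.
  - by move=> w _; rewrite lee_fin; have /andP[] := subtree_unit n [::] y w.
  - by apply/measurable_EFinP; exact: measurable_subtreeT.
  - by move=> w _; rewrite lee_fin; have /andP[] := subtree_unit n [::] y w.
have mF : measurable_fun setT (laplace_rec n).
  apply/measurable_EFinP.
  have -> : EFin \o laplace_rec n = (fun y => \int[P]_w (subtree n [::] y w)%:E)%E.
    by apply/funext => y /=; rewrite ih.
  apply: (@measurable_fun_fubini_tonelli_F _ _ R T R P (fun p => (subtree n [::] p.1 p.2)%:E)); last first.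
    by move=> p; rewrite lee_fin; have /andP[] := subtree_unit n [::] p.1 p.2.
  apply/measurable_EFinP.
  apply: (@measurable_compT _ _ _ _ _ _ (fun p : R * sub_sigma setT => subtree n [::] p.1 p.2)
    (fun p : R * T => (p.1, p.2 : sub_sigma setT))); first exact: measurable_subtree.
  apply: measurable_fun_pair => //.
  by apply: (measurableT_comp (@measurable_sub_id setT)); exact: measurable_snd.
pose phi (m : markT R) : \bar R := (mark_step t b (fun=> laplace_rec n) x m)%:E.
(* phi is nonnegative only at marks with a nonnegative decoration *)
pose phi' (m : markT R) : \bar R := maxe 0%E (phi m).
have phiE d' (T' : measurableType d') (P' : probability T' R) (s' : scheme P') w :
    phi (mark_of s' w) = phi' (mark_of s' w).
  rewrite /phi' max_r// lee_fin.
  by have /andP[] := @mark_step_unit _ t b (fun=> laplace_rec n) x (mark_of s' w) t0 (decor_ge0 s' w) (fun=> F01).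
have mphi : measurable_fun setT phi.
  apply/measurable_EFinP.
  apply: (@measurable_mark_step _ t b _ (markT R) (fun _ y _ => laplace_rec n y) (fun=> x) id) => //.
  by move=> i; exact: (measurableT_comp mF measurable_fst).
have mphi' : measurable_fun setT phi' by apply: measurable_maxe.
transitivity (\int[P]_w phi (mark_of (S u) w))%E; last first.
  rewrite /= expectE; last first.
    apply: (@summable_bounded _ _ _ _ _ 1).
      by apply/measurable_EFinP; exact: (measurableT_comp mphi (measurable_mark_of s)).
    move=> w.
    have /andP[h0 h1] := @mark_step_unit _ t b (fun=> laplace_rec n) x (mark_of s w) t0 (decor_ge0 s w) (fun=> F01).
    by rewrite ger0_norm.
  rewrite -/(phi _).
  under eq_integral => w _ do rewrite phiE.
  under [RHS]eq_integral => w _ do rewrite -/(phi (mark_of s w)) phiE.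
  apply: (@integral_same_law _ _ _ _ T T0 (markT R) P P0 (mark_of (S u)) (mark_of s) phi').
  - exact: measurable_mark_of.
  - exact: measurable_mark_of.
  - exact: mphi'.
  - by move=> m; rewrite le_max lexx.
  - by move=> A mA; exact: law.
pose I : set word := [set v | exists i, prefix (rcons u i) v].
pose hh (p : markT R * sub_sigma I) : R :=
  mark_step t b (fun i x' => subtree n (rcons u i) x' p.2) x p.1.
pose h (p : markT R * sub_sigma I) : \bar R := maxe 0%E (hh p)%:E.
have mh : measurable_fun setT h.
  apply: measurable_maxe => //; apply/measurable_EFinP.
  apply: (@measurable_mark_step _ t b _ (markT R * sub_sigma I)%type
    (fun i x' p => subtree n (rcons u i) x' p.2) (fun=> x) fst).
  - exact: measurable_cst.
  - exact: measurable_fst.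
  move=> i; apply: (@measurable_compT _ _ _ _ _ _ (fun p : R * sub_sigma I => subtree n (rcons u i) p.1 p.2)
    (fun p : R * (markT R * sub_sigma I) => (p.1, p.2.2))).
    by apply: measurable_subtree => v uv; exists i.
  apply: measurable_fun_pair; first exact: measurable_fst.
  exact: (measurable_compT measurable_snd measurable_snd).
have hhE w w' : h (mark_of (S u) w, w') = (hh (mark_of (S u) w, w'))%:E.
  rewrite /h max_r// lee_fin.
  by have /andP[] := @mark_step_unit _ t b (fun i x' => subtree n (rcons u i) x' w') x
    (mark_of (S u) w) t0 (decor_ge0 (S u) w) (fun i y => subtree_unit n (rcons u i) y w').
transitivity (\int[P]_w h (mark_of (S u) w, w))%E.
  by apply: eq_integral => w _; rewrite hhE.
have dis v : [set u] v -> I v -> False.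
  move=> -> [i /prefixP[v1 /(congr1 size)]]; rewrite size_cat size_rcons; lia.
rewrite (@integral_independent _ _ _ _ T (markT R) (sub_sigma I) P (mark_of (S u)) id h)//; last 4 first.
- exact: measurable_mark_of.
- exact: measurable_sub_id.
- by move=> p; rewrite le_max lexx.
- move=> A B mA mB; apply: (cylinders_independent indep dis) => //.
  have := @measurable_sub_mark [set u] u erefl measurableT A mA.
  by rewrite setTI.
apply: eq_integral => w _.
under eq_integral => w' _ do rewrite hhE.
rewrite /hh /phi /mark_step /= EFinM.
under eq_integral => w' _ do rewrite EFinM.
rewrite ge0_integralZl//.
- congr (_ * _)%E.
  exact: (@subtree_children n (laplace_rec n) u (natoms (S u) w) (fun i => x - atom (S u) i w)).
- apply/measurable_EFinP; apply: measurable_prod => i _; exact: measurable_subtreeT.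
- move=> w' _; rewrite lee_fin; apply: prodr_ge0 => i _.
  by have /andP[] := subtree_unit n (rcons u i) (x - atom (S u) i w) w'.
Qed.

End branching.

(** * Truncated trees and their limit *)

Section nodes.
Context {R : realType} {d : measure_display} {T : measurableType d}
  {P : probability T R} (S : word -> scheme P) (w : T).
Implicit Types (u v : word) (n : nat).

(** The vertices at most [n - 1] generations below [u]. *)
Fixpoint nodes n u : seq word :=
  if n is m.+1 then
    u :: flatten [seq nodes m (rcons u i) | i <- iota 0 (natoms (S u) w)]
  else [::].

Lemma mem_nodesS n u v : reflect
  (v = u \/ exists2 i, (i < natoms (S u) w)%N & v \in nodes n (rcons u i))
  (v \in nodes n.+1 u).
Proof.
apply: (iffP idP) => /=; rewrite inE.
  case/orP => [/eqP|/flattenP[_ /mapP[i + ->] vn]]; first by left.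
  by rewrite mem_iota => /andP[_ iN]; right; exists i.
case=> [->|[i iN vn]]; first by rewrite eqxx.
apply/orP; right; apply/flattenP; exists (nodes n (rcons u i)) => //.
by apply/mapP; exists i; rewrite // mem_iota.
Qed.

Lemma nodes_prefix n u v : v \in nodes n u -> prefix u v.
Proof.
elim: n u => [|n ih] u //= /mem_nodesS[->|[i _ /ih]]; first exact: prefix_refl.
by apply: prefix_trans; exact: prefix_rcons.
Qed.

Lemma nodes_nth n u v i : v \in nodes n (rcons u i) -> nth 0%N v (size u) = i.
Proof.
move=> /nodes_prefix/prefixP[v' ->].
by rewrite nth_cat size_rcons ltnSn nth_rcons ltnn eqxx.
Qed.

Lemma nodes_uniq n u : uniq (nodes n u).
Proof.
elim: n u => [|n ih] u //=; apply/andP; split.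
  apply/negP => /flattenP[_ /mapP[i _ ->] /nodes_prefix/prefixP[v' /(congr1 size)]].
  by rewrite size_cat size_rcons; lia.
have : uniq (iota 0 (natoms (S u) w)) by exact: iota_uniq.
elim: (iota _ _) => //= i l ihl /andP[il ul].
rewrite cat_uniq ih ihl// andbT /=; apply/hasPn => v /flattenP[_ /mapP[j jl ->] vj].
apply/negP => vi; move: il; rewrite -(nodes_nth vi) (nodes_nth vj) jl.
by [].
Qed.

Lemma mem_nodes n u v : tree S w u ->
  (v \in nodes n u) <-> [/\ prefix u v, tree S w v & (size v < size u + n)%N].
Proof.
elim: n u => [|n ih] u tu; split=> //.
- by move=> [/prefixP[v' ->] _]; rewrite size_cat addn0; lia.
- move=> /mem_nodesS[->|[i iN]]; first by split => //; [exact: prefix_refl|lia].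
  move=> /ih; case; first by apply/tree_rcons.
  move=> uv tv; rewrite size_rcons => sv; split => //; last by lia.
  by apply: prefix_trans uv; exact: prefix_rcons.
- move=> [/prefixP[v' e] tv sv]; apply/mem_nodesS.
  case: v' e => [|i v'] e; first by left; rewrite e cats0.
  right; exists i.
    have := tv (size u); rewrite e size_cat /= nth_cat ltnn subnn /= take_size_cat//.
    by apply; lia.
  apply/ih.
    apply/tree_rcons; split => //; have := tv (size u).
    by rewrite e size_cat /= nth_cat ltnn subnn /= take_size_cat//; apply; lia.
  split => //; last by rewrite size_rcons; lia.
  by rewrite e -cat_rcons; exact: prefix_prefix.
Qed.

Lemma mem_nodes0 n v : (v \in nodes n [::]) <-> tree S w v /\ (size v < n)%N.
Proof.
rewrite (mem_nodes n v (tree_nil S w)) add0n; split=> [[]//|[tv sv]].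
by split => //; exact: prefix0s.
Qed.

Variables (t : R) (b : bool).

Lemma subtreeE n u x : subtree S t b n u x w =
  expR (- (t * \sum_(v <- nodes n u) decor (S v) w)) *
  (b ==> all (fun v => Lambda S v w <= x + position S u w)%R (nodes n u))%:R.
Proof.
elim: n u x => [|n ih] u x.
  by rewrite /= big_nil mulr0 oppr0 expR0 implybT mul1r.
pose Q : pred word := fun v => (Lambda S v w <= x + position S u w)%R.
rewrite -[fun v => (Lambda S v w <= _)%R]/Q [LHS]/= /mark_step /=.
have -> : \prod_(i < natoms (S u) w) subtree S t b n (rcons u i) (x - atom (S u) i w) w =
  \prod_(i <- iota 0 (natoms (S u) w))
    (expR (- (t * \sum_(v <- nodes n (rcons u i)) decor (S v) w)) *
     (b ==> all Q (nodes n (rcons u i)))%:R).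
  rewrite -[in RHS](subn0 (natoms (S u) w)) -/(index_iota _ _) big_mkord.
  apply: eq_bigr => i _; rewrite ih; congr (_ * _).
  congr ((_ ==> _)%:R); apply: eq_all => v.
  by rewrite /Q position_rcons; congr (_ <= _); ring.
have -> : (lambda (S u) w <= x)%R = Q u.
  by rewrite /Q /Lambda [x + _]addrC lerD2l.
rewrite big_cons.
have -> (l : seq nat) : \prod_(i <- l)
    (expR (- (t * \sum_(v <- nodes n (rcons u i)) decor (S v) w)) *
     (b ==> all Q (nodes n (rcons u i)))%:R) =
  expR (- (t * \sum_(v <- flatten [seq nodes n (rcons u i) | i <- l]) decor (S v) w)) *
   (b ==> all Q (flatten [seq nodes n (rcons u i) | i <- l]))%:R.
  elim: l => [|i l ihl]; first by rewrite /= !big_nil mulr0 oppr0 expR0 implybT mul1r.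
  rewrite big_cons ihl /= big_cat /= all_cat mulrDr opprD expRD.
  by case: b; case: (all Q (nodes _ _)) => /=; rewrite ?mulr0 ?mul0r ?mulr1 ?mul1r//; ring.
rewrite mulrDr opprD expRD.
by case: b; rewrite /=; case: (Q u) => /=; rewrite ?mulr0 ?mul0r ?mulr1 ?mul1r//; ring.
Qed.

Let partial n : R := \sum_(v <- nodes n [::]) decor (S v) w.

Let partialE n : (partial n)%:E = (\sum_(v \in [set` nodes n [::]]) (decor (S v) w)%:E)%E.
Proof. by rewrite -fsbig_seq ?nodes_uniq// sumEFin. Qed.

Let partial_mono : nondecreasing_seq (EFin \o partial).
Proof.
move=> m n mn; rewrite /= !partialE; apply: lee_fsum_nneg_subset.
- exact: finite_seq.
- exact: finite_seq.
- by move=> v; rewrite !inE /= => /mem_nodes0[tv sv]; apply/mem_nodes0; split => //; lia.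
- by move=> v _; rewrite lee_fin; exact: decor_ge0.
Qed.

(** Every finite set of vertices is contained in the first generations. *)
Let partial_cvg : (partial n)%:E @[n --> \oo] --> total_decor S w.
Proof.
have -> : total_decor S w = ereal_sup (range (EFin \o partial)).
  apply/eqP; rewrite eq_le; apply/andP; split.
    apply: ub_ereal_sup => _ [A [finA At] <-].
    have [n hn] : exists n, forall v, A v -> (size v < n)%N.
      exists (\max_(v <- fset_set A) size v).+1 => v Av; rewrite ltnS.
      by apply: leq_bigmax_seq => //; rewrite in_fset_set// inE.
    apply: (@le_trans _ _ (partial n)%:E); last by apply: ereal_sup_ubound; exists n.
    rewrite partialE; apply: lee_fsum_nneg_subset => //.
    - exact: finite_seq.
    - by move=> v; rewrite !inE => Av; apply/mem_nodes0; split; [exact: At|exact: hn].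
    - by move=> v _; rewrite lee_fin; exact: decor_ge0.
  apply: ub_ereal_sup => _ [n _ <-]; rewrite /= partialE.
  apply: esum_ge; exists [set` nodes n [::]] => //; split; first exact: finite_seq.
  by move=> v /= /mem_nodes0[].
exact: ereal_nondecreasing_cvgn.
Qed.

Hypothesis t0 : 0 <= t.

Definition laplace_total : R := fine (expeR (- (t%:E * total_decor S w))%E).

Lemma expeR_laplace : (expeR (- (t%:E * total_decor S w)) = laplace_total%:E)%E.
Proof.
rewrite fineK// ge0_fin_numE ?expeR_ge0//.
have : (0 <= t%:E * total_decor S w)%E.
  rewrite mule_ge0// esum_ge0// => v _; rewrite lee_fin; exact: decor_ge0.
case: (t%:E * _)%E => [r _|_|//]; [by rewrite /= ltry|by rewrite /= ltry].
Qed.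

Let laplace_cvg0 : expR (- (t * partial n)) @[n --> \oo] --> laplace_total.
Proof.
rewrite /laplace_total; have := partial_cvg.
have : (0 <= total_decor S w)%E by apply: esum_ge0 => v _; rewrite lee_fin; exact: decor_ge0.
case: (total_decor S w) => [r _ cr|_ cr|//].
- have {}cr : partial n @[n --> \oo] --> r by move/fine_cvgP : cr => [].
  rewrite /=.
  apply: (@cvg_comp _ _ _ (fun n => - (t * partial n)) expR); last exact: continuous_expR.
  by apply: cvgN; apply: cvgM => //; exact: cvg_cst.
- move: t0; rewrite le_eqVlt => /predU1P[<-|tp].
    rewrite mul0e oppe0 expeR0 /=.
    under eq_fun do rewrite mul0r oppr0 expR0.
    exact: cvg_cst.
  rewrite gt0_muley ?lte_fin//=.
  apply/cvgrPdist_le => e e0.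
  move/cvgeyPge : cr => /(_ (e * t)^-1); apply: filterS => n.
  rewrite lee_fin => h; rewrite sub0r normrN ger0_norm ?expR_ge0//.
  rewrite expRN -[leRHS]invrK lef_pV2 ?posrE ?expR_gt0 ?invr_gt0//.
  apply: le_trans (expR_ge1Dx _).
  have : t * (e * t)^-1 <= t * partial n by rewrite ler_pM2l.
  by rewrite invfM mulrCA mulfV ?gt_eqF// mulr1; lra.
Qed.

(** With the barrier, the truncated trees eventually see a vertex beyond it if there
    is one. *)
Lemma subtree_cvg x : subtree S t b n [::] x w @[n --> \oo] -->
  laplace_total * (b ==> `[< (sup_Lambda S w <= x%:E)%E >])%:R.
Proof.
under eq_fun do rewrite subtreeE position_nil addr0.
apply: cvgM; first exact: laplace_cvg0.
have [bt|bf] := boolP b; last by rewrite /=; exact: cvg_cst.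
rewrite /=; have [h|h] := asboolP (sup_Lambda S w <= x%:E)%E.
  have e n : all (fun v => Lambda S v w <= x)%R (nodes n [::]).
    apply/allP => v /mem_nodes0[tv _]; rewrite -lee_fin; apply: le_trans h.
    by apply: ereal_sup_ubound; exists v.
  under eq_fun do rewrite e.
  exact: cvg_cst.
have [v tv hv] : exists2 v, tree S w v & x < Lambda S v w.
  apply: contrapT => hn; apply: h; apply: ub_ereal_sup => _ [v tv <-].
  by rewrite lee_fin leNgt; apply/negP => hv; apply: hn; exists v.
have : (0 : R) @[n --> \oo] --> (0 : R) by exact: cvg_cst.
apply: cvg_trans; apply: near_eq_cvg; exists (size v).+1 => // n /= vn.
rewrite (_ : all _ _ = false)//; apply/negbTE/allPn; exists v; last by rewrite -ltNge.
by apply/mem_nodes0.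
Qed.

End nodes.

(** * Scaling limits *)

Section limits.
Context {R : realType} {d : measure_display} {T : measurableType d}
  {P : probability T R}.
Variables (sigma2 eta2 : R) (N : T -> nat) (X : nat -> T -> R) (M D : T -> R).
Hypothesis ol : offspring_law (P := P) sigma2 eta2 N X M D.
Hypotheses (sigma20 : 0 < sigma2) (eta20 : 0 < eta2).

Let F := laplace_functional (P := P) N X M D.

(* e t is the Laplace transform of the total decoration without barrier; the two
   bounds express that the event beyond the barrier has probability 1 - F 0 y *)
Variable e : R -> R.
Hypothesis e_ge : forall t y, 0 <= t -> F t y <= e t.
Hypothesis e_le : forall t y, 0 <= t -> e t <= F t y + (1 - F 0 y).

Let k : R := sigma2 / eta2.
Let c : R := 6 * eta2 / sigma2.
Let k0 : 0 < k. Proof. by rewrite divr_gt0. Qed.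
Let c0 : 0 < c. Proof. by rewrite divr_gt0// mulr_gt0. Qed.

(** The value of [w0] such that [t(r, alpha) = sigma2 / 2 * w0 ^+ 2]. *)
Let free_level (alpha r : R) : R := alpha / sigma2 * (c / r ^+ 2).

Let laplace_parameterE alpha r : 0 < r ->
  laplace_parameter sigma2 eta2 r alpha = sigma2 / 2 * free_level alpha r ^+ 2.
Proof.
move=> r0; rewrite /laplace_parameter /free_level /c; field.
by rewrite !gt_eqF.
Qed.

Let free_level_gt0 alpha r : 0 < alpha -> 0 < r -> 0 < free_level alpha r.
Proof.
move=> a0 r0; rewrite /free_level.
by apply: mulr_gt0; apply: divr_gt0 => //; exact: exprn_gt0.
Qed.

Let free_level_small alpha w1 : 0 < alpha -> 0 < w1 ->
  \forall r \near +oo, 0 < r /\ free_level alpha r <= w1.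
Proof.
move=> a0 w10; near=> r.
have r1 : 1 <= r by near: r; apply: nbhs_pinfty_ge; exact: num_real.
have rw : alpha / sigma2 * c / w1 <= r by near: r; apply: nbhs_pinfty_ge; exact: num_real.
split; first by apply: lt_le_trans r1.
rewrite /free_level mulrA ler_pdivrMr ?exprn_gt0 ?(lt_le_trans _ r1)//.
have h : alpha / sigma2 * c <= r * w1 by rewrite -ler_pdivrMr.
apply: le_trans h _; rewrite mulrC ler_pM2l// expr2.
by rewrite ler_peMl//; exact: le_trans r1.
Unshelve. all: by end_near.
Qed.

Lemma continuous_profile (x : R) : 0 < x -> {for x, continuous (@profile R)}.
Proof.
move=> x0; apply: differentiable_continuous; apply/derivable1_diffP.
by have [] := is_derive_profile x0.
Qed.

(** The limit of [r ^+ 2 * (1 - F t r)]. *)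
Let limit_value (alpha : R) : R :=
  c * (2 * alpha / sigma2 * profile (Num.sqrt (12 * alpha / sigma2)) + alpha / sigma2).

Let sq_alpha alpha r : 0 < alpha -> 0 < r ->
  Num.sqrt (2 * k * free_level alpha r) = Num.sqrt (12 * alpha / sigma2) / r.
Proof.
move=> a0 r0.
have -> : 2 * k * free_level alpha r = (12 * alpha / sigma2) / r ^+ 2.
  by rewrite /k /free_level /c; field; rewrite !gt_eqF.
rewrite sqrtrM ?divr_ge0 ?mulr_ge0 ?ltW// sqrtrV ?sqr_ge0//.
by rewrite sqrtr_sqr gtr0_norm.
Qed.

(** The scaling is exact for [B = 0], and a translation by a constant disappears in
    the limit. *)
Let scaled_stationary alpha B : 0 < alpha ->
  r ^+ 2 * stationary k (free_level alpha r) (r + B) @[r --> +oo] --> limit_value alpha.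
Proof.
move=> a0.
set th := Num.sqrt (12 * alpha / sigma2).
have th0 : 0 < th by rewrite sqrtr_gt0 divr_gt0// mulr_gt0.
have inv : r^-1 @[r --> +oo] --> (0 : R).
  by apply/gtr0_cvgV0; [exact: nbhs_pinfty_gt|exact: cvg_id].
have c1 : (th * (1 + B * r^-1)) @[r --> +oo] --> th.
  rewrite -[X in _ --> X]mulr1; apply: cvgM; first exact: cvg_cst.
  rewrite -[X in _ --> X]addr0; apply: cvgD; first exact: cvg_cst.
  by rewrite -[X in _ --> X](mulr0 B); apply: cvgM => //; exact: cvg_cst.
have c2 : (c * (2 * alpha / sigma2 * profile (th * (1 + B * r^-1)) + alpha / sigma2))
    @[r --> +oo] --> limit_value alpha.
  apply: cvgM; first exact: cvg_cst.
  apply: cvgD; last exact: cvg_cst.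
  apply: cvgM; first exact: cvg_cst.
  by apply: (@cvg_comp _ _ _ (fun r => th * (1 + B * r^-1)) (@profile R) _ _ _ c1); exact: continuous_profile.
apply: cvg_trans c2; apply: near_eq_cvg; near=> r.
have r0 : 0 < r by near: r; apply: nbhs_pinfty_gt; exact: num_real.
rewrite /stationary sq_alpha// -/th.
have -> : th / r * (r + B) = th * (1 + B * r^-1) by field; rewrite gt_eqF.
rewrite /free_level; move: (profile _) => p; field.
by rewrite !gt_eqF.
Unshelve. all: by end_near.
Qed.

Let tpar alpha r : R := laplace_parameter sigma2 eta2 r alpha.

Let tpar_ge0 alpha r : 0 <= tpar alpha r.
Proof. by rewrite /tpar /laplace_parameter mulr_ge0 ?sqr_ge0// divr_ge0 ?sqr_ge0// mulr_ge0// ltW. Qed.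

Let limit_value_gt0 alpha : 0 < alpha -> 0 < limit_value alpha.
Proof.
move=> a0; apply: mulr_gt0 => //; apply: addr_gt0; last exact: divr_gt0.
apply: mulr_gt0; first by rewrite divr_gt0// mulr_gt0.
by apply: profile_gt0; rewrite sqrtr_gt0 divr_gt0// mulr_gt0.
Qed.

(** The relative error [eps] is removed after [r] has tended to infinity, so [u] and
    [u'] may depend on it. *)
Let squeeze_eps (f : R -> R) (l : R) : 0 < l ->
  (forall eps, 0 < eps -> eps < 1 -> exists u u' : R -> R,
     [/\ u r @[r --> +oo] --> l, u' r @[r --> +oo] --> l &
      \forall r \near +oo, (1 - eps) * u r <= f r <= (1 + eps) * u' r]) ->
  f r @[r --> +oo] --> l.
Proof.
move=> l0 h; apply/cvgrPdist_le => d0 dp.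
pose eps := Num.min (1 / 2) (d0 / (4 * (l + 1))).
have l1 : 0 < 4 * (l + 1) by rewrite mulr_gt0// addr_gt0.
have eps0 : 0 < eps by rewrite lt_min divr_gt0//= divr_gt0.
have eps1 : eps < 1 by apply: (@le_lt_trans _ _ (1 / 2)); [rewrite ge_min lexx|lra].
have epsd : eps * (4 * (l + 1)) <= d0 by rewrite -ler_pdivlMr// ge_min lexx orbT.
have [u [u' [cu cu' hf]]] := h _ eps0 eps1.
pose d1 := Num.min 1 (d0 / 4).
have d10 : 0 < d1 by rewrite lt_min ltr01 divr_gt0.
have d11 : d1 <= 1 by rewrite ge_min lexx.
have d12 : d1 <= d0 / 4 by rewrite ge_min lexx orbT.
move/cvgrPdist_le : cu => /(_ _ d10) cu; move/cvgrPdist_le : cu' => /(_ _ d10) cu'.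
near=> r.
have /andP[f1 f2] : (1 - eps) * u r <= f r <= (1 + eps) * u' r by near: r.
have : `|l - u r| <= d1 by near: r.
have : `|l - u' r| <= d1 by near: r.
rewrite !ler_norml => /andP[a1 a2] /andP[a3 a4].
apply/andP; split.
  have : eps * u' r <= eps * (l + 1) by rewrite ler_pM2l//; lra.
  lra.
have : eps * u r <= eps * (l + 1) by rewrite ler_pM2l//; lra.
lra.
Unshelve. all: by end_near.
Qed.

Let cvg_barrier alpha : 0 < alpha ->
  r ^+ 2 * (1 - F (tpar alpha r) r) @[r --> +oo] --> limit_value alpha.
Proof.
move=> a0; apply: squeeze_eps; first exact: limit_value_gt0.
move=> eps eps0 eps1.
have [B1 B10 [w1 w10 h1]] := defect_ge_stationary ol sigma20 eta20 eps0 eps1.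
have [B2 B20 [w2 w20 h2]] := defect_le_stationary ol sigma20 eta20 eps0 eps1.
exists (fun r => r ^+ 2 * stationary k (free_level alpha r) (r + B1)).
exists (fun r => r ^+ 2 * stationary k (free_level alpha r) (r + - B2)).
split; [exact: scaled_stationary|exact: scaled_stationary|].
near=> r.
have [r0 f1] : 0 < r /\ free_level alpha r <= w1 by near: r; exact: free_level_small.
have [_ f2] : 0 < r /\ free_level alpha r <= w2 by near: r; exact: free_level_small.
have rB : 2 * B2 <= r by near: r; apply: nbhs_pinfty_ge; exact: num_real.
have fp := free_level_gt0 a0 r0.
have := h1 _ r fp f1 (ltW r0); have := h2 _ r fp f2 rB.
rewrite -/F /tpar laplace_parameterE// => k1 k2.
rewrite ![(_ + _) * (_ ^+ 2 * _)]mulrCA !ler_pM2l ?exprn_gt0//.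
by apply/andP; split; [exact: k2|exact: k1].
Unshelve. all: by end_near.
Qed.

Let cvg_stationary w0 B : 0 < w0 ->
  stationary k w0 (y + B) @[y --> +oo] --> w0.
Proof.
move=> w00; rewrite /stationary -[X in _ --> X]add0r; apply: cvgD; last exact: cvg_cst.
rewrite -[X in _ --> X](mulr0 (2 * w0)); apply: cvgM; first exact: cvg_cst.
have [_ _ _ p0] := @is_profile_profile R.
apply: (@cvg_comp _ _ _ (fun y => Num.sqrt (2 * k * w0) * (y + B)) (@profile R) _ _ _ _ p0).
apply/cvgryPge => A; near=> y.
have s0 : 0 < Num.sqrt (2 * k * w0) by rewrite sqrtr_gt0 mulr_gt0// mulr_gt0.
rewrite mulrC -ler_pdivrMr// -lerBlDr.
by near: y; apply: nbhs_pinfty_ge; exact: num_real.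
Unshelve. all: by end_near.
Qed.

Let extinct_barrier (e0 : R) : 0 < e0 -> \forall y \near +oo, 1 - F 0 y <= e0.
Proof.
move=> e00; have [L [t1 t10 h]] := defect_small ol sigma20 e00.
near=> y; apply: (h 0 y (lexx 0) (ltW t10)).
by near: y; apply: nbhs_pinfty_ge; exact: num_real.
Unshelve. all: by end_near.
Qed.

(** The bounds on the defect are uniform in the position [y] of the barrier.  As [y]
    tends to infinity the stationary solution tends to [free_level alpha r] and the
    probability of crossing the barrier to 0. *)
Let cvg_free alpha : 0 < alpha ->
  r ^+ 2 * (1 - e (tpar alpha r)) @[r --> +oo] --> alpha / sigma2 * c.
Proof.
move=> a0; apply: squeeze_eps; first by rewrite mulr_gt0// divr_gt0.
move=> eps eps0 eps1.
have [B1 B10 [w1 w10 h1]] := defect_ge_stationary ol sigma20 eta20 eps0 eps1.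
have [B2 B20 [w2 w20 h2]] := defect_le_stationary ol sigma20 eta20 eps0 eps1.
exists (fun r => r ^+ 2 * free_level alpha r), (fun r => r ^+ 2 * free_level alpha r).
have cf : r ^+ 2 * free_level alpha r @[r --> +oo] --> alpha / sigma2 * c.
  have : (fun _ : R => alpha / sigma2 * c) r @[r --> +oo] --> alpha / sigma2 * c by exact: cvg_cst.
  apply: cvg_trans; apply: near_eq_cvg; near=> r.
  have r0 : 0 < r by near: r; apply: nbhs_pinfty_gt; exact: num_real.
  by rewrite /free_level; field; rewrite !gt_eqF.
split => //; near=> r.
have [r0 f1] : 0 < r /\ free_level alpha r <= w1 by near: r; exact: free_level_small.
have [_ f2] : 0 < r /\ free_level alpha r <= w2 by near: r; exact: free_level_small.
have fp := free_level_gt0 a0 r0.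
rewrite ![(_ + _) * (_ ^+ 2 * _)]mulrCA !ler_pM2l ?exprn_gt0//.
have tE := laplace_parameterE alpha r0; rewrite -/(tpar alpha r) in tE.
apply/andP; split.
  apply/ler_addgt0Pr => d0 dp.
  have lim : ((1 - eps) * stationary k (free_level alpha r) (y + B1)) @[y --> +oo] -->
      (1 - eps) * free_level alpha r.
    by apply: cvgM; [exact: cvg_cst|exact: cvg_stationary].
  move/cvgrPdist_le : lim => /(_ (d0 / 2)) lim.
  near (+oo%R : set_system R) => y.
  have y0 : 0 <= y by near: y; apply: nbhs_pinfty_ge; exact: num_real.
  have q1 : 1 - F 0 y <= d0 / 2 by near: y; apply: extinct_barrier; rewrite divr_gt0.
  have q2 : `|(1 - eps) * free_level alpha r -
    (1 - eps) * stationary k (free_level alpha r) (y + B1)| <= d0 / 2.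
    by near: y; apply: lim; rewrite divr_gt0.
  have := h1 _ y fp f1 y0; rewrite -/F -tE => q3.
  have q4 := e_le y (tpar_ge0 alpha r).
  move: q2; rewrite ler_norml => /andP[_ q5]; lra.
apply/ler_addgt0Pr => d0 dp.
have lim : ((1 + eps) * stationary k (free_level alpha r) (y + - B2)) @[y --> +oo] -->
    (1 + eps) * free_level alpha r.
  by apply: cvgM; [exact: cvg_cst|exact: cvg_stationary].
move/cvgrPdist_le : lim => /(_ d0) lim.
near (+oo%R : set_system R) => y.
have yB : 2 * B2 <= y by near: y; apply: nbhs_pinfty_ge; exact: num_real.
have q2 : `|(1 + eps) * free_level alpha r -
  (1 + eps) * stationary k (free_level alpha r) (y + - B2)| <= d0.
  by near: y; exact: lim.
have := h2 _ y fp f2 yB; rewrite -/F -tE => q3.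
have q4 := e_ge y (tpar_ge0 alpha r).
move: q2; rewrite ler_norml => /andP[q5 _]; lra.
Unshelve. all: by end_near.
Qed.

(** Since [1 - F 0 r] lies between [(1 - F t r) - (1 - e t)] and [1 - F t r], its
    limit after multiplication by [r ^+ 2] is [c] up to errors which vanish with
    [alpha]: that of [1 - F t r] is close to [c] by [profile_at0], and that of
    [1 - e t] is proportional to [alpha]. *)
Let cvg_exit : r ^+ 2 * (1 - F 0 r) @[r --> +oo] --> c.
Proof.
apply/cvgrPdist_le => d0 dp.
have dc : 0 < d0 / (4 * c) by rewrite divr_gt0// mulr_gt0.
pose d1 := d0 / (4 * c).
have cd1 : c * d1 = d0 / 4 by rewrite /d1; field; rewrite gt_eqF.
have := @profile_at0 R; move/cvgrPdist_le => /(_ _ dc) near0.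
near (0 : R)^'+ => a.
have a0 : 0 < a by near: a; exact: nbhs_right_gt.
have ad : a <= d1 by near: a; exact: nbhs_right_le.
have pa : `|1 - 2 * a * profile (Num.sqrt (12 * a))| <= d1 by near: a.
pose alpha := a * sigma2.
have al0 : 0 < alpha by rewrite mulr_gt0.
have aE : alpha / sigma2 = a by rewrite mulfK// gt_eqF.
have LE : limit_value alpha = c * (2 * a * profile (Num.sqrt (12 * a)) + a).
  have e2 : 2 * alpha / sigma2 = 2 * a by rewrite -aE mulrA.
  have e12 : 12 * alpha / sigma2 = 12 * a by rewrite -aE mulrA.
  by rewrite /limit_value e2 e12 aE.
have d40 : 0 < d0 / 4 by rewrite divr_gt0.
move/cvgrPdist_le : (cvg_barrier al0) => /(_ _ d40) cb.
move/cvgrPdist_le : (cvg_free al0) => /(_ _ d40) cf.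
near=> r.
have r0 : 0 < r by near: r; apply: nbhs_pinfty_gt; exact: num_real.
have h1 : `|limit_value alpha - r ^+ 2 * (1 - F (tpar alpha r) r)| <= d0 / 4 by near: r.
have h2 : `|alpha / sigma2 * c - r ^+ 2 * (1 - e (tpar alpha r))| <= d0 / 4 by near: r.
have t0 := tpar_ge0 alpha r.
have F0 : F (tpar alpha r) r <= F 0 r by apply: (laplace_le ol).
have e0 := e_le r t0.
have r20 : 0 < r ^+ 2 by rewrite exprn_gt0.
have k1 : r ^+ 2 * (1 - F 0 r) <= r ^+ 2 * (1 - F (tpar alpha r) r).
  by rewrite ler_pM2l//; lra.
have k2 : r ^+ 2 * (1 - F (tpar alpha r) r) - r ^+ 2 * (1 - e (tpar alpha r)) <=
    r ^+ 2 * (1 - F 0 r).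
  by rewrite -mulrBr ler_pM2l//; lra.
have ca : c * a <= d0 / 4 by rewrite -cd1 ler_pM2l.
have cp : `|c - c * (2 * a * profile (Num.sqrt (12 * a)))| <= d0 / 4.
  by rewrite -cd1 -{1}[c]mulr1 -mulrBr normrM (gtr0_norm c0) ler_pM2l.
rewrite LE in h1; rewrite aE in h2.
move: h1 h2 cp; rewrite !ler_norml => /andP[a1 a2] /andP[a3 a4] /andP[a5 a6].
have caN : 0 < c * a by rewrite mulr_gt0.
by apply/andP; split; move: a1 a2 a3 a4 a5 a6 k1 k2 ca caN; forget_after d0; lra.
Unshelve. all: by end_near.
Qed.

(** On the event below the barrier, [1 - F t r / F 0 r] is the difference of
    [1 - F t r] and [1 - F 0 r] divided by [F 0 r], which tends to 1; above the
    barrier, numerator and denominator are both of order [r ^- 2]. *)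
Theorem conditional_limits psi alpha : is_profile psi -> 0 < alpha ->
  r ^+ 2 * (1 - F (tpar alpha r) r / F 0 r) @[r --> +oo] --> rate psi sigma2 eta2 alpha /\
  (e (tpar alpha r) - F (tpar alpha r) r) / (1 - F 0 r) @[r --> +oo] -->
    profile_at psi sigma2 alpha.
Proof.
move=> psiP a0.
have th0 : 0 < Num.sqrt (12 * alpha / sigma2) by rewrite sqrtr_gt0 divr_gt0// mulr_gt0.
have psiE : psi (Num.sqrt (12 * alpha / sigma2)) = profile (Num.sqrt (12 * alpha / sigma2)).
  exact: profile_unique.
have cb := cvg_barrier a0; have cf := cvg_free a0; have cx := cvg_exit.
have F01 : F 0 r @[r --> +oo] --> (1 : R).
  apply/cvgrPdist_le => d0 dp; near=> r.
  have h : 1 - F 0 r <= d0 by near: r; exact: extinct_barrier.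
  rewrite ger0_norm// subr_ge0.
  by have /andP[] := laplace_bounds ol (lexx (0 : R)) r.
split.
- have : ((r ^+ 2 * (1 - F (tpar alpha r) r) - r ^+ 2 * (1 - F 0 r)) / F 0 r)
      @[r --> +oo] --> (limit_value alpha - c) / 1.
    apply: cvgM; first exact: cvgB.
    by apply: cvgV => //; exact: oner_neq0.
  have -> : (limit_value alpha - c) / 1 = rate psi sigma2 eta2 alpha.
    rewrite /limit_value /rate /profile_at psiE /c; move: (profile _) => p.
    by field; rewrite gt_eqF.
  apply: cvg_trans; apply: near_eq_cvg; near=> r.
  have Fp : F 0 r != 0.
    have : `|1 - F 0 r| <= 1 / 2.
      by near: r; move/cvgrPdist_le : F01; apply; rewrite divr_gt0.
    by rewrite ler_norml => /andP[_ h]; rewrite gt_eqF//; lra.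
  by field.
- have : ((r ^+ 2 * (1 - F (tpar alpha r) r) - r ^+ 2 * (1 - e (tpar alpha r)))
      / (r ^+ 2 * (1 - F 0 r))) @[r --> +oo] --> (limit_value alpha - alpha / sigma2 * c) / c.
    apply: cvgM; first exact: cvgB.
    by apply: cvgV => //; rewrite gt_eqF.
  have -> : (limit_value alpha - alpha / sigma2 * c) / c = profile_at psi sigma2 alpha.
    rewrite /limit_value /profile_at psiE; move: (profile _) => p; field.
    by rewrite !gt_eqF.
  apply: cvg_trans; apply: near_eq_cvg; near=> r.
  have r0 : 0 < r by near: r; apply: nbhs_pinfty_gt; exact: num_real.
  have q0 : 0 < r ^+ 2 * (1 - F 0 r).
    have : `|c - r ^+ 2 * (1 - F 0 r)| <= c / 2.
      by near: r; move/cvgrPdist_le : cx; apply; rewrite divr_gt0.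
    by rewrite ler_norml => /andP[_ h]; have := c0; lra.
  have q1 : 1 - F 0 r != 0.
    by apply/negP => /eqP q; rewrite q mulr0 ltxx in q0.
  by field; rewrite q1 gt_eqF.
Unshelve. all: by end_near.
Qed.

End limits.

(** * From a reproduction scheme to an offspring law *)

Section atomic_measure.
Context {R : realType}.
Implicit Types (n : nat) (x : nat -> R).

Lemma atomic_setT n x : atomic n x setT = n%:R%:E.
Proof.
transitivity (\sum_(i < n) (dirac (x i) setT : \bar R))%E => //.
under eq_bigr => i _ do rewrite diracT.
by rewrite sumEFin sumr_const card_ord.
Qed.

Lemma ge0_integral_atomic n x (f : R -> \bar R) : measurable_fun setT f ->
  (forall y, 0 <= f y)%E ->
  (\int[atomic n x]_y f y = \sum_(i < n) f (x i))%E.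
Proof.
move=> mf f0; rewrite /atomic ge0_integral_measure_sum//.
by apply: eq_bigr => i _; rewrite integral_dirac// diracT mul1e.
Qed.

(** The positive and negative parts are integrated separately against the sum of
    Dirac measures. *)
Lemma integral_atomic n x (f : R -> R) : measurable_fun setT f ->
  (\int[atomic n x]_y (f y)%:E = (\sum_(i < n) f (x i))%:E)%E.
Proof.
move=> /measurable_EFinP mf; rewrite integralE.
rewrite ge0_integral_atomic//; last exact: measurable_funepos.
rewrite ge0_integral_atomic//; last exact: measurable_funeneg.
have mE (a b : R) : maxe a%:E b%:E = (Num.max a b)%:E by rewrite EFin_max.
under eq_bigr => i _ do rewrite funeposE mE.
under [X in (_ - X)%E]eq_bigr => i _ do rewrite funenegE mE.
rewrite !sumEFin -EFinB -sumrB; congr EFin; apply: eq_bigr => i _.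
by case: (leP (f (x i)) 0); case: (leP (- f (x i)) 0); lra.
Qed.

(** Relates the supremum of the support, bounded by [lambda], to the atoms. *)
Lemma atom_support n x (i : 'I_n) : msupport (atomic n x) (x i).
Proof.
move=> U _ Ui; have -> : atomic n x U = (\sum_(i < n) (dirac (x i) U : \bar R))%E by [].
rewrite (bigD1 i)//=.
apply: (@lt_le_trans _ _ (dirac (x i) U)); first by rewrite diracE mem_set.
by rewrite leeDl// sume_ge0.
Qed.

End atomic_measure.

Section scheme_law.
Context {R : realType} {d : measure_display} {T : measurableType d}
  {P : probability T R} (s : scheme P).

Lemma summable_integral (f : T -> R) (c : R) : measurable_fun setT f ->
  (forall w, 0 <= f w) -> (\int[P]_w (f w)%:E = c%:E)%E ->
  summable P f /\ expect P f = c.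
Proof.
move=> mf f0 If; split; last by rewrite /expect /Rintegral If.
apply/integrableP; split; first exact/measurable_EFinP.
under eq_integral => w _ do rewrite /= ger0_norm//.
by rewrite If ltry.
Qed.

Lemma expect_ae (f g : T -> R) : measurable_fun setT f -> measurable_fun setT g ->
  {ae P, forall w, f w = g w} -> expect P f = expect P g.
Proof.
move=> mf mg fg; rewrite /expect /Rintegral; congr fine.
apply: ae_eq_integral => //; [exact/measurable_EFinP|exact/measurable_EFinP|].
by apply: filterS fg => w /= -> .
Qed.

(** Equal to [lambda s] almost surely, and at least as large as all the atoms at every
    sample point. *)
Definition reach (w : T) : R :=
  lambda s w + \sum_(i < natoms s w) Num.max 0 (atom s i w - lambda s w).

Lemma measurable_reach : measurable_fun setT reach.
Proof.
apply: measurable_funD => //.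
apply: (measurable_random_sum (h := fun i w => Num.max 0 (atom s i w - lambda s w))) => // i.
by apply: measurable_maxr => //; exact: measurable_funB.
Qed.

Lemma reach_ge0 w : 0 <= reach w.
Proof.
by rewrite addr_ge0 ?lambda_ge0// sumr_ge0// => i _; rewrite le_max lexx.
Qed.

Lemma atom_le_reach w i : (i < natoms s w)%N -> atom s i w <= reach w.
Proof.
move=> iN; rewrite /reach (bigD1 (Ordinal iN))//=.
have h1 : atom s i w - lambda s w <= Num.max 0 (atom s i w - lambda s w).
  by rewrite le_max lexx orbT.
have h2 : 0 <= \sum_(j < natoms s w | j != Ordinal iN) Num.max 0 (atom s j w - lambda s w).
  by apply: sumr_ge0 => j _; rewrite le_max lexx.
move: h1 h2; set a := Num.max _ _; set b := bigop.body _ _ _; lra.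
Qed.

Lemma reach_ae : {ae P, forall w, reach w = lambda s w}.
Proof.
apply: filterS (lambda_ge_sup s) => w h; rewrite /reach big1 ?addr0// => i _.
apply/max_idPl; rewrite subr_le0 -lee_fin; apply: le_trans h.
apply: ereal_sup_ubound; exists (atom s i w) => //.
exact: (@atom_support _ (natoms s w) (fun i => atom s i w) i).
Qed.

(** The moments of the point process are moments of sums over its atoms. *)
Lemma offspring_law_scheme sigma2 eta2 : standing_assumptions s sigma2 eta2 ->
  offspring_law (P := P) sigma2 eta2 (natoms s) (fun i => atom s i) reach (decor s).
Proof.
move=> [h1 h2 [_ h3] [_ h4] [h5 h6]].
have mN : measurable_fun setT (fun w => (natoms s w)%:R : R).
  by apply: (measurable_random_index (G := fun n _ => n%:R)).
have mX2 : measurable_fun setT (fun w => \sum_(i < natoms s w) atom s i w ^+ 2).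
  apply: (measurable_random_sum (h := fun i w => atom s i w ^+ 2)) => // i.
  exact: measurable_funX.
have [iN eN] : summable P (fun w => (natoms s w)%:R) /\ expect P (fun w => (natoms s w)%:R) = 1.
  apply: summable_integral => //; rewrite -h1.
  by apply: eq_integral => w _; rewrite /chi atomic_setT.
have [iN2 eN2] : summable P (fun w => (natoms s w)%:R ^+ 2) /\
    expect P (fun w => (natoms s w)%:R ^+ 2) = sigma2 + 1.
  apply: summable_integral; [exact: measurable_funX|by move=> w; exact: sqr_ge0|].
  by rewrite -h3; apply: eq_integral => w _; rewrite /chi atomic_setT EFin_expe.
have [iS2 eS2] : summable P (fun w => \sum_(i < natoms s w) atom s i w ^+ 2) /\
    expect P (fun w => \sum_(i < natoms s w) atom s i w ^+ 2) = eta2.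
  apply: summable_integral => //; first by move=> w; rewrite sumr_ge0// => i _; exact: sqr_ge0.
  rewrite -h4; apply: eq_integral => w _; rewrite /chi integral_atomic//.
have [iD eD] : summable P (decor s) /\ expect P (decor s) = 1.
  apply: summable_integral => //; first exact: decor_ge0.
  by move: h6; rewrite unlock.
split => //.
- exact: measurable_reach.
- exact: reach_ge0.
- exact: decor_ge0.
- exact: atom_le_reach.
- rewrite /expect /Rintegral.
  under eq_integral => w _.
    rewrite -(@integral_atomic _ (natoms s w) (fun i => atom s i w) id)//.
  over.
  by rewrite h2.
- move=> e e0; have [m0 [_ hm]] := h5 _ e0.
  exists (Num.max 1 (m0 + 1)); first by rewrite lt_max ltr01.
  move=> m; rewrite ge_max => /andP[m1 mm].
  have mlt : measurable [set w | (m < lambda s w)%R].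
    by rewrite -[X in measurable X]setTI; apply: (measurable_fun_ltr (measurable_cst m)).
  have hE : expect P (fun w => (m < reach w)%R%:R) = expect P (\1_[set w | (m < lambda s w)%R]).
    apply: expect_ae => //.
    - by apply: measurable_boolR; apply: measurable_fun_ltr => //; exact: measurable_reach.
    - apply: filterS reach_ae => w ->; rewrite indicE.
      by have [h|/negP h] := boolP (m < lambda s w); [rewrite mem_set|rewrite memNset].
  rewrite hE /expect /Rintegral integral_indic// setIT -lee_fin fineK ?fin_num_measure//.
  have := hm m; rewrite -exprVn => h; apply: le_trans (h _) _.
    by apply: lt_le_trans mm; lra.
  by rewrite exprVn.
Qed.

End scheme_law.

(** * Conditional Laplace transforms *)

Section branching_random_walk_law.
Context {R : realType} {d : measure_display} {T : measurableType d}
  {P : probability T R} {d0 : measure_display} {T0 : measurableType d0}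
  {P0 : probability T0 R} (s : scheme P0) (S : word -> scheme P).
Variables sigma2 eta2 : R.
Hypothesis assum : standing_assumptions s sigma2 eta2.
Hypotheses (law : forall u, same_law s (S u)) (indep : independent_schemes S).
Implicit Types (t r : R) (b : bool) (n : nat).

Let ol := offspring_law_scheme assum.
Let lap := laplace_trunc (P := P0) (natoms s) (fun i => atom s i) (reach s) (decor s).
Let F := laplace_functional (P := P0) (natoms s) (fun i => atom s i) (reach s) (decor s).
Let below r (w : T) : bool := `[< (sup_Lambda S w <= r%:E)%E >].
Let L t w := laplace_total S w t.

(** [lambda] and [reach] agree almost surely. *)
Lemma laplace_rec_trunc t n r : 0 <= t -> laplace_rec s t true n r = lap t n r.
Proof.
move=> t0; elim: n r => [|n ih] r //=.
have -> : laplace_rec s t true n = lap t n by exact/funext.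
have [mg _] := laplace_trunc_unit ol n t0.
apply: expect_ae.
- apply: (@measurable_mark_step _ t true _ T0 (fun _ y _ => lap t n y) (fun=> r) (mark_of s)) => //.
    exact: measurable_mark_of.
  by move=> i; exact: (measurableT_comp mg measurable_fst).
- exact: (measurable_branching_step ol).
- by apply: filterS (reach_ae s) => w h; rewrite /mark_step /branching_step /= h.
Qed.

(** The supremum and the total decoration are measurable as limits of truncated
    trees. *)
Let measurable_limit b t r : 0 <= t ->
  measurable_fun setT (fun w => L t w * (b ==> below r w)%:R).
Proof.
move=> t0; apply: (@measurable_fun_cvg _ _ _ _ (fun n => subtree S t b n [::] r)).
  by move=> n; exact: measurable_subtreeT.
by move=> w _; exact: subtree_cvg.
Qed.

Let limit_unit b t r w : 0 <= t -> 0 <= L t w * (b ==> below r w)%:R <= 1.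
Proof.
move=> t0; have c := @subtree_cvg _ _ _ _ S w t b t0 r.
have u n := subtree_unit S b t0 n [::] r w.
rewrite -(cvg_lim _ c)//; apply/andP; split.
  by apply: limr_ge; [apply/cvg_ex; eexists; exact: c|apply: nearW => n; case/andP: (u n)].
by apply: limr_le; [apply/cvg_ex; eexists; exact: c|apply: nearW => n; case/andP: (u n)].
Qed.

Let measurable_L t : 0 <= t -> measurable_fun setT (L t).
Proof.
by move=> t0; have := measurable_limit false 0 t0; under eq_fun do rewrite mulr1.
Qed.

Let L_unit t w : 0 <= t -> 0 <= L t w <= 1.
Proof. by move=> t0; have := limit_unit false 0 w t0; rewrite mulr1. Qed.

Let summable_L t : 0 <= t -> summable P (L t).
Proof.
move=> t0; apply: (@summable_bounded _ _ _ _ _ 1 (measurable_L t0)) => w.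
by have /andP[h0 h1] := L_unit w t0; rewrite ger0_norm.
Qed.

Let L0 w : L 0 w = 1.
Proof. by rewrite /L /laplace_total mul0e oppe0 expeR0. Qed.

Let measurable_below r : measurable_fun setT (fun w => (below r w)%:R : R).
Proof.
by have := measurable_limit true r (lexx 0); under eq_fun do rewrite L0 mul1r.
Qed.

Let summable_below r : summable P (fun w => (below r w)%:R).
Proof.
apply: (@summable_bounded _ _ _ _ _ 1) => // w.
by case: (below r w); rewrite ?normr1 ?normr0.
Qed.

Let summable_L_below t r : 0 <= t -> summable P (fun w => L t w * (below r w)%:R).
Proof.
move=> t0; apply: (@summable_bounded _ _ _ _ _ 1); first exact: (measurable_limit true).
by move=> w; have /andP[h0 h1] := limit_unit true r w t0; rewrite ger0_norm.
Qed.

(** The truncated trees exhaust the tree, and all the functionals lie in the unit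
    interval. *)
Lemma expect_laplace_below t r : 0 <= t ->
  expect P (fun w => L t w * (below r w)%:R) = F t r.
Proof.
move=> t0; rewrite -[RHS](cvg_lim _ (@laplace_cvg _ _ _ _ _ _ _ _ _ _ ol t t0 r))//.
apply/esym/cvg_lim => //.
rewrite [X in X @ _](_ : _ = (fun n => expect P (subtree S t true n [::] r))); last first.
  apply/funext => n; rewrite -/lap -laplace_rec_trunc// /expect /Rintegral.
  by rewrite (integral_subtree indep law true t0).
apply: (@expect_cvg _ _ _ _ _ _ (fun=> 1)).
- by move=> n; exact: measurable_subtreeT.
- exact: (measurable_limit true).
- exact: summable_cst.
- by move=> n w; have /andP[h0 h1] := subtree_unit S true t0 n [::] r w; rewrite ger0_norm.
- by move=> w; exact: subtree_cvg.
Qed.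

Let expect_below r : expect P (fun w => (below r w)%:R) = F 0 r.
Proof.
rewrite -(expect_laplace_below r (lexx 0)); congr (expect P _); apply/funext => w.
by rewrite L0 mul1r.
Qed.

Definition laplace_free t : R := expect P (L t).

Lemma laplace_free_ge t r : 0 <= t -> F t r <= laplace_free t.
Proof.
move=> t0; rewrite -expect_laplace_below//; apply: expect_le.
- exact: summable_L_below.
- exact: summable_L.
- move=> w; have /andP[h0 h1] := L_unit w t0.
  by case: (below r w); rewrite ?mulr1 ?mulr0.
Qed.

(** The part of the expectation beyond the barrier is at most the probability of
    crossing it. *)
Lemma laplace_free_le t r : 0 <= t -> laplace_free t <= F t r + (1 - F 0 r).
Proof.
move=> t0; rewrite -expect_laplace_below// -expect_below -[X in _ + (X - _)](expect_cst P 1).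
rewrite -expectB//; last exact: summable_cst.
rewrite -expectD//; last 2 first.
- exact: summable_L_below.
- by apply: summableB => //; exact: summable_cst.
apply: expect_le.
- exact: summable_L.
- apply: summableD; first exact: summable_L_below.
  by apply: summableB => //; exact: summable_cst.
- move=> w; have /andP[h0 h1] := L_unit w t0.
  by case: (below r w); rewrite ?mulr1 ?subrr ?addr0// mulr0 subr0 add0r.
Qed.

Lemma cond_expectationE t (A : set T) (b : T -> bool) : 0 <= t ->
  measurable_fun setT (fun w => (b w)%:R : R) -> (forall w, A w <-> b w) ->
  cond_expectation P (fun w => expeR (- (t%:E * total_decor S w)))%E A =
  expect P (fun w => L t w * (b w)%:R) / expect P (fun w => (b w)%:R).
Proof.
move=> t0 mb Ab; have mA : measurable A.
  have -> : A = (fun w => (b w)%:R : R) @^-1` [set 1].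
    apply/seteqP; split=> w /=; first by move=> /Ab ->.
    have [bw _|_] := boolP (b w); first exact/Ab.
    by move/eqP; rewrite eq_sym oner_eq0.
  by rewrite -[X in measurable X]setTI; exact: mb.
have bE w : (b w)%:R = \1_A w :> R.
  rewrite indicE; have [bw|/negP bw] := boolP (b w).
    by rewrite mem_set//; exact/Ab.
  by rewrite memNset// => /Ab.
rewrite /cond_expectation; congr (_ / _).
  rewrite integral_mkcond /expect /Rintegral; congr fine; apply: eq_integral => w _.
  rewrite patchE bE indicE /L; case: ifP => _; last by rewrite mulr0.
  by rewrite mulr1; exact: expeR_laplace.
rewrite /expect /Rintegral; congr fine.
under eq_integral => w _ do rewrite bE.
by rewrite integral_indic// setIT.
Qed.

Lemma cond_laplace_below t r : 0 <= t ->
  cond_expectation P (fun w => expeR (- (t%:E * total_decor S w)))%E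
    [set w | (sup_Lambda S w <= r%:E)%E] = F t r / F 0 r.
Proof.
move=> t0; rewrite (@cond_expectationE _ _ (below r))//.
  by rewrite expect_laplace_below// expect_below.
by move=> w; split=> /asboolP.
Qed.

Lemma cond_laplace_above t r : 0 <= t ->
  cond_expectation P (fun w => expeR (- (t%:E * total_decor S w)))%E
    [set w | (r%:E < sup_Lambda S w)%E] = (laplace_free t - F t r) / (1 - F 0 r).
Proof.
move=> t0.
have bN w : (~~ below r w)%:R = 1 - (below r w)%:R :> R.
  by case: (below r w); rewrite ?subrr ?subr0.
rewrite (@cond_expectationE _ _ (fun w => ~~ below r w))//.
- rewrite -expect_laplace_below// -expect_below /laplace_free; congr (_ / _).
    rewrite -expectB; [|exact: summable_L|exact: summable_L_below].
    by congr (expect P _); apply/funext => w; rewrite bN mulrBr mulr1.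
  rewrite -[X in _ = X - _](expect_cst P 1) -expectB//; last exact: summable_cst.
  by congr (expect P _); apply/funext.
- under eq_fun do rewrite bN.
  exact: measurable_funB.
- move=> w; rewrite /below /= ltNge; split=> [h|/negP h].
    by apply/negP => /asboolP; exact/negP.
  by apply/negP => h'; apply: h; exact/asboolP.
Qed.

End branching_random_walk_law.

(** * The rate near zero and the theorem *)

Section rate_at_zero.
Context {R : realType} (psi : R -> R) (sigma2 eta2 : R).
Hypotheses (psiP : is_profile psi) (sigma20 : 0 < sigma2) (eta20 : 0 < eta2).
Implicit Type alpha : R.

Lemma rateE alpha : 0 < alpha -> sigma2 / (6 * eta2) * rate psi sigma2 eta2 alpha =
  2 * (alpha / sigma2) * profile (Num.sqrt (12 * (alpha / sigma2))) - 1 + alpha / sigma2.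
Proof.
move=> a0; rewrite /rate /profile_at -[12 * alpha / sigma2]mulrA (profile_unique psiP)//.
  by move: (profile _) => p; field; rewrite !gt_eqF.
by rewrite sqrtr_gt0 mulr_gt0// divr_gt0.
Qed.

(** [1 / 384] is the radius in [rate_series]. *)
Lemma near0_scaled : \forall alpha \near 0^'+, 0 < alpha /\ alpha / sigma2 <= 1 / 384.
Proof.
have c0 : 0 < (1 / 384 : R) by lra.
near=> alpha.
split; first by near: alpha; exact: nbhs_right_gt.
rewrite ler_pdivrMr//; near: alpha; apply: nbhs_right_le.
exact: mulr_gt0.
Unshelve. all: by end_near.
Qed.

(** [rate_estimate] for five terms; the constant is [2 * 24 ^+ 5] rescaled by
    [sigma2]. *)
Lemma rate_estimate5 : exists2 C : R, 0 < C & \forall alpha \near 0^'+,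
  `| sigma2 / (6 * eta2) * rate psi sigma2 eta2 alpha -
     (3 / 5 * (alpha / sigma2) ^+ 2 - 2 / 7 * (alpha / sigma2) ^+ 3
      + 3 / 25 * (alpha / sigma2) ^+ 4) | <= C * alpha ^+ 5.
Proof.
exists (2 * (24 / sigma2) ^+ 5); first by rewrite mulr_gt0// exprn_gt0// divr_gt0.
apply: filterS near0_scaled => alpha [a0 a1].
have := rate_estimate 5 (divr_gt0 a0 sigma20) a1; rewrite -rateE//.
have [c0 c1 c2 c3 c4] := @rate_coefE R.
rewrite big_mkord !big_ord_recr big_ord0 /= c0 c1 c2 c3 c4.
have -> : 0 + 0 * (alpha / sigma2) ^+ 0 + 0 * (alpha / sigma2) ^+ 1 +
    3 / 5 * (alpha / sigma2) ^+ 2 + - (2 / 7) * (alpha / sigma2) ^+ 3 +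
    3 / 25 * (alpha / sigma2) ^+ 4 = 3 / 5 * (alpha / sigma2) ^+ 2 -
    2 / 7 * (alpha / sigma2) ^+ 3 + 3 / 25 * (alpha / sigma2) ^+ 4 by ring.
have -> : 2 * (24 * (alpha / sigma2)) ^+ 5 = 2 * (24 / sigma2) ^+ 5 * alpha ^+ 5.
  by field; rewrite gt_eqF.
by [].
Qed.

Lemma cvg_scaled : alpha / sigma2 @[alpha --> 0^'+] --> (0 : R)^'+.
Proof.
move=> A [e /= e0 eA]; exists (e * sigma2); first by rewrite /= mulr_gt0.
move=> a /= ha a0; apply: eA => /=; last by rewrite divr_gt0.
by move: ha; rewrite !sub0r !normrN normf_div (gtr0_norm sigma20) ltr_pdivrMr.
Qed.

Lemma rate_at0 : rate psi sigma2 eta2 alpha @[alpha --> 0^'+] --> (0 : R).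
Proof.
have id0 : alpha / sigma2 @[alpha --> 0^'+] --> (0 : R).
  by move=> A hA; apply: cvg_scaled; exact: cvg_within hA.
have : 6 * eta2 / sigma2 * (2 * (alpha / sigma2) *
    profile (Num.sqrt (12 * (alpha / sigma2))) - 1 + alpha / sigma2)
    @[alpha --> 0^'+] --> 6 * eta2 / sigma2 * (1 - 1 + 0).
  apply: cvgM; first exact: cvg_cst.
  apply: cvgD => //; apply: cvgB; last exact: cvg_cst.
  exact: (cvg_comp _ _ cvg_scaled (@profile_at0 R)).
rewrite subrr addr0 mulr0; apply: cvg_trans; apply: near_eq_cvg.
near=> alpha; have a0 : 0 < alpha by near: alpha; exact: nbhs_right_gt.
rewrite -rateE//; move: (rate _ _ _ _) => p; field.
by rewrite !gt_eqF.
Unshelve. all: by end_near.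
Qed.

Lemma rate_series_scaled : \forall alpha \near 0^'+,
  (\sum_(0 <= k < n) rate_coef k * (alpha / sigma2) ^+ k) @[n --> \oo] -->
  sigma2 / (6 * eta2) * rate psi sigma2 eta2 alpha.
Proof.
apply: filterS near0_scaled => alpha [a0 a1]; rewrite rateE//.
by apply: rate_series => //; rewrite divr_gt0.
Qed.

End rate_at_zero.

Theorem theorem4 (R : realType) :
  (exists psi : R -> R, is_profile psi) /\
  (forall psi1 psi2 : R -> R, is_profile psi1 -> is_profile psi2 ->
     forall x, 0 < x -> psi1 x = psi2 x) /\
  forall psi : R -> R, is_profile psi ->
  forall sigma2 eta2 : R, 0 < sigma2 -> 0 < eta2 ->
  [/\ cvg (rate psi sigma2 eta2 alpha @[alpha --> 0^'+]),
      exists a : nat -> R,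
        [/\ a 0%N = 0, a 1%N = 0, a 2%N = 3 / 5, a 3%N = - (2 / 7) & a 4%N = 3 / 25] /\
        \forall alpha \near 0^'+,
          (\sum_(0 <= k < n) a k * (alpha / sigma2) ^+ k) @[n --> \oo] -->
          sigma2 / (6 * eta2) * rate psi sigma2 eta2 alpha,
      exists2 C : R, 0 < C & \forall alpha \near 0^'+,
        `| sigma2 / (6 * eta2) * rate psi sigma2 eta2 alpha -
           (3 / 5 * (alpha / sigma2) ^+ 2 - 2 / 7 * (alpha / sigma2) ^+ 3
            + 3 / 25 * (alpha / sigma2) ^+ 4) | <= C * alpha ^+ 5 &
      forall (d0 : measure_display) (T0 : measurableType d0) (P0 : probability T0 R)
        (s : scheme P0) (d : measure_display) (T : measurableType d)
        (P : probability T R) (S : word -> scheme P),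
      standing_assumptions s sigma2 eta2 ->
      (forall u : word, same_law s (S u)) -> independent_schemes S ->
      forall alpha : R, 0 < alpha ->
        (r ^+ 2 * (1 - cond_expectation P
             (fun w => expeR (- ((laplace_parameter sigma2 eta2 r alpha)%:E * total_decor S w)))
             [set w | (sup_Lambda S w <= r%:E)%E]))
          @[r --> +oo] --> rate psi sigma2 eta2 alpha
        /\
        cond_expectation P
             (fun w => expeR (- ((laplace_parameter sigma2 eta2 r alpha)%:E * total_decor S w)))
             [set w | (r%:E < sup_Lambda S w)%E]
          @[r --> +oo] --> profile_at psi sigma2 alpha].
Proof.
split; first by exists profile; exact: is_profile_profile.
split.
  by move=> psi1 psi2 h1 h2 x x0; rewrite (profile_unique h1 x0) (profile_unique h2 x0).
move=> psi psiP sigma2 eta2 sigma20 eta20; split.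
- by apply/cvg_ex; exists 0; exact: rate_at0.
- exists rate_coef; split; first exact: rate_coefE.
  exact: rate_series_scaled.
- exact: rate_estimate5.
move=> d0 T0 P0 s d T P S assum law indep alpha a0.
have t0 r : 0 <= laplace_parameter sigma2 eta2 r alpha.
  by rewrite /laplace_parameter mulr_ge0 ?sqr_ge0// divr_ge0 ?sqr_ge0// mulr_ge0// ltW.
under eq_fun do rewrite (cond_laplace_below assum law indep _ (t0 _)).
under [X in _ /\ X @ _ --> _]eq_fun do rewrite (cond_laplace_above assum law indep _ (t0 _)).
apply: (conditional_limits (offspring_law_scheme assum) sigma20 eta20) => //.
- by move=> t y; exact: (laplace_free_ge assum law indep).
- by move=> t y; exact: (laplace_free_le assum law indep).
Qed.
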